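(* For every fixed $\varepsilon>0$, as $x\to\infty$ ($x$ real), $$\sum_{\substack{m,n\le x\\ \gcd(m,n)>1}}s(m,n)=x^2\left(\sum_{r=0}^3C_r(\log x)^r\right)+O\left(x^{\frac{1117}{701}+\varepsilon}\right),$$ $$\sum_{\substack{m,n\le x\\ \gcd(m,n)>1}}c(m,n)=x^2\left(\sum_{r=0}^3D_r(\log x)^r\right)+O\left(x^{\frac{1117}{701}+\varepsilon}\right),$$ where the sums run over pairs of positive integers, the implied constants depend only on $\varepsilon$, $C_3=A_3$, $D_3=B_3$, and $C_r=A_r-b_r$, $D_r=B_r-b_r$ for $0\le r\le2$, with the constants $A_r,B_r$ ($0\le r\le 3$) as defined in the context and $$b_2=\sum_{K=1}^\infty\mu(K)\left(\frac{\beta_0(K)}{K}\right)^2=\prod_p\left(1-\frac4{p^2}+\frac4{p^3}-\frac1{p^4}\right),$$ $$b_1=\sum_{K=1}^\infty\frac{2\mu(K)}{K^2}\,\beta_0(K)\bigl(\beta_1(K)-\beta_0(K)\log K\bigr),$$ $$b_0=\sum_{K=1}^\infty\frac{\mu(K)}{K^2}\bigl(\beta_1(K)-\beta_0(K)\log K\bigr)^2,$$ the product being over all primes $p$.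
   Context: For positive integers $m,n$, $s(m,n)$ denotes the total number of subgroups of the group $\mathbb{Z}_m\times\mathbb{Z}_n$, and $c(m,n)$ denotes the number of its cyclic subgroups, where $\mathbb{Z}_m$ is the additive group of residue classes modulo $m$. $\zeta$ is the Riemann zeta function, $\mu$ the Möbius function, $\tau(n)$ the number of divisors of $n$, and $\nu_p(K)$ the exponent of the prime $p$ in $K$. The Stieltjes constants are $\gamma_k=\lim_{x\to\infty}\left(\sum_{n\le x}\frac{(\log n)^k}{n}-\frac{(\log x)^{k+1}}{k+1}\right)$ for $k=0,1,2,\ldots$, and $\gamma=\gamma_0$. Constants $A_r$, $B_r$: $$A_3=\frac1{3\zeta(2)},\qquad A_2=\frac1{\zeta(2)}\left(3\gamma-1-\frac{\zeta'(2)}{\zeta(2)}\right),$$ $$A_1=\frac1{\zeta(2)}\left(8\gamma^2-6\gamma-2\gamma_1+1-2(3\gamma-1)\frac{\zeta'(2)}{\zeta(2)}+2\left(\frac{\zeta'(2)}{\zeta(2)}\right)^2-\frac{\zeta''(2)}{\zeta(2)}\right),$$ $$B_3=\frac1{3\zeta^2(2)},\qquad B_2=\frac1{\zeta^2(2)}\left(3\gamma-1-2\frac{\zeta'(2)}{\zeta(2)}\right),$$ $$B_1=\frac1{\zeta^2(2)}\left(8\gamma^2-6\gamma-2\gamma_1+1-4(3\gamma-1)\frac{\zeta'(2)}{\zeta(2)}+6\left(\frac{\zeta'(2)}{\zeta(2)}\right)^2-2\frac{\zeta''(2)}{\zeta(2)}\right),$$ and $A_0,B_0$ are the constant coefficients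 in the asymptotic expansions of the unrestricted sums, i.e. (both limits exist) $$A_0=\lim_{x\to\infty}\left(\frac1{x^2}\sum_{m,n\le x}s(m,n)-\sum_{r=1}^3A_r(\log x)^r\right),\qquad B_0=\lim_{x\to\infty}\left(\frac1{x^2}\sum_{m,n\le x}c(m,n)-\sum_{r=1}^3B_r(\log x)^r\right).$$ Functions $\beta_0,\beta_1$: for $K\in\mathbb{N}$ and $s\in\mathbb{C}$ let $$F_K(s)=\prod_{p\mid K}\left(1-\eta_p(K)p^{-s}\right),\qquad\eta_p(K)=\frac{\nu_p(K)}{\nu_p(K)+1},$$ (product over primes $p$ dividing $K$), $$\alpha_0(K)=F_K(1)=\prod_{p\mid K}\left(1-\frac{\eta_p(K)}{p}\right),\qquad \alpha_1(K)=F_K'(1)=\sum_{q\mid K}\frac{\eta_q(K)}{q}\log q\prod_{p\mid K,\ p\ne q}\left(1-\frac{\eta_p(K)}{p}\right)$$ ($p,q$ primes), and $$\beta_0(K)=\tau(K)\alpha_0(K),\qquad\beta_1(K)=\tau(K)\bigl(\alpha_0(K)(2\gamma-1)+\alpha_1(K)\bigr).$$ *)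

(* Defs.v *)
From mathcomp Require Export all_boot all_order all_algebra all_fingroup all_solvable.
From mathcomp Require Export all_classical all_reals all_analysis.
Export Order.TTheory GRing.Theory Num.Theory numFieldNormedType.Exports.

Set Implicit Arguments.
Unset Strict Implicit.
Unset Printing Implicit Defensive.

Local Open Scope classical_set_scope.
Local Open Scope ring_scope.

(* [Zp n] is the additive group Z/nZ for every n >= 1: it is the full group of
   'Z_n when n > 1 and the trivial group when n = 1. *)
Definition nb_subgroups (m n : nat) : nat :=
  #|subgroups (finset.setX (Zp m) (Zp n))|.

Definition nb_cyclic_subgroups (m n : nat) : nat :=
  #|[set H in subgroups (finset.setX (Zp m) (Zp n)) | cyclic H]%SET|.

Definition pair_sum (R : realType) (f : nat -> nat -> nat) (x : R) : R :=
  \sum_(1 <= m < (Num.truncn x).+1) \sum_(1 <= n < (Num.truncn x).+1)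
    (f m n)%:R.

Definition noncoprime_pair_sum (R : realType) (f : nat -> nat -> nat) (x : R) : R :=
  \sum_(1 <= m < (Num.truncn x).+1)
    \sum_(1 <= n < (Num.truncn x).+1 | (1 < gcdn m n)%N) (f m n)%:R.

(* The Riemann zeta function on the half-line s > 1; only its value and its
   derivatives at 2 are used. *)
Definition zeta (R : realType) (s : R) : R :=
  limn (fun N => \sum_(1 <= n < N) n%:R `^ (- s)).

Definition stieltjes (R : realType) (k : nat) : R :=
  lim ((\sum_(1 <= n < (Num.truncn x).+1) ln n%:R ^+ k / n%:R
        - ln x ^+ k.+1 / k.+1%:R : R) @[x --> +oo]).

(* The Moebius function for K >= 1; the value 1 at K = 0 is junk. *)
Definition mobius (K : nat) : int :=
  if all (fun p => logn p K == 1%N) (primes K) then (-1) ^+ size (primes K)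
  else 0.

Definition tau (K : nat) : nat := size (divisors K).

Definition eta (R : realType) (p K : nat) : R := (logn p K)%:R / (logn p K).+1%:R.

(* F_K restricted to real arguments. *)
Definition Ffun (R : realType) (K : nat) (s : R) : R :=
  \prod_(p <- primes K) (1 - eta R p K * p%:R `^ (- s)).

Definition alpha0 (R : realType) (K : nat) : R := Ffun K 1.

Definition alpha1 (R : realType) (K : nat) : R := (@Ffun R K)^`()%classic 1.

Definition beta0 (R : realType) (K : nat) : R := (tau K)%:R * alpha0 R K.

Definition beta1 (R : realType) (K : nat) : R :=
  (tau K)%:R * (alpha0 R K * (2 * stieltjes R 0 - 1) + alpha1 R K).

(* zeta'(2) / zeta(2) and zeta''(2) / zeta(2) *)
Definition zeta1q (R : realType) : R := (@zeta R)^`()%classic 2 / zeta 2.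
Definition zeta2q (R : realType) : R := (@zeta R)^`(2)%classic 2 / zeta 2.

Definition A3 (R : realType) : R := (3 * zeta 2)^-1.

Definition A2 (R : realType) : R :=
  (zeta 2)^-1 * (3 * stieltjes R 0 - 1 - zeta1q R).

Definition A1 (R : realType) : R :=
  (zeta 2)^-1 *
  (8 * stieltjes R 0 ^+ 2 - 6 * stieltjes R 0 - 2 * stieltjes R 1 + 1
   - 2 * (3 * stieltjes R 0 - 1) * zeta1q R + 2 * zeta1q R ^+ 2 - zeta2q R).

Definition B3 (R : realType) : R := (3 * zeta 2 ^+ 2)^-1.

Definition B2 (R : realType) : R :=
  (zeta 2 ^+ 2)^-1 * (3 * stieltjes R 0 - 1 - 2 * zeta1q R).

Definition B1 (R : realType) : R :=
  (zeta 2 ^+ 2)^-1 *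
  (8 * stieltjes R 0 ^+ 2 - 6 * stieltjes R 0 - 2 * stieltjes R 1 + 1
   - 4 * (3 * stieltjes R 0 - 1) * zeta1q R + 6 * zeta1q R ^+ 2
   - 2 * zeta2q R).

Definition A0_fun (R : realType) (x : R) : R :=
  pair_sum nb_subgroups x / x ^+ 2
  - (A1 R * ln x + A2 R * ln x ^+ 2 + A3 R * ln x ^+ 3).

Definition B0_fun (R : realType) (x : R) : R :=
  pair_sum nb_cyclic_subgroups x / x ^+ 2
  - (B1 R * ln x + B2 R * ln x ^+ 2 + B3 R * ln x ^+ 3).

Definition A0 (R : realType) : R := lim ((A0_fun x : R) @[x --> +oo]).
Definition B0 (R : realType) : R := lim ((B0_fun x : R) @[x --> +oo]).

Definition b2_term (R : realType) (K : nat) : R :=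
  (mobius K)%:~R * (beta0 R K / K%:R) ^+ 2.

Definition b1_term (R : realType) (K : nat) : R :=
  2 * (mobius K)%:~R / K%:R ^+ 2 * beta0 R K
  * (beta1 R K - beta0 R K * ln K%:R).

Definition b0_term (R : realType) (K : nat) : R :=
  (mobius K)%:~R / K%:R ^+ 2 * (beta1 R K - beta0 R K * ln K%:R) ^+ 2.

Definition b2 (R : realType) : R := limn (fun N => \sum_(1 <= K < N) b2_term R K).
Definition b1 (R : realType) : R := limn (fun N => \sum_(1 <= K < N) b1_term R K).
Definition b0 (R : realType) : R := limn (fun N => \sum_(1 <= K < N) b0_term R K).

Definition C3 (R : realType) : R := A3 R.
Definition C2 (R : realType) : R := A2 R - b2 R.
Definition C1 (R : realType) : R := A1 R - b1 R.
Definition C0 (R : realType) : R := A0 R - b0 R.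

Definition D3 (R : realType) : R := B3 R.
Definition D2 (R : realType) : R := B2 R - b2 R.
Definition D1 (R : realType) : R := B1 R - b1 R.
Definition D0 (R : realType) : R := B0 R - b0 R.

(* Lets the Landau notations be used at the filter +oo. *)
Canonical pinfty_filter_on (R : realType) : filter_on R :=
  FilterType (pinfty_nbhs R) _.

(* Main.v *)
(* With D(u) the summatory function of tau and T(y) = sum_{f <= y} f D(y/f)^2,
   the identities s(m,n) = sum_{a|m, b|n} gcd(a,b) and c(m,n) = the same sum with
   phi(gcd(a,b)) exhibit the two unrestricted sums as one, resp. two, Moebius
   convolutions of T.  So it is enough to expand T; a single saving beyond the
   trivial bound for the error term Delta of D is needed: truncating at
   f <= sqrt y, the cross term reduces to sum_{f <= sqrt y} (log(y/f) + c) Delta(y/f).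
   Writing Delta by means of the sawtooth function psi, this is O(y^(5/9+eps))
   thanks to sum_{n <= U} psi(X/n) = O(X^(1/3+eps)) for U^3 <= X^2 (Voronoi's
   method: split into blocks on which X/n is close to an arithmetic progression
   with rational difference).  The resulting exponent 14/9 is below 1117/701, so
   no exponential sum estimates are required.
   If gcd(m,n) = 1 then s(m,n) = c(m,n) = tau(m) tau(n), and the sum over coprime
   pairs is sum_K mu(K) (sum_{m <= x/K} tau(Km))^2.  For squarefree K the inner sum
   D_K satisfies D_{pK}(y) = 2 D_K(y) - D_K(y/p), which produces the coefficients
   beta_0(K), beta_1(K) with an error uniform up to a factor 3^omega(K). *)

Require Import Defs.
From mathcomp Require Import ring lra zify.

Set Implicit Arguments.
Unset Strict Implicit.
Unset Printing Implicit Defensive.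

Local Open Scope classical_set_scope.
Local Open Scope ring_scope.

(** * Growth exponents *)

(** The bound Delta(u) = O(u^(1/2+eps)) alone would give y^(7/4) for the cross term, which is above
    1117/701, although it is enough for sum f Delta(y/f)^2, of size y^(3/2). The exponent 5/9 arises
    by splitting the pairs (f, a) with a^2 f <= y at a = y^(1/3): a sawtooth sum over f for fixed a
    is O((y/a)^(1/3)), and sum_{a <= y^(1/3)} (y/a)^(1/3) = O(y^(5/9)); the rest is symmetric. The
    range f > sqrt y becomes a sum of D(k)^2 over k < sqrt y, where a cancellation in sum Delta(k)
    is needed as well; that one is elementary. Constant terms are never computed: A_0 and B_0 are
    limits, so an unknown constant is carried along and identified at the end. All estimates read f
    = O(sz^(e+d)) for every d > 0. Logarithms then have exponent 0 and exponents add under products.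
    The size function lets one calculus serve real and integer variables, and validity for all sizes
    >= 1, not only large ones, makes the bounds summable over arguments y/f. *)

Definition growth (R : realType) (T : Type) (sz : T -> R) (e : R) (f : T -> R) : Prop :=
  forall d, 0 < d ->
    exists2 C, 0 <= C & forall t, 1 <= sz t -> `|f t| <= C * sz t `^ (e + d).

Lemma growth_le (R : realType) (T : Type) (sz : T -> R) (e : R) (f g : T -> R) :
  growth sz e g -> (forall t, 1 <= sz t -> `|f t| <= `|g t|) -> growth sz e f.
Proof.
move=> gg fg d d0; have [C C0 H] := gg d d0; exists C => // t t1.
exact: le_trans (fg t t1) (H t t1).
Qed.

Lemma growth_ext (R : realType) (T : Type) (sz : T -> R) (e : R) (f g : T -> R) :
  growth sz e g -> (forall t, 1 <= sz t -> f t = g t) -> growth sz e f.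
Proof. by move=> gg fg; apply: growth_le gg _ => t /fg ->. Qed.

Lemma growth_bound (R : realType) (T : Type) (sz : T -> R) (e C : R) (f : T -> R) :
  (forall t, 1 <= sz t -> `|f t| <= C * sz t `^ e) -> growth sz e f.
Proof.
move=> H d d0; exists (Num.max 0 C); first by rewrite le_max lexx.
move=> t t1; apply: le_trans (H t t1) _.
apply: (@le_trans _ _ (Num.max 0 C * sz t `^ e)).
  by apply: ler_wpM2r; rewrite ?powR_ge0// le_max lexx orbT.
by apply: ler_wpM2l; rewrite ?le_max ?lexx// ler_powR// lerDl ltW.
Qed.

Lemma growth_expW (R : realType) (T : Type) (sz : T -> R) (e e' : R) (f : T -> R) :
  e <= e' -> growth sz e f -> growth sz e' f.
Proof.
move=> ee' H d d0; have [C C0 HC] := H d d0; exists C => // t t1.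
apply: le_trans (HC t t1) _; apply: ler_wpM2l => //.
by rewrite ler_powR// lerD2r.
Qed.

Lemma growthD (R : realType) (T : Type) (sz : T -> R) (e : R) (f g : T -> R) :
  growth sz e f -> growth sz e g -> growth sz e (fun t => f t + g t).
Proof.
move=> Hf Hg d d0; have [C C0 HC] := Hf d d0; have [C' C'0 HC'] := Hg d d0.
exists (C + C'); first exact: addr_ge0.
move=> t t1; rewrite mulrDl; apply: le_trans (ler_normD _ _) _.
by apply: lerD; [exact: HC | exact: HC'].
Qed.

Lemma growthN (R : realType) (T : Type) (sz : T -> R) (e : R) (f : T -> R) :
  growth sz e f -> growth sz e (fun t => - f t).
Proof. by move=> Hf; apply: growth_le Hf _ => t _; rewrite normrN. Qed.

Lemma growthB (R : realType) (T : Type) (sz : T -> R) (e : R) (f g : T -> R) :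
  growth sz e f -> growth sz e g -> growth sz e (fun t => f t - g t).
Proof. by move=> Hf Hg; apply: growthD => //; exact: growthN. Qed.

Lemma growthM (R : realType) (T : Type) (sz : T -> R) (e1 e2 : R) (f g : T -> R) :
  growth sz e1 f -> growth sz e2 g -> growth sz (e1 + e2) (fun t => f t * g t).
Proof.
move=> Hf Hg d d0; have d20 : 0 < d / 2 by rewrite divr_gt0.
have [C C0 HC] := Hf _ d20; have [C' C'0 HC'] := Hg _ d20.
exists (C * C'); first exact: mulr_ge0.
move=> t t1; rewrite normrM.
have -> : e1 + e2 + d = (e1 + d / 2) + (e2 + d / 2) by lra.
rewrite powRD; last by apply/implyP => _; rewrite gt_eqF// (lt_le_trans ltr01).
rewrite mulrACA; apply: ler_pM => //; [exact: HC | exact: HC'].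
Qed.

Lemma growth_cst (R : realType) (T : Type) (sz : T -> R) (c : R) :
  growth sz 0 (fun=> c).
Proof. by apply: (@growth_bound _ _ _ _ `|c|) => t _; rewrite powRr0 mulr1. Qed.

Lemma growth0 (R : realType) (T : Type) (sz : T -> R) (e : R) :
  growth sz e (fun=> 0).
Proof. by apply: (@growth_bound _ _ _ _ 0) => t _; rewrite normr0 mul0r. Qed.

Lemma growthZ (R : realType) (T : Type) (sz : T -> R) (e c : R) (f : T -> R) :
  growth sz e f -> growth sz e (fun t => c * f t).
Proof.
by move=> Hf; rewrite -[e]add0r; apply: growthM => //; exact: growth_cst.
Qed.

Lemma growth_powR (R : realType) (T : Type) (sz : T -> R) (e : R) :
  growth sz e (fun t => sz t `^ e).
Proof.
by apply: (@growth_bound _ _ _ _ 1) => t _; rewrite mul1r ger0_norm// powR_ge0.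
Qed.

Lemma growth_size (R : realType) (T : Type) (sz : T -> R) : growth sz 1 sz.
Proof.
apply: growth_ext (growth_powR _ _) _ => t t1.
by rewrite powRr1// (le_trans ler01).
Qed.

Lemma growth_size_exp (R : realType) (T : Type) (sz : T -> R) (k : nat) :
  growth sz k%:R (fun t => sz t ^+ k).
Proof.
apply: growth_ext (growth_powR _ _) _ => t t1.
by rewrite powR_mulrn// (le_trans ler01).
Qed.

Lemma growth_size_inv (R : realType) (T : Type) (sz : T -> R) (k : nat) :
  growth sz (- k%:R) (fun t => (sz t ^+ k)^-1).
Proof.
apply: growth_ext (growth_powR _ _) _ => t t1.
by rewrite powR_invn// (le_trans ler01).
Qed.

Lemma ln_le_powR (R : realType) (d x : R) : 0 < d -> 1 <= x -> ln x <= d^-1 * x `^ d.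
Proof.
move=> d0 x1; have x0 : 0 < x by exact: lt_le_trans x1.
rewrite mulrC ler_pdivlMr// mulrC -ln_powR.
by apply: ltW; apply: ln_sublinear; rewrite powR_gt0.
Qed.

Lemma growth_ln (R : realType) (T : Type) (sz : T -> R) :
  growth sz 0 (fun t => ln (sz t)).
Proof.
move=> d d0; exists d^-1; first by rewrite invr_ge0 ltW.
by move=> t t1; rewrite add0r ger0_norm ?ln_ge0// ln_le_powR.
Qed.

Lemma growthX (R : realType) (T : Type) (sz : T -> R) (f : T -> R) (k : nat) :
  growth sz 0 f -> growth sz 0 (fun t => f t ^+ k).
Proof.
move=> Hf; elim: k => [|k IH]; first exact: growth_cst.
apply: growth_ext (_ : growth sz 0 (fun t => f t * f t ^+ k)) _.
  by rewrite -[0 : R]addr0; apply: growthM.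
by move=> t _; rewrite exprS.
Qed.

Lemma growth_norm (R : realType) (T : Type) (sz : T -> R) (e : R) (f : T -> R) :
  growth sz e f -> growth sz e (fun t => `|f t|).
Proof. by move=> Hf; apply: growth_le Hf _ => t _; rewrite normr_id. Qed.

(* [h] need not preserve sizes exactly: only a two-sided comparison
   [c^-1 (size t)^a <= size (h t) <= c (size t)^a] matters. *)
Lemma growth_comp (R : realType) (T U : Type) (szT : T -> R) (szU : U -> R)
    (h : T -> U) (a c e : R) (f : U -> R) : 0 < c -> 0 < a ->
  (forall t, 1 <= szT t ->
     [/\ 1 <= szU (h t), szU (h t) <= c * szT t `^ a
       & szT t `^ a <= c * szU (h t)]) ->
  growth szU e f -> growth szT (a * e) (fun t => f (h t)).
Proof.
move=> c0 a0 Hh Hf d d0; have da0 : 0 < d / a by rewrite divr_gt0.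
have [C C0 HC] := Hf _ da0.
have E : a * e + d = a * (e + d / a).
  by rewrite mulrDr mulrCA mulfV ?mulr1// gt_eqF.
(* The exponent g = e + d/a can have either sign: the upper comparison of sizes costs c^g when g >=
   0, the lower one costs c^(-g) when g < 0. *)
exists (C * Num.max (c `^ (e + d / a)) (c `^ (- (e + d / a)))).
  by rewrite mulr_ge0// le_max powR_ge0.
move=> t t1; have [h1 hle hge] := Hh t t1.
apply: le_trans (HC _ h1) _; rewrite -mulrA; apply: ler_wpM2l => //.
have s0 : 0 < szU (h t) by exact: lt_le_trans h1.
have t0 : 0 < szT t `^ a by rewrite powR_gt0// (lt_le_trans ltr01).
rewrite E powRrM; set g := e + d / a.
have [g0|g0] := leP 0 g.
  apply: (@le_trans _ _ ((c * szT t `^ a) `^ g)).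
    by apply: ge0_ler_powR; rewrite ?nnegrE ?mulr_ge0// ltW.
  rewrite (powRM _ (ltW c0) (ltW t0)); apply: ler_wpM2r; first exact: powR_ge0.
  by rewrite le_max lexx.
set G := - g; have G0 : 0 <= G by rewrite oppr_ge0 ltW.
have gE z : z `^ g = (z `^ G)^-1 by rewrite /G powRN invrK.
rewrite (gE (szU _)) (gE (_ `^ _)).
rewrite (ler_pdivlMr _ _ (powR_gt0 _ t0)) ler_pdivrMl ?powR_gt0// mulrC.
apply: (@le_trans _ _ ((c * szU (h t)) `^ G)).
  by apply: ge0_ler_powR; rewrite ?nnegrE ?mulr_ge0// ltW.
rewrite (powRM _ (ltW c0) (ltW s0)).
apply: ler_wpM2r; first exact: powR_ge0.
by rewrite le_max lexx orbT.
Qed.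

Lemma growth_cvg0 (R : realType) (e : R) (f : R -> R) :
  e < 0 -> growth id e f -> f x @[x --> +oo] --> 0.
Proof.
move=> e0 Hf; have d0 : 0 < - e / 2 by rewrite divr_gt0// oppr_gt0.
have [C C0 HC] := Hf _ d0.
apply/cvgrPdist_le => /= eps eps0.
near=> x; rewrite sub0r normrN.
have x1 : 1 <= x by near: x; exact: nbhs_pinfty_ge.
have x0 : 0 < x by exact: lt_le_trans x1.
apply: le_trans (HC _ x1) _.
have -> : e + - e / 2 = - (- e / 2) by lra.
rewrite powRN ler_pdivrMr ?powR_gt0//.
rewrite mulrC -ler_pdivrMr//.
have H : ((C / eps) `^ ((- e / 2)^-1)) `^ (- e / 2) <= x `^ (- e / 2).
  apply: ge0_ler_powR; [exact: ltW | by rewrite nnegrE powR_ge0 |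
    by rewrite nnegrE ltW |].
  by near: x; apply: nbhs_pinfty_ge; rewrite num_real.
apply: le_trans H.
by rewrite -powRrM mulVf ?gt_eqF// powRr1// divr_ge0// ltW.
Unshelve. all: by end_near. Qed.

Notation natsize R := (fun n : nat => n%:R : R).

(** * Sums and tails of powers of integers *)

Lemma powR_sum_step (R : realType) (s : R) (n : nat) : 0 < s ->
  n.+1%:R `^ (s - 1) <= (1 + s) / s * (n.+1%:R `^ s - n%:R `^ s).
Proof.
move=> s0; set x : R := n.+1%:R.
have x0 : 0 < x by rewrite ltr0n.
have s10 : 0 < 1 + s by rewrite addr_gt0.
have xs0 : 0 < x `^ s by rewrite powR_gt0.
have -> : x `^ (s - 1) = x `^ s / x.
  by rewrite powRB ?powRr1 ?(ltW x0)// (gt_eqF x0) implybT.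
(* With n = x - 1, (1 - 1/x)^s <= exp(-s/x) <= 1/(1 + s/x) <= 1 - s/((1+s)x), the last because 1/x
   <= 1. This covers both signs of s - 1 at once. *)
suff H : n%:R `^ s <= x `^ s * (1 - s / (1 + s) / x).
  apply: (@le_trans _ _ ((1 + s) / s * (x `^ s * (s / (1 + s) / x)))).
    rewrite le_eqVlt; apply/orP; left; apply/eqP; field.
    by rewrite !gt_eqF.
  by apply: ler_wpM2l; [rewrite divr_ge0// ltW | by rewrite lerBrDr -lerBrDl (le_trans H)// mulrBr mulr1].
case: n @x x0 xs0 => [|n] x x0 xs0.
  rewrite powR0 ?gt_eqF// mulr_ge0 ?(ltW xs0)// subr_ge0 divr1.
  by rewrite ler_pdivrMr// mul1r; lra.
set y : R := n.+1%:R.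
have y0 : 0 < y by rewrite ltr0n.
have yE : y = x * (1 - x^-1).
  by rewrite mulrBr mulr1 mulfV ?gt_eqF// /x /y -[n.+2]addn1 natrD addrK.
have t0 : 0 < 1 - x^-1 by move: y0; rewrite yE pmulr_rgt0.
rewrite yE powRM ?(ltW x0) ?(ltW t0)//; apply: ler_wpM2l; first exact: ltW.
rewrite /powR (gt_eqF t0).
apply: (@le_trans _ _ (expR (- (s / x)))).
  rewrite ler_expR -mulrN; apply: ler_wpM2l; first exact: ltW.
  by apply: le_ln1Dx; rewrite ltrN2 invf_lt1// ltr1n.
have sx0 : 0 < s / x by rewrite divr_gt0.
rewrite expRN; apply: (@le_trans _ _ (1 + s / x)^-1).
  rewrite lef_pV2 ?posrE ?expR_gt0 ?expR_ge1Dx//.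
  by rewrite addr_gt0.
rewrite -div1r ler_pdivrMr ?addr_gt0//.
set u := x^-1; have u1 : u <= 1 by rewrite invf_le1// ler1n.
have u0 : 0 < u by rewrite invr_gt0.
rewrite -subr_ge0.
have -> : (1 - s / (1 + s) * u) * (1 + s * u) - 1 =
    s ^+ 2 * u * (1 - u) / (1 + s) by field; rewrite gt_eqF.
by rewrite divr_ge0 ?mulr_ge0 ?exprn_ge0 ?subr_ge0// ltW.
Qed.

Lemma sum_powR_le (R : realType) (s : R) (N : nat) : 0 < s ->
  \sum_(1 <= n < N.+1) n%:R `^ (s - 1) <= (1 + s) / s * N%:R `^ s.
Proof.
move=> s0.
apply: (@le_trans _ _
    (\sum_(1 <= n < N.+1) (1 + s) / s * (n%:R `^ s - n.-1%:R `^ s))).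
  rewrite !big_add1 /=; apply: ler_sum => n _; exact: powR_sum_step.
rewrite -mulr_sumr big_add1 /= (telescope_sumr_eq (fun n => n%:R `^ s))//.
by rewrite powR0 ?gt_eqF// subr0.
Qed.

(** Telescoping substitute for comparison with an integral: (1 - 1/x)^(-r) >= exp(r/x) >= 1 +
    r/x. *)
Lemma powR_tail_step (R : realType) (r : R) (n : nat) : 0 < r -> (0 < n)%N ->
  n.+1%:R `^ (- r - 1) <= r^-1 * (n%:R `^ (- r) - n.+1%:R `^ (- r)).
Proof.
move=> r0 n0; set y : R := n%:R; set x : R := n.+1%:R.
have y0 : 0 < y by rewrite ltr0n.
have x0 : 0 < x by rewrite ltr0n.
have xr0 : 0 < x `^ (- r) by rewrite powR_gt0.
have -> : x `^ (- r - 1) = x `^ (- r) / x.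
  by rewrite powRB ?powRr1 ?(ltW x0)// (gt_eqF x0) implybT.
suff H : x `^ (- r) * (1 + r / x) <= y `^ (- r).
  apply: (@le_trans _ _ (r^-1 * (x `^ (- r) * (r / x)))).
    rewrite le_eqVlt; apply/orP; left; apply/eqP; field.
    by rewrite !gt_eqF.
  by apply: ler_wpM2l; [rewrite invr_ge0 ltW | rewrite lerBrDr (le_trans _ H)// mulrDr mulr1 addrC].
have yE : y = x * (1 - x^-1).
  by rewrite mulrBr mulr1 mulfV ?gt_eqF// /x /y -addn1 natrD addrK.
have t0 : 0 < 1 - x^-1 by move: y0; rewrite yE pmulr_rgt0.
rewrite yE powRM ?(ltW x0) ?(ltW t0)//; apply: ler_wpM2l; first exact: ltW.
rewrite /powR (gt_eqF t0).
apply: le_trans (expR_ge1Dx _) _; rewrite ler_expR mulNr -mulrN.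
apply: ler_wpM2l; first exact: ltW.
rewrite lerNr; apply: le_ln1Dx; rewrite ltrN2 invf_lt1//.
by rewrite ltr1n ltnS.
Qed.

Lemma sum_powR_tail_le (R : realType) (r : R) (M N : nat) : 0 < r -> (0 < M)%N ->
  \sum_(M.+1 <= n < N) n%:R `^ (- r - 1) <= r^-1 * M%:R `^ (- r).
Proof.
move=> r0 M0; have [NM|MN] := leqP N M.+1.
  by rewrite big_geq// mulr_ge0 ?powR_ge0// invr_ge0 ltW.
case: N MN => // N MN; rewrite big_add1 /=.
apply: (@le_trans _ _
    (\sum_(M <= n < N) - (r^-1 * (n.+1%:R `^ (- r) - n%:R `^ (- r))))).
  apply: ler_sum_nat => n /andP[Mn _].
  rewrite -mulrN opprB; apply: powR_tail_step => //; exact: leq_trans Mn.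
rewrite sumrN -mulr_sumr (telescope_sumr_eq (fun n => n%:R `^ (- r)))//; last by rewrite -ltnS ltnW.
rewrite -mulrN opprB; apply: ler_wpM2l; first by rewrite invr_ge0 ltW.
by rewrite gerBl powR_ge0.
Qed.

(** The hypothesis -1 <= e makes e + 1 + d positive for every d > 0, also in the borderline case e =
    -1, where the logarithm is absorbed by d. *)
Lemma growth_sum (R : realType) (e : R) (u : nat -> R) : -1 <= e ->
  growth (natsize R) e u ->
  growth (natsize R) (e + 1) (fun N => \sum_(1 <= n < N.+1) `|u n|).
Proof.
move=> e1 Hu d d0; have [C C0 HC] := Hu d d0.
have s0 : 0 < e + 1 + d by lra.
exists (C * ((1 + (e + 1 + d)) / (e + 1 + d))).
  by rewrite mulr_ge0// divr_ge0//; lra.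
move=> N _; rewrite ger0_norm ?sumr_ge0//.
rewrite -mulrA; apply: le_trans (ler_wpM2l C0 (sum_powR_le N s0)).
rewrite mulr_sumr.
apply: ler_sum_nat => n /andP[n1 _].
have -> : e + 1 + d - 1 = e + d by lra.
by apply: HC; rewrite ler1n.
Qed.

Lemma growth_sum_norm (R : realType) (T : Type) (sz : T -> R) (e : R)
    (r : T -> seq nat) (u : T -> nat -> R) :
  growth sz e (fun t => \sum_(n <- r t) `|u t n|) ->
  growth sz e (fun t => \sum_(n <- r t) u t n).
Proof.
move=> H; apply: growth_le H _ => t _; apply: le_trans (ler_norm_sum _ _ _) _.
exact: ler_norm.
Qed.

Lemma series_growth (R : realType) (e : R) (u : nat -> R) : e < -1 ->
  growth (natsize R) e u ->
  exists l, \sum_(1 <= n < N) u n @[N --> \oo] --> l /\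
    growth (natsize R) (e + 1) (fun N => l - \sum_(1 <= n < N.+1) u n).
Proof.
move=> e1 Hu.
(* [series] starts at 0, where [growth] gives no information on [u]; the term there is replaced by
   0. *)
pose v k := if k is k'.+1 then u k else 0 : R.
have sE : (fun N => \sum_(1 <= n < N) u n) = series v.
  apply/funext => -[|N]; rewrite /series /=.
    by rewrite !big_geq.
  rewrite [in RHS]big_ltn// add0r big_nat_cond [in RHS]big_nat_cond.
  by apply: eq_bigr => -[].
have tail d : 0 < d -> e + 1 + d < 0 -> exists2 C, 0 <= C &
    forall M N, (0 < M)%N ->
      \sum_(M.+1 <= n < N) `|u n| <= C * M%:R `^ (e + 1 + d).
  move=> d0 ed; have [C C0 HC] := Hu d d0.
  have r0 : 0 < - (e + 1 + d) by lra.
  exists (C * (- (e + 1 + d))^-1).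
    by rewrite mulr_ge0// invr_ge0 ltW.
  move=> M N M0; have := sum_powR_tail_le N r0 M0; rewrite opprK => H.
  rewrite -mulrA; apply: le_trans (ler_wpM2l C0 H).
  rewrite mulr_sumr.
  apply: ler_sum_nat => n /andP[n1 _].
  have -> : e + 1 + d - 1 = e + d by lra.
  by apply: HC; rewrite ler1n; apply: leq_trans n1.
(* Half of the room below -1: the tail exponent e + 1 + d1 is still negative. *)
pose d1 := - (e + 1) / 2.
have d10 : 0 < d1 by rewrite /d1; lra.
have [C1 C10 HC1] := tail d1 d10 ltac:(rewrite /d1; lra).
have vcvg : cvgn (series v).
  apply: normed_cvg.
  apply: nondecreasing_is_cvgn.
    apply/nondecreasing_seqP => n.
    by rewrite [leRHS]seriesSr lerDl normr_ge0.
  exists (`|u 1%N| + C1) => _ [N _ <-].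
  apply: (@le_trans _ _ (\sum_(0 <= k < N.+2) `|v k|)).
    rewrite /series /= [X in _ <= X](@big_cat_nat _ _ _ N)//=; last by rewrite leqW.
    by rewrite lerDl sumr_ge0.
  rewrite big_ltn// big_ltn// /= normr0 add0r lerD2l.
  apply: le_trans (le_trans (HC1 1%N N.+2 isT) _); last first.
    by rewrite powR1 mulr1.
  by apply: ler_sum_nat => -[|n].
exists (limn (series v)); split; first by rewrite sE.
(* The tail bound requires a negative exponent, so a large d is first lowered to d1. *)
move=> d d0; pose d' := Num.min d d1.
have d'0 : 0 < d' by rewrite lt_min d0.
have d'd : d' <= d by rewrite ge_min lexx.
have d'1 : d' <= d1 by rewrite ge_min lexx orbT.
have [C C0 HC] := tail d' d'0 ltac:(move: d'1; rewrite /d1; lra).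
exists C => // M M1; have M0 : (0 < M)%N by move: M1; rewrite ler1n.
have HM N : (M < N)%N ->
    `|series v N - \sum_(1 <= n < M.+1) u n| <= C * M%:R `^ (e + 1 + d').
  move=> MN; rewrite -sE (@big_cat_nat _ _ _ M.+1)//= addrAC subrr add0r.
  exact: le_trans (ler_norm_sum _ _ _) (HC M N M0).
apply: (@le_trans _ _ (C * M%:R `^ (e + 1 + d'))); last first.
  by apply: ler_wpM2l => //; apply: ler_powR => //; rewrite lerD2l.
have cv : `|series v N - \sum_(1 <= n < M.+1) u n| @[N --> \oo] -->
    `|limn (series v) - \sum_(1 <= n < M.+1) u n|.
  by apply: cvg_norm; apply: cvgB => //; exact: cvg_cst.
rewrite -(cvg_lim _ cv)//; apply: limr_le; first by apply/cvg_ex; eexists; exact: cv.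
by near=> N; apply: HM; near: N; exact: nbhs_infty_gt.
Unshelve. all: by end_near. Qed.

Lemma growth_comp_truncn (R : realType) (e : R) (f : nat -> R) :
  growth (natsize R) e f -> growth id e (fun x => f (Num.truncn x)).
Proof.
move=> Hf; rewrite -[e]mul1r; apply: (growth_comp (c := 2)) Hf => // x x1.
have x0 : 0 <= x by exact: le_trans x1.
rewrite powRr1//.
have /andP[h1 h2] := truncn_itv x0.
have h3 : 1 <= (Num.truncn x)%:R :> R by rewrite ler1n truncn_gt0.
split => //; first lra.
by move: h2; rewrite -[_.+1]addn1 natrD; lra.
Qed.

(** * Sawtooth sums *)

(** The function psi(t) = {t} - 1/2 for t >= 0; since [Num.truncn] vanishes on negative reals, all
    arguments below are kept nonnegative wherever periodicity is used. *)
Definition sawtooth (R : realType) (t : R) : R := t - (Num.truncn t)%:R - 2^-1.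

Lemma sawtooth_le_half (R : realType) (t : R) : 0 <= t -> `|sawtooth t| <= 2^-1.
Proof.
move=> /truncn_itv/andP[h1 h2]; move: h2; rewrite -natr1 => h2.
by rewrite /sawtooth ler_norml; apply/andP; split; lra.
Qed.

Lemma truncnDn (R : realType) (t : R) (n : nat) : 0 <= t ->
  Num.truncn (t + n%:R) = (Num.truncn t + n)%N.
Proof.
move=> t0; rewrite addrC truncnD ?natrK 1?addnC//.
Qed.

Lemma sawtoothDn (R : realType) (t : R) (n : nat) : 0 <= t ->
  sawtooth (t + n%:R) = sawtooth t.
Proof. by move=> t0; rewrite /sawtooth truncnDn// natrD; ring. Qed.

(** The jumps of psi go downwards, so its growth is bounded by that of the argument. This one-sided
    Lipschitz bound does the work of continuity in [sawtooth_block]. *)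
Lemma sawtooth_sub_le (R : realType) (s t : R) : s <= t ->
  sawtooth t - sawtooth s <= t - s.
Proof.
move=> st; have := le_truncn st; rewrite -(ler_nat R) /sawtooth; lra.
Qed.

Lemma truncn_divn (R : realType) (z : R) (q : nat) : 0 <= z -> (0 < q)%N ->
  Num.truncn (z / q%:R) = (Num.truncn z %/ q)%N.
Proof.
move=> z0 q0; apply: truncn_def.
have q0R : 0 < q%:R :> R by rewrite ltr0n.
rewrite ler_pdivlMr// ltr_pdivrMr// -!natrM.
have /andP[h1 h2] := truncn_itv z0; apply/andP; split.
  by apply: le_trans h1; rewrite ler_nat leq_trunc_div.
by apply: lt_le_trans h2 _; rewrite ler_nat ltn_ceil.
Qed.

(** Hermite's identity on integers: passing from m to m + 1 drops the term m/q and adds (m+q)/q,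
    which is one larger. *)
Lemma sum_divn_shift (q m : nat) : (0 < q)%N ->
  (\sum_(r < q) (m + r) %/ q = m)%N.
Proof.
move=> q0; elim: m => [|m IH].
  by rewrite big1// => r _; rewrite add0n divn_small.
apply/eqP; rewrite -(eqn_add2l (m %/ q)) -{1}[X in (X %/ q + _)%N]addn0.
rewrite -(big_mkord xpredT (fun r => (m.+1 + r) %/ q)%N).
under eq_bigr do rewrite addSnnS.
rewrite -(big_add1 _ _ 0 q.+1 xpredT (fun r => (m + r) %/ q)%N).
rewrite -(big_ltn (F := fun r => (m + r) %/ q)%N)//.
rewrite big_nat_recr//= big_mkord IH.
by rewrite divnDr ?dvdnn// divnn q0 addnCA addn1.
Qed.

Lemma sum_nat_ord (R : realType) (q : nat) :
  \sum_(r < q) r%:R = q%:R * (q%:R - 1) / 2 :> R.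
Proof.
elim: q => [|q IH]; first by rewrite big_ord0 !mul0r.
by rewrite big_ord_recr/= IH -natr1; field.
Qed.

Lemma sawtooth_sum_mul (R : realType) (q : nat) (b : R) : (0 < q)%N -> 0 <= b ->
  \sum_(r < q) sawtooth (b + r%:R / q%:R) = sawtooth (q%:R * b).
Proof.
move=> q0 b0; have q0R : 0 < q%:R :> R by rewrite ltr0n.
have qb0 : 0 <= q%:R * b by rewrite mulr_ge0// ltW.
pose m := Num.truncn (q%:R * b).
have tE (r : nat) : Num.truncn (b + r%:R / q%:R) = ((m + r) %/ q)%N.
  have -> : b + r%:R / q%:R = (q%:R * b + r%:R) / q%:R.
    by field; rewrite gt_eqF.
  by rewrite truncn_divn ?addr_ge0// truncnDn.
rewrite /sawtooth; under eq_bigr do rewrite tE.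
rewrite !sumrB -natr_sum sum_divn_shift// big_split/= !sumr_const card_ord.
rewrite -mulr_suml sum_nat_ord.
rewrite -[b *+ q]mulr_natr -[2^-1 *+ q]mulr_natr.
by field; rewrite gt_eqF.
Qed.

(** Multiplication by a permutes the residues mod q and psi has period 1, so this is Hermite's
    identity in another order. *)
Lemma sawtooth_sum_arith (R : realType) (a q : nat) (b : R) :
  (0 < q)%N -> coprime a q -> 0 <= b ->
  \sum_(j < q) sawtooth (b + (a * j)%:R / q%:R) = sawtooth (q%:R * b).
Proof.
case: q => // q _ caq b0; rewrite -sawtooth_sum_mul//.
have q0R : 0 < q.+1%:R :> R by rewrite ltr0n.
pose h (j : 'I_q.+1) : 'I_q.+1 := Ordinal (ltn_pmod (a * j) (ltn0Sn q)).
have hinj : injective h.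
  move=> i j /(congr1 val)/= /eqP.
  wlog ij : i j / (i <= j)%N.
    by move=> H; case: (leqP i j) => [|/ltnW] ij; [|rewrite eq_sym => /(H _ _ ij) ->]; first exact: H.
  rewrite eq_sym eqn_mod_dvd ?leq_mul2l ?ij ?orbT// -mulnBr Gauss_dvdr; last by rewrite coprime_sym.
  move=> dv; apply/val_inj/eqP; rewrite eqn_leq ij /= -subn_eq0.
  by rewrite -leqn0 leqNgt; apply/negP => /(dvdn_leq)/(_ dv); rewrite leqNgt ltnS (leq_trans (leq_subr _ _))// -ltnS ltn_ord.
rewrite [RHS](reindex_inj hinj)/=; apply: eq_bigr => j _.
rewrite {1}(divn_eq (a * j) q.+1) natrD mulrDl natrM mulfK ?gt_eqF//.
rewrite [X in b + X]addrC addrA sawtoothDn// addr_ge0// divr_ge0//.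
Qed.

(** Over a full period the progression with difference a/q contributes psi(q b), at most 1/2 in
    absolute value. Moving b by K/q up or down puts the progression on one side of all the t j; then
    [sawtooth_sub_le] loses at most 2K/q per term, hence 2K in all. *)
Lemma sawtooth_block (R : realType) (a q : nat) (b K : R) (t : nat -> R) :
  (0 < q)%N -> coprime a q -> 0 <= b -> 0 <= K ->
  (forall j, (j < q)%N -> 0 <= t j) ->
  (forall j, (j < q)%N -> `|t j - (b + (a * j)%:R / q%:R)| <= K / q%:R) ->
  `|\sum_(j < q) sawtooth (t j)| <= 2 * K + 1.
Proof.
move=> q0 caq b0 K0 t0 Ht.
have q0R : 0 < q%:R :> R by rewrite ltr0n.
have Kq0 : 0 <= K / q%:R by rewrite divr_ge0// ltW.
have sumK : \sum_(j < q) (2 * (K / q%:R)) = 2 * K.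
  by rewrite sumr_const card_ord -mulr_natr; field; rewrite gt_eqF.
rewrite ler_norml; apply/andP; split.
  have := sawtooth_le_half (mulr_ge0 (ltW q0R) (addr_ge0 b0 Kq0)).
  rewrite -(sawtooth_sum_arith q0 caq (addr_ge0 b0 Kq0)) ler_norml => /andP[H _].
  suff : \sum_(j < q) sawtooth (b + K / q%:R + (a * j)%:R / q%:R) -
      \sum_(j < q) (2 * (K / q%:R)) <= \sum_(j < q) sawtooth (t j).
    by rewrite sumK; lra.
  rewrite -sumrB; apply: ler_sum => j _.
  have := Ht j (ltn_ord j); rewrite ler_norml => /andP[h1 h2].
  have h3 : t j <= b + K / q%:R + (a * j)%:R / q%:R by lra.
  have := sawtooth_sub_le h3; lra.
(* The progression is now moved down, so an integer m is added to keep its arguments nonnegative. *)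
pose m := (Num.truncn (K / q%:R)).+1.
have Km : K / q%:R <= m%:R by apply: ltW; exact: truncnS_gt.
have bm : 0 <= b + m%:R - K / q%:R by lra.
have := sawtooth_le_half (mulr_ge0 (ltW q0R) bm).
rewrite -(sawtooth_sum_arith q0 caq bm) ler_norml => /andP[_ H].
suff : \sum_(j < q) sawtooth (t j) <=
    \sum_(j < q) sawtooth (b + m%:R - K / q%:R + (a * j)%:R / q%:R) +
    \sum_(j < q) (2 * (K / q%:R)).
  by rewrite sumK; lra.
rewrite -big_split/=; apply: ler_sum => j _.
have := Ht j (ltn_ord j); rewrite ler_norml => /andP[h1 h2].
rewrite -(sawtoothDn m (t0 j (ltn_ord j))).
have h3 : b + m%:R - K / q%:R + (a * j)%:R / q%:R <= t j + m%:R by lra.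
have := sawtooth_sub_le h3; lra.
Qed.

(** Pigeonhole: the fractional parts of 0, x, ..., Q x fall into Q boxes of length 1/Q, and the
    difference of two multiples in one box gives q and a. *)
Lemma dirichlet_approx (R : realType) (x : R) (Q : nat) : 0 <= x -> (0 < Q)%N ->
  exists q a : nat, [/\ (0 < q <= Q)%N, coprime a q
    & `|x - a%:R / q%:R| <= (q%:R * Q%:R)^-1].
Proof.
move=> x0 Q0; have Q0R : 0 < Q%:R :> R by rewrite ltr0n.
pose fr (i : nat) := i%:R * x - (Num.truncn (i%:R * x))%:R.
have frP i : 0 <= fr i < 1.
  have : 0 <= i%:R * x by rewrite mulr_ge0.
  move=> /truncn_itv/andP[h1 h2]; move: h2; rewrite -natr1 /fr => h2.
  by apply/andP; split; lra.
have fQ i : (Num.truncn (Q%:R * fr i) < Q)%N.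
  have /andP[h1 h2] := frP i.
  by rewrite truncn_lt_nat ?mulr_ge0// -[ltRHS]mulr1 ltr_pM2l.
pose f (i : 'I_Q.+1) : 'I_Q := Ordinal (fQ i).
have [i [j [ij fij]]] : exists i j : 'I_Q.+1, (i < j)%N /\ f i = f j.
  have : ~~ injectiveb f.
    apply/negP => /injectiveP/leq_card; by rewrite !card_ord ltnn.
  move=> /injectivePn[i [j ij fij]].
  have [h|h|h] := ltngtP i j; [by exists i, j | by exists j, i|].
  by move/eqP: ij; case; exact: val_inj.
have near : `|fr j - fr i| < Q%:R^-1.
  have /(congr1 val)/= E := fij.
  have /andP[h1 h2] := truncn_itv (mulr_ge0 (ltW Q0R) (proj1 (andP (frP i)))).
  have /andP[h3 h4] := truncn_itv (mulr_ge0 (ltW Q0R) (proj1 (andP (frP j)))).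
  rewrite -[ltRHS]div1r ltr_pdivlMr// mulrC -[X in X * _](gtr0_norm Q0R) -normrM.
  move: h1 h2 h3 h4; rewrite -E -natr1 => h1 h2 h3 h4.
  by rewrite ltr_norml; apply/andP; split; lra.
pose q1 := (j - i)%N; pose a1 := (Num.truncn (j%:R * x) - Num.truncn (i%:R * x))%N.
have q10 : (0 < q1)%N by rewrite subn_gt0.
have q1Q : (q1 <= Q)%N by rewrite (leq_trans (leq_subr _ _))// -ltnS ltn_ord.
have q1R : q1%:R = j%:R - i%:R :> R by rewrite natrB// ltnW.
have a1R : a1%:R = (Num.truncn (j%:R * x))%:R - (Num.truncn (i%:R * x))%:R :> R.
  by rewrite natrB// le_truncn// ler_wpM2r// ler_nat ltnW.
have q10R : 0 < q1%:R :> R by rewrite ltr0n.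
have main : `|x - a1%:R / q1%:R| <= (q1%:R * Q%:R)^-1.
  have -> : x - a1%:R / q1%:R = (fr j - fr i) / q1%:R.
    by rewrite /fr a1R q1R; field; rewrite -q1R gt_eqF.
  rewrite normrM normfV (gtr0_norm q10R) invfM mulrC.
  by apply: ler_wpM2l; rewrite ?invr_ge0 ltW.
have g0 : (0 < gcdn a1 q1)%N by rewrite gcdn_gt0 q10 orbT.
(* Reducing the fraction keeps its value and only enlarges the admissible error 1/(qQ). *)
exists (q1 %/ gcdn a1 q1)%N, (a1 %/ gcdn a1 q1)%N; split.
- by rewrite divn_gt0// dvdn_leq// ?dvdn_gcdr//= (leq_trans (leq_div _ _)).
- rewrite /coprime -(eqn_pmul2r g0) mul1n muln_gcdl.
  by rewrite !divnK ?dvdn_gcdl ?dvdn_gcdr.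
have g0R : 0 < (gcdn a1 q1)%:R :> R by rewrite ltr0n.
have -> : (a1 %/ gcdn a1 q1)%:R / (q1 %/ gcdn a1 q1)%:R = a1%:R / q1%:R :> R.
  rewrite -[in RHS](divnK (dvdn_gcdl a1 q1)) -[X in _ = _ / X%:R](divnK (dvdn_gcdr a1 q1)).
  rewrite !natrM -mulf_div divff ?mulr1// gt_eqF//.
apply: le_trans main _; rewrite lef_pV2 ?posrE ?mulr_gt0//; last first.
  by rewrite ltr0n divn_gt0// dvdn_leq// dvdn_gcdr.
by rewrite ler_pM2r// ler_nat leq_div.
Qed.

(** All selected integers lie in a window of length L that starts at the smallest of them. *)
Lemma count_spread_le (R : realType) (P : pred nat) (L : R) (D E : nat) : 0 <= L ->
  (forall m m', (D <= m < m')%N -> (m' < E)%N -> P m -> P m' -> (m' - m)%:R <= L) ->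
  (\sum_(D <= m < E) P m)%N%:R <= L + 1 :> R.
Proof.
move=> L0 HP.
have -> : (\sum_(D <= m < E) P m)%N = size [seq m <- index_iota D E | P m].
  by rewrite size_filter -sum1_count [RHS]big_mkcond /=; apply: eq_bigr => m _; case: (P m).
case sE : [seq m <- index_iota D E | P m] => [|m0 s]; first by rewrite addr_ge0.
have srt : sorted ltn (m0 :: s).
  by rewrite -sE; apply: sorted_filter; [exact: ltn_trans | exact: iota_ltn_sorted].
have mem m : m \in m0 :: s -> [/\ (D <= m < E)%N & P m].
  by rewrite -sE mem_filter mem_index_iota => /andP[].
have [/andP[Dm0 _] Pm0] := mem m0 (mem_head _ _).
have sub : {subset m0 :: s <= iota m0 (Num.truncn L).+1}.
  move=> m ms; have [/andP[Dm mE] Pm] := mem m ms.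
  rewrite mem_iota; move: (ms); rewrite inE => /predU1P[->|mIs].
    by rewrite leqnn -[X in (X < _)%N]addn0 ltn_add2l.
  have m0m : (m0 < m)%N.
    by move: srt => /= /(order_path_min ltn_trans)/allP/(_ m mIs).
  rewrite (ltnW m0m) /= -ltn_subLR ?(ltnW m0m)// ltnS.
  by rewrite truncn_ge_nat//; apply: HP; rewrite ?Dm0.
have := uniq_leq_size (sorted_uniq ltn_trans ltnn srt) sub.
rewrite size_iota -(ler_nat R) => /le_trans; apply.
by rewrite -natr1 lerD2r truncn_le.
Qed.

Lemma sum_nat_last_terms (V : zmodType) (F : nat -> V) (n q : nat) : (q <= n)%N ->
  \sum_((n - q).+1 <= i < n.+1) F i = \sum_(j < q) F (n - j)%N.
Proof.
move=> qn; rewrite -(big_mkord xpredT (fun j => F (n - j)%N)).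
rewrite big_nat_rev /= -[(n - q).+1 in LHS]add0n big_addn subSS subKn//.
by apply: eq_big_nat => j /andP[_ jq]; congr F; lia.
Qed.

(** * Voronoi's method on one dyadic block *)

Section SawtoothHyperbola.
Variables (R : realType) (Z B : R) (D : nat).
Hypotheses (BE : B = 16387) (Z32 : 32 <= Z) (D0 : (0 < D)%N) (DZ : D%:R <= Z ^+ 2).

(** Order of the Dirichlet approximations to the slope X/m^2, with X = Z^3 and m between D and 2D.
    On a block of length q the second-order term of X/m is about q^2 X / D^3; it is O(1/q) exactly
    when q = O(D/Z). A Q of this order also keeps the number of blocks O(Z) up to a logarithm. *)
Let Q := Num.truncn (16 * D%:R / Z).
Hypothesis Q2 : (2 <= Q)%N.

Let B0 : 0 < B. Proof. rewrite BE; lra. Qed.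
Let Z0 : 0 < Z. Proof. by apply: lt_le_trans Z32. Qed.
Let D0R : 0 < D%:R :> R. Proof. by rewrite ltr0n. Qed.
Let Q0R : 0 < Q%:R :> R. Proof. by rewrite ltr0n (leq_trans _ Q2). Qed.

Let QZ : Q%:R * Z <= 16 * D%:R.
Proof.
rewrite -ler_pdivlMr// truncn_le divr_ge0// ?mulr_ge0//; exact: ltW.
Qed.

(** From 16 D < (Q+1) Z <= 2 Q Z. *)
Let QZ_ge : 8 * D%:R <= Q%:R * Z.
Proof.
have : 16 * D%:R < (Q%:R + 1) * Z by rewrite -ltr_pdivrMr// natr1 truncnS_gt.
have : 1 <= Q%:R :> R by rewrite ler1n (leq_trans _ Q2).
move=> h1; rewrite mulrDl mul1r.
have : Z <= Q%:R * Z by rewrite ler_peMl// ltW.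
lra.
Qed.

(** From 32 Q <= Q Z <= 16 D. Hence a block of length at most Q that ends at n >= D stays above
    n/2. *)
Let QD : (2 * Q <= D)%N.
Proof.
rewrite -(ler_nat R) natrM; have := QZ.
have : Q%:R * 32 <= Q%:R * Z by rewrite ler_pM2l.
lra.
Qed.

Let near (q a m : nat) : bool :=
  `|Z ^+ 3 / m%:R ^+ 2 - a%:R / q%:R| <= (q%:R * Q%:R)^-1.

(** The slope is at most Z^3/D^2; the factor 2 absorbs the approximation error. *)
Let amax (q : nat) : nat := Num.truncn (2 * q%:R * Z ^+ 3 / D%:R ^+ 2).

Let cnt (q a n : nat) : nat := (\sum_(D <= m < n) near q a m)%N.

Let ceil_div (k q : nat) : nat := ((k + q.-1) %/ q)%N.

(* Bounds the number of blocks needed to exhaust [D, n), a block attached to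
   a/q having length q. *)
Let potential (n : nat) : nat :=
  (\sum_(1 <= q < Q.+1) \sum_(1 <= a < (amax q).+1) ceil_div (cnt q a n) q)%N.

(** The constant is 2K + 1 of [sawtooth_block] with K = 8193: one unit for replacing the slope by
    a/q, and 8192 for the second-order term. *)
Let near_block (n q a : nat) : (D <= n)%N -> (n < 2 * D)%N ->
  (0 < q <= Q)%N -> coprime a q -> near q a n ->
  `|\sum_(j < q) sawtooth (Z ^+ 3 / (n - j)%:R)| <= B.
Proof.
move=> Dn n2D /andP[q0 qQ] caq nr.
have -> : B = 2 * 8193 + 1 by rewrite BE; ring.
have n0R : 0 < n%:R :> R by rewrite ltr0n (leq_trans D0).
have DnR : D%:R <= n%:R :> R by rewrite ler_nat.
have q0R : 0 < q%:R :> R by rewrite ltr0n.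
have Z30 : 0 < Z ^+ 3 by rewrite exprn_gt0.
apply: (@sawtooth_block _ a q (Z ^+ 3 / n%:R) 8193 (fun j => Z ^+ 3 / (n - j)%:R)).
- by [].
- by [].
- by rewrite divr_ge0// ltW.
- by rewrite ler0n.
- by move=> j _; rewrite divr_ge0// ltW.
move=> j jq.
have jn : (2 * j <= n)%N by rewrite (leq_trans _ Dn)// (leq_trans _ QD)// leq_mul2l/= ltnW// (leq_trans jq).
have jnR : 2 * j%:R <= n%:R :> R by rewrite -natrM ler_nat.
have jqR : j%:R <= q%:R :> R by rewrite ler_nat ltnW.
have j0R : 0 <= j%:R :> R by [].
have qQR : q%:R <= Q%:R :> R by rewrite ler_nat.
have jn' : (j <= n)%N by rewrite (leq_trans _ jn)// leq_pmull.
rewrite natrB//; set N := n%:R; set J := j%:R.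
have NJ : 0 < N - J by rewrite /N /J; lra.
(* Exact Taylor expansion at n: the first-order part compares the slope with a/q, the remainder is
   quadratic in j. *)
have -> : Z ^+ 3 / (N - J) - (Z ^+ 3 / N + (a * j)%:R / q%:R) =
    J * (Z ^+ 3 / N ^+ 2 - a%:R / q%:R) + Z ^+ 3 * J ^+ 2 / (N ^+ 2 * (N - J)).
  by rewrite natrM -/J; field; rewrite !gt_eqF.
apply: le_trans (ler_normD _ _) _.
have h1 : `|J * (Z ^+ 3 / N ^+ 2 - a%:R / q%:R)| <= q%:R^-1.
  rewrite normrM (ger0_norm j0R).
  apply: le_trans (ler_wpM2l j0R nr) _.
  rewrite invfM mulrCA -[leRHS]mulr1; apply: ler_wpM2l; first by rewrite invr_ge0 ltW.
  by rewrite ler_pdivrMr// mul1r (le_trans jqR).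
(* 8192 = 2 * 16^3: the cube comes from q Z <= 16 N, the factor 2 from N - J >= N/2. *)
have h2 : `|Z ^+ 3 * J ^+ 2 / (N ^+ 2 * (N - J))| <= 8192 / q%:R.
  rewrite ger0_norm; last by rewrite divr_ge0 ?mulr_ge0 ?exprn_ge0 ?(ltW NJ) ?(ltW Z0) ?(ltW n0R).
  rewrite ler_pdivlMr// mulrAC ler_pdivrMr; last by rewrite mulr_gt0// exprn_gt0.
  have c1 : (q%:R * Z) ^+ 3 <= (16 * N) ^+ 3.
    rewrite lerXn2r ?nnegrE ?mulr_ge0 ?(ltW q0R) ?(ltW Z0) ?(ltW n0R)//.
    have := QZ; have := DnR; rewrite -/N; nra.
  have c2 : Z ^+ 3 * J ^+ 2 * q%:R <= (q%:R * Z) ^+ 3.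
    have -> : (q%:R * Z) ^+ 3 = Z ^+ 3 * q%:R ^+ 2 * q%:R by ring.
    apply: ler_wpM2r; first exact: ltW.
    apply: ler_wpM2l; first exact: ltW.
    by rewrite lerXn2r ?nnegrE// ltW.
  apply: le_trans c2 (le_trans c1 _).
  have : N ^+ 2 * N <= N ^+ 2 * (2 * (N - J)).
    apply: ler_wpM2l; [by rewrite exprn_ge0 ?(ltW n0R) | by rewrite /N /J; lra].
  rewrite -[leRHS]mulrA; lra.
by apply: le_trans (lerD h1 h2) _; rewrite le_eqVlt; apply/orP; left; apply/eqP; field; rewrite gt_eqF.
Qed.

Let near_bounds (n q a : nat) : (D <= n)%N -> (n < 2 * D)%N ->
  (0 < q <= Q)%N -> near q a n -> (0 < a <= amax q)%N.
Proof.
move=> Dn n2D /andP[q0 qQ] nr.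
have q0R : 0 < q%:R :> R by rewrite ltr0n.
have q1R : 1 <= q%:R :> R by rewrite ler1n.
have n0R : 0 < n%:R :> R by rewrite ltr0n (leq_trans D0).
have DnR : D%:R <= n%:R :> R by rewrite ler_nat.
have nDR : n%:R <= 2 * D%:R :> R by rewrite -natrM ler_nat ltnW.
have Z30 : 0 < Z ^+ 3 by rewrite exprn_gt0.
have d20 : 0 < D%:R ^+ 2 :> R by rewrite exprn_gt0.
have n20 : 0 < n%:R ^+ 2 :> R by rewrite exprn_gt0.
have Q2R : 2 <= Q%:R :> R by rewrite ler_nat.
set u := Z ^+ 3 / n%:R ^+ 2.
have u_lo : Z ^+ 3 / (4 * D%:R ^+ 2) <= u.
  rewrite /u ler_pM2l// lef_pV2 ?posrE ?mulr_gt0//.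
  have -> : 4 * D%:R ^+ 2 = (2 * D%:R) ^+ 2 :> R by ring.
  by rewrite lerXn2r ?nnegrE ?mulr_ge0// ltW.
have u_hi : u <= Z ^+ 3 / D%:R ^+ 2.
  by rewrite /u ler_pM2l// lef_pV2 ?posrE// lerXn2r ?nnegrE// ltW.
(* If a were 0, the slope would be at most 1/Q; but it is at least Z^3/(4 D^2), and Z^3 Q = Z^2 (Q
   Z) >= 8 D^2 because D <= Z^2. *)
have a0 : (0 < a)%N.
  rewrite lt0n; apply/eqP => aE; move: nr; rewrite /near aE mul0r subr0 -/u.
  rewrite ger0_norm ?divr_ge0 ?(ltW Z30) ?(ltW n20)//; apply/negP; rewrite -ltNge.
  apply: lt_le_trans u_lo; apply: (@le_lt_trans _ _ Q%:R^-1).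
    by rewrite lef_pV2 ?posrE ?mulr_gt0// ler_peMl// ltW.
  rewrite -div1r ltr_pdivrMr// mulrAC ltr_pdivlMr ?mulr_gt0// mul1r.
  have e1 : D%:R * (8 * D%:R) <= Z ^+ 2 * (Q%:R * Z).
    by apply: ler_pM; rewrite ?mulr_ge0// ltW.
  have -> : Z ^+ 3 * Q%:R = Z ^+ 2 * (Q%:R * Z) by ring.
  by apply: lt_le_trans e1; nra.
rewrite a0 /= /amax truncn_ge_nat; last first.
  by rewrite divr_ge0 ?mulr_ge0// ltW.
have a1R : 1 <= a%:R :> R by rewrite ler1n.
have aq : a%:R / q%:R <= Z ^+ 3 / D%:R ^+ 2 + (q%:R * 2)^-1.
  have : (q%:R * Q%:R)^-1 <= (q%:R * 2)^-1 :> R.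
    by rewrite lef_pV2 ?posrE ?mulr_gt0// ler_pM2l.
  by move: nr; rewrite /near ler_norml => /andP[h1 h2] h3; rewrite -/u in h1 h2; lra.
(* Together with a >= 1 this forces q Z^3/D^2 >= 1/2, so doubling that quantity absorbs the extra
   1/2. *)
have : a%:R <= q%:R * (Z ^+ 3 / D%:R ^+ 2) + 2^-1.
  move: aq; rewrite ler_pdivrMr// => /le_trans; apply.
  rewrite le_eqVlt; apply/orP; left; apply/eqP; field; rewrite !gt_eqF//.
have -> : 2 * q%:R * Z ^+ 3 / D%:R ^+ 2 = 2 * (q%:R * (Z ^+ 3 / D%:R ^+ 2)) by ring.
by lra.
Qed.

(** Between m and m' the slope drops by at least Z^3 (m' - m)/(8 D^3), while two slopes near a/q
    differ by at most 2/(qQ). *)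
Let cnt_le (q a n : nat) : (0 < q)%N -> (n <= 2 * D)%N ->
  (cnt q a n)%:R <= 16 * D%:R ^+ 3 / (q%:R * Q%:R * Z ^+ 3) + 1 :> R.
Proof.
move=> q0 n2D; apply: count_spread_le.
  rewrite divr_ge0 ?mulr_ge0 ?exprn_ge0 ?(ltW Q0R) ?(ltW Z0)//.
move=> m m' /andP[Dm mm'] m'n nm nm'.
have q0R : 0 < q%:R :> R by rewrite ltr0n.
have m0R : 0 < m%:R :> R by rewrite ltr0n (leq_trans D0).
have DmR : D%:R <= m%:R :> R by rewrite ler_nat.
have mm'R : m%:R <= m'%:R :> R by rewrite ler_nat ltnW.
have m'DR : m'%:R <= 2 * D%:R :> R by rewrite -natrM ler_nat ltnW// (leq_trans m'n).
have m'0R : 0 < m'%:R :> R by lra.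
have Z30 : 0 < Z ^+ 3 by rewrite exprn_gt0.
have dist : Z ^+ 3 / m%:R ^+ 2 - Z ^+ 3 / m'%:R ^+ 2 <= 2 * (q%:R * Q%:R)^-1.
  move: nm nm'; rewrite /near !ler_norml => /andP[h1 h2] /andP[h3 h4]; lra.
rewrite natrB; last exact: ltnW.
have lo : Z ^+ 3 * (m'%:R - m%:R) / (8 * D%:R ^+ 3) <= Z ^+ 3 / m%:R ^+ 2 - Z ^+ 3 / m'%:R ^+ 2.
  have -> : Z ^+ 3 / m%:R ^+ 2 - Z ^+ 3 / m'%:R ^+ 2 =
      Z ^+ 3 * (m'%:R - m%:R) * ((m%:R * m'%:R ^+ 2)^-1 + (m%:R ^+ 2 * m'%:R)^-1).
    by field; rewrite !gt_eqF.
  apply: ler_wpM2l; first by rewrite mulr_ge0 ?subr_ge0// ltW.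
  have -> : (8 * D%:R ^+ 3)^-1 = ((2 * D%:R) ^+ 3)^-1 + 0 :> R by rewrite addr0; congr (_^-1); ring.
  apply: lerD; last by rewrite invr_ge0 mulr_ge0 ?exprn_ge0// ltW.
  rewrite lef_pV2 ?posrE ?exprn_gt0 ?mulr_gt0 ?exprn_gt0//.
  have -> : (2 * D%:R) ^+ 3 = (2 * D%:R) * (2 * D%:R) ^+ 2 :> R by ring.
  apply: ler_pM; rewrite ?exprn_ge0 ?(ltW m0R) ?(ltW m'0R)//; first by lra.
  by rewrite lerXn2r ?nnegrE ?(ltW m'0R) ?mulr_ge0.
have := le_trans lo dist.
rewrite ler_pdivrMr ?mulr_gt0 ?exprn_gt0// => H.
rewrite ler_pdivlMr ?mulr_gt0//.
have -> : (m'%:R - m%:R) * (q%:R * Q%:R * Z ^+ 3) = (Z ^+ 3 * (m'%:R - m%:R)) * (q%:R * Q%:R) by ring.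
rewrite -ler_pdivlMr ?mulr_gt0//; apply: le_trans H _.
by rewrite le_eqVlt; apply/orP; left; apply/eqP; field; rewrite !gt_eqF.
Qed.

Let cnt_mono (q a n n' : nat) : (n <= n')%N -> (cnt q a n <= cnt q a n')%N.
Proof.
move=> nn'; rewrite /cnt; have [Dn|nD] := leqP D n.
  by rewrite [X in (_ <= X)%N](@big_cat_nat _ _ _ n)//= leq_addr.
by rewrite big_geq// ltnW.
Qed.

(** The slope is monotone in m, so the points near a given a/q form an interval. *)
Let near_convex (q a m1 m m2 : nat) : (0 < m1 <= m)%N -> (m <= m2)%N ->
  near q a m1 -> near q a m2 -> near q a m.
Proof.
move=> /andP[m10 m1m] mm2; rewrite /near !ler_norml => /andP[h1 h2] /andP[h3 h4].
have Z30 : 0 < Z ^+ 3 by rewrite exprn_gt0.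
have H i j : (0 < i <= j)%N -> Z ^+ 3 / j%:R ^+ 2 <= Z ^+ 3 / i%:R ^+ 2.
  move=> /andP[i0 ij]; rewrite ler_pM2l// lef_pV2 ?posrE ?exprn_gt0 ?ltr0n//; last exact: leq_trans ij.
  by rewrite lerXn2r ?nnegrE// ler_nat.
have e1 : Z ^+ 3 / m%:R ^+ 2 <= Z ^+ 3 / m1%:R ^+ 2 by apply: H; rewrite m10.
have e2 : Z ^+ 3 / m2%:R ^+ 2 <= Z ^+ 3 / m%:R ^+ 2 by apply: H; rewrite (leq_trans m10).
by apply/andP; split; lra.
Qed.

Let ceil_div_mono (k k' q : nat) : (k <= k')%N -> (ceil_div k q <= ceil_div k' q)%N.
Proof. by move=> kk'; rewrite /ceil_div leq_div2r// leq_add2r. Qed.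

(** Removing the block (n-q, n] lowers the summand of (q, a) by at least one. If no point up to n-q
    is near a/q, its ceiling is 0 before n and positive after. Otherwise [near_convex] makes all q
    points of the block near, so the count grows by exactly q and the ceiling by 1. The other
    summands are monotone. *)
Let potential_block (n q a : nat) : (D <= n)%N -> (n < 2 * D)%N ->
  (0 < q <= Q)%N -> near q a n -> (D + q <= n)%N ->
  (potential (n - q).+1 < potential n.+1)%N.
Proof.
move=> Dn n2D qQ nr Dqn; have aA := near_bounds Dn n2D qQ nr.
have q0 : (0 < q)%N by case/andP: qQ.
rewrite /potential !big_add1 /= !big_mkord.
have q1Q : (q.-1 < Q)%N by rewrite prednK//; case/andP: qQ.
rewrite (bigD1 (Ordinal q1Q))//= [X in (_ < X)%N](bigD1 (Ordinal q1Q))//= -addSn.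
apply: leq_add; last first.
  apply: leq_sum => i _; apply: leq_sum => j _.
  by apply: ceil_div_mono; apply: cnt_mono; rewrite ltnS leq_subr.
rewrite prednK// !big_add1 /= !big_mkord.
have a1A : (a.-1 < amax q)%N by case/andP: aA => a0 aA; rewrite prednK.
rewrite (bigD1 (Ordinal a1A))//= [X in (_ < X)%N](bigD1 (Ordinal a1A))//= -addSn.
apply: leq_add; last first.
  apply: leq_sum => j _.
  by apply: ceil_div_mono; apply: cnt_mono; rewrite ltnS leq_subr.
rewrite prednK; last by case/andP: aA.
have split_cnt : cnt q a n.+1 = (cnt q a (n - q).+1 + \sum_((n - q).+1 <= m < n.+1) near q a m)%N.
  rewrite /cnt (@big_cat_nat _ _ _ (n - q).+1)//=; last by rewrite ltnS leq_subr.
  by apply: leqW; rewrite leq_subRL ?(leq_trans (leq_addl D q) Dqn)// addnC.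
have [c0|c0] := posnP (cnt q a (n - q).+1).
  rewrite c0 /ceil_div add0n divn_small ?prednK// divn_gt0//.
  rewrite -[X in (X <= _)%N](prednK q0) -addn1 addnC leq_add2r.
  rewrite split_cnt c0 add0n big_nat_recr/= ?nr ?leq_addl//.
  by rewrite ltn_subrL q0 (leq_trans _ Dn).
have [m1 [Dm1 m1n nm1]] : exists m1, [/\ (D <= m1)%N, (m1 <= n - q)%N & near q a m1].
  move: c0; rewrite lt0n /cnt => /eqP c0; apply: contrapT => H; apply: c0.
  rewrite big_nat_cond big1// => m; rewrite andbT => /andP[Dm mn].
  by case nm : (near q a m) => //; case: H; exists m.
have allnear : (\sum_((n - q).+1 <= m < n.+1) near q a m)%N = q.
  rewrite -[RHS](subKn (m := q) (n := n.+1)); last by rewrite leqW// (leq_trans (leq_addl D q)).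
  rewrite (@subSn q n); last by rewrite (leq_trans (leq_addl D q)).
  rewrite -[RHS]muln1 -sum_nat_const_nat.
  rewrite big_nat_cond [RHS]big_nat_cond; apply: eq_bigr => m; rewrite andbT => /andP[m1' m2].
  rewrite (@near_convex q a m1 m n)// (leq_trans D0 Dm1)/=.
  by rewrite (leq_trans m1n)// ltnW.
by rewrite split_cnt allnear /ceil_div addnAC [X in (_ < X)%N]divnDr// divnn q0 addn1.
Qed.

Let sum_le_potential (n : nat) : (n < 2 * D)%N ->
  `|\sum_(D <= m < n.+1) sawtooth (Z ^+ 3 / m%:R)| <=
    B * (potential n.+1)%:R + Q%:R.
Proof.
have Z30 : 0 < Z ^+ 3 by rewrite exprn_gt0.
elim/ltn_ind: n => n IH n2D.
have [nD|Dn] := ltnP n D.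
  by rewrite big_geq// normr0 addr_ge0 ?mulr_ge0// ltW.
have Q0 : (0 < Q)%N by exact: leq_trans Q2.
have x0 : 0 <= Z ^+ 3 / n%:R ^+ 2 by rewrite divr_ge0 ?exprn_ge0// ltW.
have [q [a [qQ caq nr]]] := dirichlet_approx x0 Q0.
have [q0 qQ'] := andP qQ.
(* When no full block fits above D, at most q <= Q terms are left and the trivial bound is used;
   this happens once, whence the single summand Q. *)
have [nDq|Dqn] := ltnP n (D + q).
  apply: le_trans (ler_norm_sum _ _ _) _.
  apply: (@le_trans _ _ (\sum_(D <= m < n.+1) 1)).
    apply: ler_sum => m _; apply: le_trans (sawtooth_le_half _) _; last by lra.
    by rewrite divr_ge0// ltW.
  rewrite sumr_const_nat; apply: (@le_trans _ _ Q%:R); last by rewrite lerDr mulr_ge0// ltW.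
  by rewrite ler_nat leq_subLR (leq_trans nDq)// leq_add2l.
have nqn : (n - q < n)%N by rewrite ltn_subrL q0 (leq_trans D0).
have IHn := IH _ nqn (ltn_trans nqn n2D).
rewrite (@big_cat_nat _ _ _ (n - q).+1)//=; last 2 first.
  by apply: leqW; rewrite leq_subRL ?(leq_trans (leq_addl D q) Dqn)// addnC.
  by rewrite ltnW.
apply: le_trans (ler_normD _ _) _.
rewrite (sum_nat_last_terms (fun i => sawtooth (Z ^+ 3 / i%:R))); last first.
  by rewrite (leq_trans (leq_addl D q)).
have := near_block Dn n2D qQ caq nr.
have := potential_block Dn n2D qQ nr Dqn.
rewrite -(ler_nat R) -natr1 => h1 h2.
apply: le_trans (lerD IHn h2) _; rewrite addrAC lerD2r.
by apply: le_trans (ler_wpM2l (ltW B0) h1); rewrite mulrDr mulr1.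
Qed.

(** For each q there are at most [amax q] numerators, each with at most window/q + 2 blocks. The
    window part sums to D/Q times a harmonic sum, the constant part to Q^2 Z^3/D^2; both are O(Z) up
    to the harmonic factor as Q is of order D/Z. *)
Let potential_le : (potential (2 * D))%:R <=
  8 * Z * \sum_(1 <= q < Q.+1) q%:R^-1 + 1024 * Z.
Proof.
have Z30 : 0 < Z ^+ 3 by rewrite exprn_gt0.
have d20 : 0 < D%:R ^+ 2 :> R by rewrite exprn_gt0.
have step q : (0 < q)%N ->
    (\sum_(1 <= a < (amax q).+1) ceil_div (cnt q a (2 * D)) q)%N%:R <=
    32 * (D%:R / Q%:R) / q%:R + 4 * q%:R * Z ^+ 3 / D%:R ^+ 2 :> R.
  move=> q0; have q0R : 0 < q%:R :> R by rewrite ltr0n.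
  rewrite natr_sum.
  apply: (@le_trans _ _ (\sum_(1 <= a < (amax q).+1)
      (16 * D%:R ^+ 3 / (q%:R ^+ 2 * Q%:R * Z ^+ 3) + 2))).
    apply: ler_sum_nat => a _.
    rewrite -(ler_pM2r q0R).
    apply: (@le_trans _ _ ((cnt q a (2 * D))%:R + q%:R)).
      rewrite -natrM -natrD ler_nat (leq_trans (leq_divM _ _))//.
      by rewrite leq_add2l leq_pred.
    have := cnt_le a q0 (leqnn (2 * D)).
    have -> : (16 * D%:R ^+ 3 / (q%:R ^+ 2 * Q%:R * Z ^+ 3) + 2) * q%:R =
      16 * D%:R ^+ 3 / (q%:R * Q%:R * Z ^+ 3) + 2 * q%:R by field; rewrite !gt_eqF.
    have : 1 <= q%:R :> R by rewrite ler1n.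
    by lra.
  rewrite sumr_const_nat subSS subn0 -[leLHS]mulr_natl.
  have am : (amax q)%:R <= 2 * q%:R * Z ^+ 3 / D%:R ^+ 2 :> R.
    by rewrite truncn_le divr_ge0 ?mulr_ge0// ltW.
  have c0 : 0 <= 16 * D%:R ^+ 3 / (q%:R ^+ 2 * Q%:R * Z ^+ 3) + 2.
    by rewrite addr_ge0// divr_ge0 ?mulr_ge0 ?exprn_ge0// ltW.
  apply: le_trans (ler_wpM2r c0 am) _.
  by rewrite le_eqVlt; apply/orP; left; apply/eqP; field; rewrite !gt_eqF.
rewrite natr_sum; apply: (@le_trans _ _ (\sum_(1 <= q < Q.+1)
    (4 * Z * q%:R^-1 + 4 * Q%:R * Z ^+ 3 / D%:R ^+ 2))).
  apply: ler_sum_nat => q /andP[q0 qQ]; apply: le_trans (step q q0) _.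
  have q0R : 0 < q%:R :> R by rewrite ltr0n.
  apply: lerD.
    rewrite ler_pM2r ?invr_gt0// mulrA ler_pdivrMr//.
    have := QZ_ge; lra.
  rewrite ler_pM2r ?invr_gt0// ler_pM2r// ler_pM2l//.
  by rewrite ler_nat -ltnS.
rewrite big_split/= -mulr_sumr sumr_const_nat subSS subn0 -[X in _ + X <= _]mulr_natr.
apply: lerD.
  apply: ler_wpM2r; last by rewrite ler_pM2r//; lra.
  by apply: sumr_ge0 => i _; rewrite invr_ge0.
rewrite mulrAC ler_pdivrMr//.
have : (Q%:R * Z) ^+ 2 <= (16 * D%:R) ^+ 2.
  by rewrite lerXn2r ?nnegrE ?mulr_ge0// ltW.
move=> H; have : (Q%:R * Z) ^+ 2 * (4 * Z) <= (16 * D%:R) ^+ 2 * (4 * Z).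
  by rewrite ler_pM2r// mulr_gt0.
lra.
Qed.

Lemma sawtooth_dyadic_sum (n : nat) : (n < 2 * D)%N ->
  `|\sum_(D <= m < n.+1) sawtooth (Z ^+ 3 / m%:R)| <=
    B * (8 * Z * \sum_(1 <= q < Q.+1) q%:R^-1 + 1024 * Z) + Q%:R.
Proof.
move=> n2D; apply: le_trans (sum_le_potential n2D) _.
rewrite lerD2r ler_pM2l//; apply: le_trans potential_le.
rewrite ler_nat; apply: leq_sum => q _; apply: leq_sum => a _.
by apply: ceil_div_mono; exact: cnt_mono.
Qed.

End SawtoothHyperbola.

Lemma growth_comp_truncn_powR (R : realType) (a e : R) (f : nat -> R) : 0 < a ->
  growth (natsize R) e f -> growth id (a * e) (fun x => f (Num.truncn (x `^ a))).
Proof.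
move=> a0 Hf; apply: (growth_comp (c := 2)) Hf => // x x1.
have xa1 : 1 <= x `^ a by rewrite -(powRr0 x) ler_powR// ltW.
have x0 : 0 <= x `^ a by exact: le_trans xa1.
have /andP[h1 h2] := truncn_itv x0.
have h3 : 1 <= (Num.truncn (x `^ a))%:R :> R by rewrite ler1n truncn_gt0.
split => //; first lra.
by move: h2; rewrite -[_.+1]addn1 natrD; lra.
Qed.

Lemma growth_sum_inv (R : realType) :
  growth (natsize R) 0 (fun N => \sum_(1 <= n < N.+1) n%:R^-1).
Proof.
have H := growth_sum (lexx (-1)) (growth_size_inv (natsize R) 1).
apply: (growth_le (g := fun N => \sum_(1 <= n < N.+1) `|(n%:R ^+ 1)^-1|)).
  by move: H; rewrite addNr.
move=> N _; rewrite ger0_norm; last by apply: sumr_ge0 => n _; rewrite invr_ge0.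
rewrite ger0_norm; last by apply: sumr_ge0 => n _; rewrite normr_ge0.
by apply: ler_sum => n _; rewrite expr1 ler_norm.
Qed.

Lemma growth_trunc_log (R : realType) :
  growth (natsize R) 0 (fun N => (trunc_log 2 N).+1%:R).
Proof.
apply: (growth_le (g := fun N => 1 + (ln 2)^-1 * ln N%:R)).
  by apply: growthD; [exact: growth_cst | apply: growthZ; exact: growth_ln].
move=> N N1; have ln2 : 0 < ln 2 :> R by apply: ln_gt0; lra.
have N0 : 0 < N%:R :> R by exact: lt_le_trans N1.
rewrite !ger0_norm//; last first.
  by rewrite addr_ge0// mulr_ge0 ?ln_ge0// invr_ge0 ltW.
rewrite -natr1 addrC lerD2l mulrC ler_pdivlMr// mulr_natl -lnXn//.
rewrite ler_ln ?posrE ?exprn_gt0// -natrX ler_nat.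
by apply: trunc_logP => //; move: N1; rewrite ler1n.
Qed.

(** Uniform in D <= Z^2: for 32 <= Z the order 16 D/Z is at most Z^2, where the harmonic sum is cut,
    and at most 16 Z, the last summand. *)
Definition dyadic_bound (R : realType) (Z : R) : R :=
  16387 * (8 * Z * (\sum_(1 <= q < (Num.truncn (Z `^ 2)).+1) q%:R^-1) + 1024 * Z)
  + 16 * Z.

Lemma growth_dyadic_bound (R : realType) : growth id 1 (@dyadic_bound R).
Proof.
have H0 : growth id 0 (fun Z : R => \sum_(1 <= q < (Num.truncn (Z `^ 2)).+1) q%:R^-1).
  by have := growth_comp_truncn_powR (ltr0Sn R 1) (@growth_sum_inv R); rewrite mulr0.
have H1 : growth id 1 (@id R) by exact: growth_size.
apply: growthD; last exact: (growthZ 16 H1).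
apply: growthZ; apply: growthD; last exact: (growthZ 1024 H1).
by have := growthM (growthZ 8 H1) H0; rewrite addr0.
Qed.

Lemma sawtooth_dyadic_le (R : realType) (Z : R) (D n : nat) :
  32 <= Z -> (0 < D)%N -> D%:R <= Z ^+ 2 -> (n < 2 * D)%N ->
  `|\sum_(D <= m < n.+1) sawtooth (Z ^+ 3 / m%:R)| <= dyadic_bound Z.
Proof.
move=> Z32 D0 DZ n2D.
have Z0 : 0 < Z by apply: lt_le_trans Z32.
have D0R : 0 < D%:R :> R by rewrite ltr0n.
have S0 N : 0 <= \sum_(1 <= q < N) q%:R^-1 :> R.
  by apply: sumr_ge0 => i _; rewrite invr_ge0.
have [Q2|Q1] := leqP 2 (Num.truncn (16 * D%:R / Z)).
  apply: le_trans (sawtooth_dyadic_sum (erefl _) Z32 D0 DZ Q2 n2D) _.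
  have QZ : (Num.truncn (16 * D%:R / Z))%:R <= 16 * Z.
    apply: (@le_trans _ _ (16 * D%:R / Z)).
      by rewrite truncn_le divr_ge0// ?mulr_ge0//; exact: ltW.
    by rewrite ler_pdivrMr// -mulrA ler_pM2l// -expr2.
  apply: lerD => //.
  apply: ler_wpM2l; first lra.
  rewrite lerD2r; apply: ler_wpM2l; first by rewrite mulr_ge0// ltW.
  have QN : (Num.truncn (16 * D%:R / Z) <= Num.truncn (Z `^ 2))%N.
    apply: le_truncn; rewrite powR_mulrn ?(ltW Z0)//; apply: le_trans DZ.
    by rewrite ler_pdivrMr// mulrC ler_pM2l//; lra.
  by rewrite [leRHS](@big_cat_nat _ _ _ (Num.truncn (16 * D%:R / Z)).+1)//= lerDl;
     apply: sumr_ge0 => i _; rewrite invr_ge0.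
(* Q <= 1 means 16 D < 2 Z; the block then has at most D <= Z terms and is bounded trivially. *)
have DZ' : D%:R <= Z.
  move: Q1; rewrite truncn_lt_nat; last by rewrite divr_ge0// ?mulr_ge0//; exact: ltW.
  by rewrite ltr_pdivrMr//; lra.
apply: (@le_trans _ _ (16 * Z)); last first.
  rewrite /dyadic_bound lerDr; apply: mulr_ge0; first lra.
  apply: addr_ge0; last by apply: mulr_ge0; [exact: ler0n | exact: ltW].
  by apply: mulr_ge0 => //; apply: mulr_ge0; [exact: ler0n | exact: ltW].
apply: le_trans (ler_norm_sum _ _ _) _.
apply: (@le_trans _ _ (\sum_(D <= m < n.+1) 1)).
  apply: ler_sum => m _; apply: le_trans (sawtooth_le_half _) _; last by lra.
  by rewrite divr_ge0 ?exprn_ge0// ltW.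
rewrite sumr_const_nat; apply: (@le_trans _ _ D%:R); last lra.
by rewrite ler_nat leq_subLR addnn -mul2n.
Qed.

(** With X = Z^3 this is the bound X^(1/3+eps) for sums of length up to X^(2/3): at most
    logarithmically many dyadic blocks of size O(Z^(1+eps)) each. *)
Lemma sawtooth_hyperbola_sum (R : realType) :
  exists2 G : R -> R, growth id 1 G & forall (Z : R) (U : nat),
    1 <= Z -> U%:R <= Z ^+ 2 ->
    `|\sum_(1 <= m < U.+1) sawtooth (Z ^+ 3 / m%:R)| <= G Z.
Proof.
(* 1024 = 32^2 bounds the number of terms when Z < 32. *)
exists (fun Z => 1024 + (trunc_log 2 (Num.truncn (Z `^ 2))).+1%:R * `|dyadic_bound Z|).
  apply: growthD; first exact: growth_expW ler01 (growth_cst _ _).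
  have := growth_comp_truncn_powR (ltr0Sn R 1) (@growth_trunc_log R); rewrite mulr0 => H.
  by have := growthM H (growth_norm (@growth_dyadic_bound R)); rewrite add0r.
move=> Z U Z1 UZ; have Z0 : 0 < Z by exact: lt_le_trans Z1.
have [Z32|Z32] := leP 32 Z; last first.
  rewrite ler_wpDr ?mulr_ge0//.
  apply: le_trans (ler_norm_sum _ _ _) _.
  apply: (@le_trans _ _ (\sum_(1 <= m < U.+1) 1)).
    apply: ler_sum => m _; apply: le_trans (sawtooth_le_half _) _; last by lra.
    by rewrite divr_ge0 ?exprn_ge0// ltW.
  rewrite sumr_const_nat subSS subn0; apply: le_trans UZ _.
  have : Z ^+ 2 <= 32 ^+ 2 by rewrite lerXn2r ?nnegrE ?(ltW Z0)// ltW.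
  lra.
apply: ler_wpDl; first exact: ler0n.
(* Each step of the induction on k peels off the top block [2^k, V]. *)
have dy k V : (V < 2 ^ k)%N -> (V <= U)%N ->
    `|\sum_(1 <= m < V.+1) sawtooth (Z ^+ 3 / m%:R)| <= k%:R * `|dyadic_bound Z|.
  elim: k V => [|k IH] V Vk VU.
    by move: Vk; rewrite expn0 ltnS leqn0 => /eqP ->; rewrite big_geq// normr0 mul0r.
  have [Vk'|Vk'] := ltnP V (2 ^ k).
    apply: le_trans (IH _ Vk' VU) _; rewrite ler_wpM2r// ler_nat//.
  have k0 : (0 < 2 ^ k)%N by rewrite expn_gt0.
  rewrite (@big_cat_nat _ _ _ (2 ^ k))//=; last by rewrite leqW.
  apply: le_trans (ler_normD _ _) _.
  rewrite -natr1 mulrDl mul1r; apply: lerD.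
    have := IH (2 ^ k).-1; rewrite prednK//; apply => //.
    by rewrite (leq_trans (leq_pred _))// (leq_trans Vk').
  apply: le_trans (ler_norm _); apply: sawtooth_dyadic_le => //.
    by apply: le_trans UZ; rewrite ler_nat (leq_trans Vk').
  by rewrite -expnS.
apply: le_trans (dy (trunc_log 2 U).+1 U _ (leqnn U)) _.
  exact: trunc_log_ltn.
apply: ler_wpM2r => //; rewrite ler_nat ltnS; apply: leq_trunc_log.
by rewrite truncn_ge_nat ?powR_ge0// powR_mulrn// ltW.
Qed.

(** * Stieltjes constants and divisor sums *)

Lemma is_derive_inv_id (R : realType) (x : R) : x != 0 ->
  is_derive x 1 (fun x : R => x^-1) (- x ^- 2).
Proof.
move=> x0; apply: DeriveDef; first exact: derivableV.
by rewrite (@deriveV _ _ id)// derive_id /GRing.scale/= mulr1.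
Qed.

(** Error of the trapezoid rule for 1/x on [1, y]; the difference has derivative (1 - 1/x)^2 / 2, so
    the mean value theorem gives a cubic bound. *)
Lemma ln_trapezoid (R : realType) (y : R) : 1 <= y ->
  0 <= 2^-1 * (y - y^-1) - ln y <= 2^-1 * (y - 1) ^+ 3.
Proof.
move=> y1.
pose f (x : R) := 2^-1 * (x - x^-1) - ln x.
pose df (x : R) := 2^-1 * (1 + x ^- 2) - x^-1.
have der (x : R) : 1 <= x -> is_derive x 1 f (df x).
  move=> x1; have x0 : 0 < x by exact: lt_le_trans x1.
  have xu : x != 0 by rewrite gt_eqF.
  have dV : is_derive x 1 (fun x : R => x^-1) (- x ^- 2).
    exact: is_derive_inv_id (lt0r_neq0 x0).
  have dl := is_derive1_ln x0.
  apply: is_derive_eq.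
  by rewrite /df /GRing.scale /=; ring.
have [||c cy] := @MVT_segment R f df 1 y y1.
- by move=> x; rewrite in_itv/= => /andP[/ltW x1 _]; exact: der.
- apply: derivable_within_continuous => x; rewrite in_itv/= => /andP[x1 _].
  by have [] := der x x1.
have f1 : f 1 = 0 by rewrite /f invr1 subrr mulr0 ln1 subrr.
move: cy; rewrite in_itv/= => /andP[c1 cy].
have c0 : 0 < c by exact: lt_le_trans c1.
have dfE : df c = 2^-1 * (1 - c^-1) ^+ 2 by rewrite /df; field; rewrite gt_eqF.
rewrite -/(f y) f1 subr0 => ->; rewrite dfE; apply/andP; split.
  by rewrite !mulr_ge0 ?exprn_ge0 ?invr_ge0 ?subr_ge0// invf_le1.
have y10 : 0 <= y - 1 by rewrite subr_ge0.
rewrite -mulrA; apply: ler_wpM2l; first by rewrite invr_ge0.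
rewrite [(y - 1) ^+ 3]exprSr; apply: ler_wpM2r => //.
have cc : 1 - c^-1 <= y - 1.
  apply: (@le_trans _ _ (c - 1)); last lra.
  rewrite -subr_ge0; have -> : c - 1 - (1 - c^-1) = (c - 1) ^+ 2 / c by field; rewrite gt_eqF.
  by rewrite divr_ge0 ?exprn_even_ge0// ltW.
by rewrite lerXn2r ?nnegrE// subr_ge0 invf_le1.
Qed.

(** As ln 0 is 0 by convention, the step at n = 1 vanishes and the steps from 1 to N add up to ln
    N. *)
Definition ln_step (R : realType) (n : nat) : R := ln n%:R - ln n.-1%:R.

Lemma ln_step_bounds (R : realType) (n : nat) : (1 < n)%N ->
  n%:R^-1 <= ln_step R n <= n.-1%:R^-1.
Proof.
case: n => // n; rewrite ltnS => n0; rewrite /ln_step/=.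
have n0R : 0 < n%:R :> R by rewrite ltr0n.
have s0R : 0 < n.+1%:R :> R by rewrite ltr0n.
apply/andP; split.
  have : ln (1 + - n.+1%:R^-1) <= - n.+1%:R^-1 :> R.
    by apply: le_ln1Dx; rewrite ltrN2 invf_lt1// ltr1n.
  have -> : 1 + - n.+1%:R^-1 = n%:R / n.+1%:R :> R.
    by rewrite -[n.+1]addn1 natrD; field; rewrite natr1 gt_eqF.
  by rewrite ln_div ?posrE// lerNr opprB.
rewrite -ln_div ?posrE//.
have -> : n.+1%:R / n%:R = 1 + n%:R^-1 :> R.
  by rewrite -[n.+1]addn1 natrD; field; rewrite gt_eqF.
by apply: le_ln1Dx; rewrite (lt_trans _ (_ : 0 < _))// ?invr_gt0// ltrN10.
Qed.

Lemma pred_inv_le (R : realType) (n : nat) : (1 < n)%N ->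
  n.-1%:R^-1 - n%:R^-1 <= 2 / n%:R ^+ 2 :> R.
Proof.
case: n => // n; rewrite ltnS => n0/=.
have n0R : 0 < n%:R :> R by rewrite ltr0n.
have n1R : 1 <= n%:R :> R by rewrite ler1n.
have s0R : 0 < n%:R + 1 :> R by rewrite addr_gt0.
rewrite -natr1.
have -> : n%:R^-1 - (n%:R + 1)^-1 = 1 / (n%:R * (n%:R + 1)) :> R by field; rewrite !gt_eqF.
rewrite ler_pdivrMr ?mulr_gt0// mulrAC ler_pdivlMr ?exprn_gt0// mul1r.
nra.
Qed.

Lemma growth_ln_step (R : realType) : growth (natsize R) (-1) (ln_step R).
Proof.
apply: (@growth_bound _ _ _ _ 2) => n; rewrite ler1n => n1.
rewrite powR_inv1//; have [->|n2] : n = 1%N \/ (1 < n)%N by lia.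
  by rewrite /ln_step/= ln1 ln0// subrr normr0 invr1 mulr1.
have /andP[h1 h2] := ln_step_bounds R n2.
have n0R : 0 < n%:R :> R by rewrite ltr0n.
rewrite ger0_norm; last by apply: le_trans h1; rewrite invr_ge0.
apply: le_trans h2 _.
have p0R : 0 < n.-1%:R :> R by rewrite ltr0n; lia.
rewrite ler_pdivlMr// mulrC ler_pdivrMr// -natrM ler_nat; lia.
Qed.

Lemma growth_inv_sub_ln_step (R : realType) :
  growth (natsize R) (-2) (fun n => n%:R^-1 - ln_step R n).
Proof.
apply: (@growth_bound _ _ _ _ 2) => n; rewrite ler1n => n1.
have -> : n%:R `^ (-2) = (n%:R ^+ 2)^-1 :> R by rewrite -[2]/(2%:R) powR_invn.
have [->|n2] : n = 1%N \/ (1 < n)%N by lia.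
  by rewrite /ln_step/= ln1 ln0// !subr0 invr1 normr1 expr1n invr1 mulr1; lra.
have /andP[h1 h2] := ln_step_bounds R n2.
have := pred_inv_le R n2.
rewrite distrC ger0_norm ?subr_ge0//; lra.
Qed.

Lemma log_sum_asymp (R : realType) (j : nat) : (j <= 2)%N ->
  exists g : R, growth (natsize R) (-1)
    (fun N => \sum_(1 <= n < N.+1) ln n%:R ^+ j / n%:R - ln N%:R ^+ j.+1 / j.+1%:R - g).
Proof.
move=> j2.
(* Defect of the summand against the telescoping increment of ln^(j+1)/(j+1). In powers of the step
   s = ln n - ln(n-1) it is ln^j n (1/n - s) plus terms with s^2 or s^3, hence of exponent -2. *)
pose a n : R := ln n%:R ^+ j / n%:R - (ln n%:R ^+ j.+1 - ln n.-1%:R ^+ j.+1) / j.+1%:R.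
have Ha : growth (natsize R) (-2) a.
  have lnN : growth (natsize R) 0 (fun n => ln n%:R) by exact: growth_ln.
  have h1 := @growth_inv_sub_ln_step R.
  have h2 := @growth_ln_step R.
  have h22 := growthM h2 h2; have h222 := growthM h22 h2.
  have {}h22 := growth_expW (ltac:(lra) : -1 + -1 <= -2 :> R) h22.
  have {}h222 := growth_expW (ltac:(lra) : -1 + -1 + -1 <= -2 :> R) h222.
  case: j j2 @a => [|[|[|//]]] _ a.
  - apply: growth_ext h1 _ => n n1.
    have n0 : n%:R != 0 :> R by rewrite gt_eqF// (lt_le_trans ltr01).
    by rewrite /a /ln_step; field.
  - have := growthM lnN h1; rewrite add0r => k1.
    have H := growthD k1 (growthZ (2^-1) h22).
    apply: growth_ext H _ => n n1.
    rewrite /a /ln_step; set p := ln n%:R; set q := ln n.-1%:R.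
    have : n%:R != 0 :> R by rewrite gt_eqF// (lt_le_trans ltr01).
    by move=> n0; field.
  have := growthM (growthX 2 lnN) h1; rewrite add0r => k1.
  have := growthM lnN h22; rewrite add0r => k2.
  have H := growthD k1 (growthD k2 (growthZ (- 3^-1) h222)).
  apply: growth_ext H _ => n n1.
  rewrite /a /ln_step; set p := ln n%:R; set q := ln n.-1%:R.
  have : n%:R != 0 :> R by rewrite gt_eqF// (lt_le_trans ltr01).
  by move=> n0; field.
have [l [_ Hl]] := series_growth (ltac:(lra) : -2 < -1 :> R) Ha.
exists l; have : -2 + 1 = -1 :> R by lra.
move=> e; rewrite e in Hl; apply: growth_ext (growthN Hl) _ => N.
rewrite ler1n => N1; rewrite opprB; congr (_ - _).
rewrite sumrB -mulr_suml; congr (_ - _ / _).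
rewrite big_add1/= (telescope_sumr_eq (fun n => ln n%:R ^+ j.+1))//.
by rewrite (ln0 (lexx 0)) expr0n subr0.
Qed.

Lemma growth_ln_truncn (R : realType) :
  growth id (-1) (fun x : R => ln x - ln (Num.truncn x)%:R).
Proof.
apply: (@growth_bound _ _ _ _ 2) => x x1.
have x0 : 0 < x by exact: lt_le_trans x1.
have /andP[h1 h2] := truncn_itv (ltW x0).
have N1 : 1 <= (Num.truncn x)%:R :> R by rewrite ler1n truncn_gt0.
move: h2; rewrite -natr1; set N := _%:R => h2.
have N0 : 0 < N by exact: lt_le_trans N1.
rewrite powR_inv1 ?(ltW x0)// ger0_norm; last by rewrite subr_ge0 ler_ln ?posrE.
rewrite -ln_div ?posrE//.
have -> : x / N = 1 + (x - N) / N by field; rewrite gt_eqF.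
apply: (@le_trans _ _ ((x - N) / N)).
  apply: le_ln1Dx; apply: (@lt_le_trans _ _ 0); first by rewrite ltrN10.
  by rewrite divr_ge0 ?subr_ge0// ltW.
by rewrite ler_pdivrMr// mulrAC ler_pdivlMr//; nra.
Qed.

Lemma growth_lnX_truncn (R : realType) (k : nat) :
  growth id (-1) (fun x : R => ln x ^+ k - ln (Num.truncn x)%:R ^+ k).
Proof.
have lt : growth id 0 (fun x : R => ln (Num.truncn x)%:R).
  exact: growth_comp_truncn (growth_ln _).
elim: k => [|k IH].
  by apply: growth_ext (growth0 _ _) _ => x _; rewrite !expr0 subrr.
have := growthM (growth_ln id) IH; rewrite add0r => H1.
have := growthM (@growth_ln_truncn R) (growthX k lt); rewrite addr0 => H2.
apply: growth_ext (growthD H1 H2) _ => x _ /=.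
by rewrite !exprS; ring.
Qed.

(** Also shows that the limit defining [stieltjes] exists for j <= 2, the only indices that
    occur. *)
Lemma stieltjes_asymp (R : realType) (j : nat) : (j <= 2)%N ->
  growth id (-1) (fun x : R =>
    \sum_(1 <= n < (Num.truncn x).+1) ln n%:R ^+ j / n%:R
      - ln x ^+ j.+1 / j.+1%:R - stieltjes R j).
Proof.
move=> j2; have [g Hg] := log_sum_asymp R j2.
have H : growth id (-1) (fun x : R =>
    \sum_(1 <= n < (Num.truncn x).+1) ln n%:R ^+ j / n%:R
      - ln x ^+ j.+1 / j.+1%:R - g).
  have := growthB (growth_comp_truncn Hg) (growthZ (j.+1%:R^-1) (@growth_lnX_truncn R j.+1)).
  by move=> H; apply: growth_ext H _ => x _; ring.
suff -> : stieltjes R j = g by [].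
apply: cvg_lim => //.
have H0 := growth_cvg0 (ltrN10 R) H.
rewrite -[g]add0r; apply: cvg_trans (cvgD H0 (cvg_cst g)).
by apply: near_eq_cvg; near=> x; rewrite /= subrK.
Unshelve. all: by end_near. Qed.

(** The term 1/(2N) is needed because [divisor_delta_sawtooth] multiplies the error by u with N
    close to sqrt u, and must end with O(1) up to eps. *)
Lemma harmonic_asymp (R : realType) :
  growth (natsize R) (-2)
    (fun N => \sum_(1 <= n < N.+1) n%:R^-1 - ln N%:R - stieltjes R 0 - (2 * N%:R)^-1).
Proof.
(* Trapezoid errors. With 1/0 = 0 at n = 1 they add up to H_N - 1/(2N) - ln N. *)
pose a n : R := 2^-1 * (n%:R^-1 + n.-1%:R^-1) - ln_step R n.
have Ha : growth (natsize R) (-3) a.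
  apply: (@growth_bound _ _ _ _ 4) => n; rewrite ler1n => n1.
  have -> : n%:R `^ (-3) = (n%:R ^+ 3)^-1 :> R by rewrite -[3]/(3%:R) powR_invn.
  have [->|n2] : n = 1%N \/ (1 < n)%N by lia.
    rewrite /a /ln_step/= ln1 ln0// subr0 invr0 addr0 subr0 invr1 mulr1 expr1n invr1.
    by rewrite ger0_norm; lra.
  have n0R : 0 < n%:R :> R by rewrite ltr0n.
  have p0R : 0 < n.-1%:R :> R by rewrite ltr0n; lia.
  have nE : n%:R = n.-1%:R + 1 :> R by rewrite natr1 prednK//; lia.
  have y1 : 1 <= n%:R / n.-1%:R :> R by rewrite ler_pdivlMr// mul1r nE lerDl.
  have := ln_trapezoid y1; rewrite ln_div ?posrE// -/(ln_step R n).
  have -> : n%:R / n.-1%:R - 1 = n.-1%:R^-1 :> R by rewrite nE; field; rewrite gt_eqF.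
  have -> : 2^-1 * (n%:R / n.-1%:R - (n%:R / n.-1%:R)^-1) =
      2^-1 * (n%:R^-1 + n.-1%:R^-1) :> R.
    by rewrite nE; field; rewrite -nE !gt_eqF.
  rewrite -/(a n) => /andP[a0 a1]; rewrite ger0_norm//; apply: le_trans a1 _.
  rewrite -exprVn.
  have : n.-1%:R^-1 <= 2 * n%:R^-1 :> R.
    by rewrite ler_pdivlMr// mulrC ler_pdivrMr// -natrM ler_nat; lia.
  move=> h; have : (n.-1%:R^-1) ^+ 3 <= (2 * n%:R^-1) ^+ 3 :> R.
    by rewrite lerXn2r ?nnegrE ?mulr_ge0 ?invr_ge0// ltW.
  by rewrite exprMn; lra.
have [l [_ Hl]] := series_growth (ltac:(lra) : -3 < -1 :> R) Ha.
have e : -3 + 1 = -2 :> R by lra.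
rewrite e in Hl.
have sE N : (0 < N)%N -> \sum_(1 <= n < N.+1) a n =
    \sum_(1 <= n < N.+1) n%:R^-1 - ln N%:R - (2 * N%:R)^-1.
  elim: N => // -[|N] IH _.
    rewrite !big_nat1 /a /ln_step/= ln1 ln0// invr0 invr1; lra.
  rewrite big_nat_recr//= IH// [in RHS]big_nat_recr//= /a /ln_step/=.
  have h1 : N.+1%:R != 0 :> R by rewrite pnatr_eq0.
  have h2 : N.+2%:R != 0 :> R by rewrite pnatr_eq0.
  move: h2; rewrite -[N.+2]addn1 natrD.
  move: (\sum_(_ <= _ < _) _) (N.+1%:R) h1 => s x h1 h2.
  by field; rewrite h1 h2.
have H1 : growth (natsize R) (-2)
    (fun N => \sum_(1 <= n < N.+1) n%:R^-1 - ln N%:R - l - (2 * N%:R)^-1).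
  apply: growth_ext (growthN Hl) _ => N; rewrite ler1n => N1.
  by rewrite opprB sE//; lra.
suff <- : l = stieltjes R 0 by [].
have inv : growth (natsize R) (-1) (fun N => (2 * N%:R)^-1).
  have := growthZ (2^-1) (growth_size_inv (natsize R) 1) => H; apply: growth_ext H _ => N _.
  by rewrite expr1 invfM.
have H2 := growthD (growth_expW (ltac:(lra) : -2 <= -1 :> R) H1) inv.
have H3 := growthB (growth_comp_truncn H2) (@growth_ln_truncn R).
have H4 := growthB H3 (@stieltjes_asymp R 0 isT).
(* Two expansions of the same harmonic sum: their constants differ by a constant that tends to 0. *)
have H5 : growth id (-1) (fun _ : R => stieltjes R 0 - l).
  apply: growth_ext H4 _ => x _; rewrite !expr1 divr1.
  under [X in _ = _ - (X - _ - _)]eq_bigr do rewrite expr0 mul1r.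
  lra.
have h0 := growth_cvg0 (ltrN10 R) H5.
have h1 := cvg_unique (@Rhausdorff R) (cvg_cst (stieltjes R 0 - l)) h0.
by apply/esym/eqP; rewrite -subr_eq0 h1.
Qed.

(** * Divisor sums and Moebius inversion *)

Lemma sum_multiples (V : nmodType) (F : nat -> V) (a n : nat) : (0 < a)%N ->
  \sum_(1 <= k < n.+1 | (a %| k)%N) F k = \sum_(1 <= b < (n %/ a).+1) F (a * b)%N.
Proof.
move=> a0; elim: n => [|n IH]; first by rewrite div0n !big_geq.
rewrite big_mkcond big_nat_recr//= -big_mkcond IH divnS//.
case: ifP => [dv|_]; last by rewrite addr0.
rewrite add1n [RHS]big_nat_recr//=; congr (_ + F _).
by rewrite -[LHS](divnK dv) divnS// dv add1n mulnC.
Qed.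

Lemma big_divisors (V : nmodType) (F : nat -> V) (k N : nat) : (0 < k <= N)%N ->
  \sum_(d <- divisors k) F d = \sum_(1 <= d < N.+1 | (d %| k)%N) F d.
Proof.
move=> /andP[k0 kN]; rewrite -[RHS]big_filter; apply: perm_big; apply: uniq_perm.
- exact: divisors_uniq.
- by rewrite filter_uniq// iota_uniq.
move=> d; rewrite mem_filter mem_index_iota -dvdn_divisors//.
case dk : (d %| k)%N => //=; rewrite (dvdn_gt0 k0 dk) ltnS.
by rewrite (leq_trans (dvdn_leq k0 dk)).
Qed.

Lemma sum_divisors_exchange (V : nmodType) (F : nat -> nat -> V) (N : nat) :
  \sum_(1 <= k < N.+1) \sum_(d <- divisors k) F d k =
  \sum_(1 <= d < N.+1) \sum_(1 <= b < (N %/ d).+1) F d (d * b)%N.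
Proof.
under eq_big_nat => k kN do rewrite (big_divisors _ kN).
rewrite (exchange_big_dep_nat xpredT) //=; apply: eq_big_nat => d /andP[d0 _].
by rewrite sum_multiples.
Qed.

Definition tau_sum (n : nat) : nat := (\sum_(1 <= k < n.+1) tau k)%N.

Lemma tau_sumE (n : nat) : tau_sum n = (\sum_(1 <= a < n.+1) n %/ a)%N.
Proof.
have H := @sum_divisors_exchange nat (fun _ _ => 1%N) n.
rewrite /tau_sum /tau; under eq_bigr do rewrite -sum1_size.
apply: etrans H _; apply: eq_bigr => a _.
transitivity (((n %/ a).+1 - 1) * 1)%N; first exact: sum_nat_const_nat.
by rewrite subSS subn0 muln1.
Qed.

(** Since n < (M+1)^2, the conditions a b <= n and a > M force b <= M, so the tail in a can be
    summed over b first. *)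
Lemma hyperbola_tail (V : comPzRingType) (f g : nat -> V) (n M : nat) :
  (M ^ 2 <= n < M.+1 ^ 2)%N ->
  \sum_(M.+1 <= a < n.+1) f a * \sum_(1 <= b < (n %/ a).+1) g b =
  \sum_(1 <= b < M.+1) g b * \sum_(M.+1 <= a < (n %/ b).+1) f a.
Proof.
move=> /andP[Mn nM].
transitivity (\sum_(M.+1 <= a < n.+1) \sum_(1 <= b < M.+1 | (a * b <= n)%N) g b * f a).
  apply: eq_big_nat => a /andP[Ma an]; rewrite mulrC mulr_suml.
  have a0 : (0 < a)%N by exact: leq_trans Ma.
  have naM : (n %/ a <= M)%N.
    rewrite -ltnS ltn_divLR//; apply: leq_trans nM _.
    by rewrite -mulnn leq_mul2l Ma orbT.
  rewrite (big_nat_widen _ _ M.+1)//; apply: eq_bigl => b.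
  by rewrite /= ltnS leq_divRL// mulnC.
rewrite (exchange_big_dep_nat xpredT) //=; apply: eq_big_nat => b /andP[b0 bM].
rewrite mulr_sumr [RHS](big_nat_widen _ _ n.+1); last by rewrite ltnS leq_div.
by apply: eq_bigl => a; rewrite /= ltnS leq_divRL.
Qed.

Lemma tau_sum_hyperbola (V : comPzRingType) (n M : nat) : (M ^ 2 <= n < M.+1 ^ 2)%N ->
  (tau_sum n)%:R = 2%:R * (\sum_(1 <= a < M.+1) (n %/ a)%:R) - M%:R ^+ 2 :> V.
Proof.
move=> MnM; have /andP[Mn nM] := MnM.
have Mn' : (M <= n)%N by move: Mn; rewrite -mulnn; nia.
have cst1 m k : \sum_(m <= b < k) 1 = (k - m)%:R :> V by rewrite sumr_const_nat.
rewrite tau_sumE natr_sum (@big_cat_nat _ _ _ M.+1)//=.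
have -> : \sum_(M.+1 <= a < n.+1) (n %/ a)%:R =
    \sum_(M.+1 <= a < n.+1) 1 * \sum_(1 <= b < (n %/ a).+1) 1 :> V.
  by apply: eq_bigr => a _; rewrite mul1r cst1 subSS subn0.
rewrite (hyperbola_tail _ _ MnM).
have -> : \sum_(1 <= b < M.+1) 1 * (\sum_(M.+1 <= a < (n %/ b).+1) 1) =
   \sum_(1 <= b < M.+1) ((n %/ b)%:R - M%:R) :> V.
  apply: eq_big_nat => b /andP[b0 bM]; rewrite mul1r cst1 subSS natrB//.
  by rewrite leq_divRL// (leq_trans _ Mn)// -mulnn leq_mul2l -ltnS bM orbT.
by rewrite sumrB sumr_const_nat subSS subn0 -mulr_natr; ring.
Qed.

Lemma mobius_mul_prime (p d : nat) : prime p -> (0 < d)%N ->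
  mobius (p * d) = if (p %| d)%N then 0 else - mobius d.
Proof.
move=> pp d0; have p0 := prime_gt0 pp.
rewrite /mobius; case: (boolP (p %| d)%N) => pd.
  case: ifP => // /allP hall; have : p \in primes (p * d).
    by rewrite mem_primes pp muln_gt0 p0 d0 dvdn_mulr.
  move=> /hall.
  rewrite lognM// logn_prime// eqxx add1n eqSS => /eqP l0.
  by have := pd; rewrite -[p in (p %| _)%N]expn1 pfactor_dvdn// l0.
have perm : perm_eq (primes (p * d)) (p :: primes d).
  apply: uniq_perm; rewrite ?primes_uniq//=.
    by rewrite mem_primes (negbTE pd) !andbF primes_uniq.
  move=> q; rewrite inE primesM// [primes p]primes_prime// inE//.
rewrite (perm_all _ perm) (perm_size perm) /= lognM// logn_prime// eqxx.
have -> : logn p d = 0%N by apply/eqP; rewrite -leqn0 leqNgt logn_gt0 mem_primes (negbTE pd) !andbF.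
have -> : all (fun q => logn q (p * d) == 1%N) (primes d) = all (fun q => logn q d == 1%N) (primes d).
  apply: eq_in_all => q qd; rewrite lognM// logn_prime//.
  have -> : (q == p) = false by apply/eqP => qp; move: qd; rewrite qp mem_primes (negbTE pd) !andbF.
  by [].
by rewrite addn0 eqxx /=; case: ifP => _; rewrite ?oppr0// exprS mulN1r.
Qed.

Lemma mobius_norm_le1 (d : nat) : `|mobius d| <= 1.
Proof. by rewrite /mobius; case: ifP => _; rewrite ?normr0// normrX normrN1 expr1n. Qed.

(** For a prime p dividing n, the divisors p b with p not dividing b cancel against b, and mu
    vanishes on the other multiples of p. *)
Lemma sum_mobius (n : nat) : (0 < n)%N ->
  \sum_(d <- divisors n) mobius d = (n == 1%N)%:R.
Proof.
move=> n0; have [->|n1] := eqVneq n 1%N; first by rewrite big_seq1.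
have pp : prime (pdiv n) by apply: pdiv_prime; rewrite ltn_neqAle eq_sym n1.
have pn := pdiv_dvd n; move: (pdiv n) pp pn => p pp pn.
have p0 := prime_gt0 pp.
rewrite (@big_divisors _ _ n n) ?n0 ?leqnn// (bigID (fun d => (p %| d)%N))/=.
under eq_bigl do rewrite andbC.
rewrite big_mkcondr/= sum_multiples//.
have -> : \sum_(1 <= b < (n %/ p).+1) (if (p * b %| n)%N then mobius (p * b) else 0) =
    - \sum_(1 <= b < (n %/ p).+1 | (b %| n)%N && ~~ (p %| b)%N) mobius b.
  rewrite -sumrN [RHS]big_mkcond/=; apply: eq_big_nat => b /andP[b0 _].
  rewrite mobius_mul_prime//; case pb : (p %| b)%N => /=; first by rewrite andbF; case: ifP.
  rewrite andbT Gauss_dvd ?pn//; by rewrite prime_coprime// pb.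
apply/eqP; rewrite addrC subr_eq0; apply/eqP.
rewrite [RHS](big_nat_widen _ _ n.+1); last by rewrite ltnS leq_div.
apply: eq_bigl => b; case bn : (b %| n)%N => //=; case pb : (p %| b)%N => //=.
rewrite ltnS leq_divRL// dvdn_leq// mulnC Gauss_dvd ?pn//.
by rewrite prime_coprime// pb.
Qed.

Lemma sum_mobius_real (R : realType) (n : nat) : (0 < n)%N ->
  \sum_(d <- divisors n) (mobius d)%:~R = (n == 1%N)%:R :> R.
Proof. by move=> n0; rewrite -rmorph_sum/= sum_mobius//; case: eqP. Qed.

Lemma dvdn_div_swap (e d n : nat) : (0 < n)%N -> (0 < e)%N -> (0 < d)%N ->
  (e %| n)%N && (d %| n %/ e)%N = (d %| n)%N && (e %| n %/ d)%N.
Proof.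
move=> n0 e0 d0.
have H a b : (0 < a)%N -> (a %| n)%N && (b %| n %/ a)%N = (a * b %| n)%N.
  move=> a0; apply/andP/idP => [[an bn]|abn].
    by rewrite -(divnK an) mulnC dvdn_mul.
  have an : (a %| n)%N by apply: dvdn_trans abn; exact: dvdn_mulr.
  by split=> //; rewrite dvdn_divRL// mulnC.
by rewrite !H// mulnC.
Qed.

Lemma dvdn_div (d n : nat) : (d %| n)%N -> (n %/ d %| n)%N.
Proof. by move=> dn; rewrite -{2}(divnK dn) dvdn_mulr. Qed.

Lemma mobius_inversion (R : realType) (g h : nat -> R) (n : nat) : (0 < n)%N ->
  (forall m, (0 < m)%N -> g m = \sum_(d <- divisors m) h d) ->
  \sum_(e <- divisors n) (mobius e)%:~R * g (n %/ e)%N = h n.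
Proof.
move=> n0 gh; rewrite (@big_divisors _ _ n n) ?n0 ?leqnn//.
have step : \sum_(1 <= e < n.+1 | (e %| n)%N) (mobius e)%:~R * g (n %/ e)%N =
    \sum_(1 <= e < n.+1 | (e %| n)%N) \sum_(1 <= d < n.+1 | (d %| n %/ e)%N) (mobius e)%:~R * h d.
  rewrite big_nat_cond [RHS]big_nat_cond; apply: eq_bigr => e /andP[/andP[e0 _] en].
  have ne0 : (0 < n %/ e)%N by rewrite divn_gt0// dvdn_leq.
  by rewrite gh// (@big_divisors _ _ _ n) ?ne0 ?leq_div// mulr_sumr.
rewrite step (exchange_big_dep_nat (fun d => (d %| n)%N))/=; last first.
  by move=> e d _ _ en dne; apply: dvdn_trans dne _; exact: dvdn_div.
transitivity (\sum_(1 <= d < n.+1 | (d %| n)%N) h d * \sum_(e <- divisors (n %/ d)) (mobius e)%:~R).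
  rewrite big_nat_cond [RHS]big_nat_cond; apply: eq_bigr => d /andP[/andP[d0 _] dn].
  have nd0 : (0 < n %/ d)%N by rewrite divn_gt0// dvdn_leq.
  rewrite (@big_divisors _ _ _ n) ?nd0 ?leq_div// mulr_sumr.
  rewrite big_nat_cond [RHS]big_nat_cond; apply: eq_big => [e|e _]; last by rewrite mulrC.
  case e0 : (0 < e)%N => //=; congr (_ && _).
  by rewrite dvdn_div_swap// dn.
rewrite big_mkcond big_nat_recr//= dvdnn divnn n0 sum_mobius_real// eqxx mulr1.
rewrite big_nat_cond big1 ?add0r// => d; rewrite andbT => /andP[d0 dn].
case: ifP => // dvn.
have nd0 : (0 < n %/ d)%N by rewrite divn_gt0// dvdn_leq.
rewrite (sum_mobius_real R nd0).
case: eqP => [nd1|_]; last by rewrite mulr0.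
by move: dn; rewrite -(divnK dvn) nd1 mul1n ltnn.
Qed.

Lemma sum_totient_divisors (n : nat) : (0 < n)%N ->
  (\sum_(d <- divisors n) totient d = n)%N.
Proof.
move=> n0; rewrite (@big_divisors nat totient n n) ?n0 ?leqnn//.
rewrite -[RHS]sum_totient_dvd -(big_mkord (fun d => (d %| n)%N) totient).
by rewrite [RHS]big_mkcond [RHS]big_ltn//= dvd0n (gtn_eqF n0) add0n -big_mkcond.
Qed.

Lemma totient_mobius (R : realType) (n : nat) : (0 < n)%N ->
  (totient n)%:R = \sum_(e <- divisors n) (mobius e)%:~R * (n %/ e)%:R :> R.
Proof.
move=> n0; rewrite (@mobius_inversion R (fun n => n%:R) (fun n => (totient n)%:R))//.
by move=> m m0; rewrite -natr_sum sum_totient_divisors.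
Qed.

Lemma leq_truncn_sqrt (R : realType) (u : R) (a : nat) : 0 <= u ->
  (a <= Num.truncn (Num.sqrt u))%N = (a%:R ^+ 2 <= u).
Proof.
move=> u0; rewrite truncn_ge_nat ?sqrtr_ge0//.
by rewrite -{2}(sqr_sqrtr u0) ler_pXn2r// ?nnegrE// sqrtr_ge0.
Qed.

Lemma truncn_sqrt_bounds (R : realType) (u : R) : 0 <= u ->
  (Num.truncn (Num.sqrt u) ^ 2 <= Num.truncn u < (Num.truncn (Num.sqrt u)).+1 ^ 2)%N.
Proof.
move=> u0; apply/andP; split.
  by rewrite truncn_ge_nat// natrX -leq_truncn_sqrt.
rewrite truncn_lt_nat// natrX ltNge -leq_truncn_sqrt//.
by rewrite ltnn.
Qed.

Lemma growth_comp_truncn_sqrt (R : realType) (e : R) (f : nat -> R) :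
  growth (natsize R) e f ->
  growth id (e / 2) (fun x => f (Num.truncn (Num.sqrt x))).
Proof.
move=> Hf; have h2 : 0 < 2^-1 :> R by rewrite invr_gt0.
have := growth_comp_truncn_powR h2 Hf; rewrite mulrC => H.
apply: growth_ext H _ => x x1.
by rewrite powR12_sqrt// (le_trans ler01).
Qed.

(** * The error term in the Dirichlet divisor problem *)

Definition divisor_delta (R : realType) (u : R) : R :=
  (tau_sum (Num.truncn u))%:R - u * (ln u + (2 * stieltjes R 0 - 1)).

Lemma ln1D_quad (R : realType) (t : R) : 0 <= t -> `|t - ln (1 + t)| <= t ^+ 2.
Proof.
move=> t0; have h1 : ln (1 + t) <= t by apply: le_ln1Dx; lra.
have t10 : 0 < 1 + t by lra.
have h2 : - (t / (1 + t)) >= ln (1 + - (t / (1 + t))).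
  by apply: le_ln1Dx; rewrite ltrN2 ltr_pdivrMr//; lra.
have e : 1 + - (t / (1 + t)) = (1 + t)^-1 by field; rewrite gt_eqF.
move: h2; rewrite e lnV ?posrE// lerN2 => h2.
rewrite ger0_norm ?subr_ge0// lerBlDr -lerBlDl; apply: le_trans h2.
rewrite ler_pdivlMr// -subr_ge0.
have -> : t - (t - t ^+ 2) * (1 + t) = t ^+ 3 by ring.
by rewrite exprn_ge0.
Qed.

(** Dirichlet's hyperbola method: Delta(u) = -2 sum_{a <= sqrt u} psi(u/a) + O(u^eps). *)
Lemma divisor_delta_sawtooth (R : realType) :
  growth id 0 (fun u : R => divisor_delta u +
    2 * \sum_(1 <= a < (Num.truncn (Num.sqrt u)).+1) sawtooth (u / a%:R)).
Proof.
have := growthM (growthZ 2 (growth_size (@id R))) (growth_comp_truncn_sqrt (@harmonic_asymp R)).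
have -> : 1 + -2 / 2 = 0 :> R by field.
move=> HE.
(* What remains after inserting the harmonic expansion. With sqrt u = M + th and 0 <= th <= 1, the
   terms of order u and sqrt u cancel; a bounded polynomial in th and 1/M is left, plus the
   quadratic error of the logarithm. *)
have HB : growth id 0 (fun u : R => u * (2 * ln (Num.truncn (Num.sqrt u))%:R - ln u)
    + u / (Num.truncn (Num.sqrt u))%:R - (Num.truncn (Num.sqrt u))%:R
    - (Num.truncn (Num.sqrt u))%:R ^+ 2 + u).
  apply: (@growth_bound _ _ _ _ 20) => u u1; rewrite powRr0 mulr1.
  have u0 : 0 <= u by exact: le_trans u1.
  set s := Num.sqrt u.
  have s1 : 1 <= s by rewrite /s -sqrtr1 ler_sqrt.
  have s0 : 0 < s by exact: lt_le_trans s1.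
  have uE : u = s ^+ 2 by rewrite /s sqr_sqrtr.
  have M1 : 1 <= (Num.truncn s)%:R :> R by rewrite ler1n truncn_gt0.
  have /andP[h1 h2] := truncn_itv (ltW s0).
  move: h2; rewrite -natr1; set M := (Num.truncn s)%:R => h2.
  have M0 : 0 < M by exact: lt_le_trans M1.
  pose th := s - M; pose i := M^-1.
  have th0 : 0 <= th by rewrite /th; lra.
  have th1 : th <= 1 by rewrite /th; lra.
  have i0 : 0 < i by rewrite invr_gt0.
  have i1 : i <= 1 by rewrite invf_le1.
  have iM : i * M = 1 by rewrite mulVf// gt_eqF.
  have sE : s = M + th by rewrite /th; lra.
  have lE : 2 * ln M - ln u = - (2 * ln (1 + th * i)).
    have -> : 1 + th * i = s / M by rewrite sE /i; field; rewrite gt_eqF.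
    by rewrite ln_div ?posrE// uE lnXn//; ring.
  rewrite lE.
  have ti0 : 0 <= th * i by rewrite mulr_ge0// ltW.
  have := ln1D_quad ti0; set l := ln _ => hl.
  have -> : u * - (2 * l) + u / M - M - M ^+ 2 + u =
      2 * (u * (th * i - l)) + (u * (i - 2 * (th * i) + 1) - M - M ^+ 2).
    by rewrite -/i; ring.
  apply: le_trans (ler_normD _ _) _.
  have ui : u * i ^+ 2 = (1 + th * i) ^+ 2.
    by rewrite uE sE -exprMn mulrDl [M * i]mulrC iM.
  have ti1 : th * i <= 1 by rewrite -[1]mulr1; apply: ler_pM => //; exact: ltW.
  have p1 : `|2 * (u * (th * i - l))| <= 8.
    rewrite !normrM (ger0_norm u0) ger0_norm//.
    apply: (@le_trans _ _ (2 * (u * (th * i) ^+ 2))).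
      by rewrite ler_pM2l//; apply: ler_wpM2l.
    have -> : u * (th * i) ^+ 2 = th ^+ 2 * (1 + th * i) ^+ 2 by rewrite -ui; ring.
    have : th ^+ 2 * (1 + th * i) ^+ 2 <= 1 * 2 ^+ 2.
      apply: ler_pM.
      - exact: exprn_ge0.
      - by rewrite exprn_ge0// addr_ge0.
      - exact: exprn_ile1.
      - by apply: lerXn2r; rewrite ?nnegrE ?addr_ge0//; lra.
    lra.
  have p2 : u * (i - 2 * (th * i) + 1) - M - M ^+ 2 =
      2 * th - 3 * th ^+ 2 + th ^+ 2 * i - 2 * th ^+ 3 * i.
    have E1 : u * i = M + 2 * th + th ^+ 2 * i.
      by rewrite uE sE; transitivity (M * (i * M) + 2 * th * (i * M) + th ^+ 2 * i); [ring | rewrite iM; ring].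
    have -> : u * (i - 2 * (th * i) + 1) = u * i - 2 * th * (u * i) + u by ring.
    by rewrite E1 uE sE; ring.
  have p3 : `|2 * th - 3 * th ^+ 2 + th ^+ 2 * i - 2 * th ^+ 3 * i| <= 8.
    have a1 : 0 <= th ^+ 2 <= 1 by rewrite exprn_ge0// exprn_ile1.
    have a2 : 0 <= th ^+ 2 * i <= 1.
      have /andP[b1 b2] := a1; rewrite mulr_ge0 ?(ltW i0)//=.
      by rewrite -[leRHS]mulr1; apply: ler_pM => //; exact: ltW.
    have a3 : 0 <= th ^+ 3 * i <= 1.
      rewrite mulr_ge0 ?exprn_ge0 ?(ltW i0)//=.
      by rewrite -[leRHS]mulr1; apply: ler_pM => //; rewrite ?exprn_ge0 ?exprn_ile1// ltW.
    move: a1 a2 a3 => /andP[? ?] /andP[? ?] /andP[? ?].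
    by rewrite ler_norml; apply/andP; split; lra.
  rewrite p2; lra.
apply: growth_ext (growthD HE HB) _ => u u1 /=.
have u0 : 0 <= u by exact: le_trans u1.
rewrite /divisor_delta (@tau_sum_hyperbola R _ _ (truncn_sqrt_bounds u0)).
set M := Num.truncn (Num.sqrt u).
have M0 : M%:R != 0 :> R.
  rewrite gt_eqF// ltr0n /M truncn_gt0.
  by rewrite -sqrtr1 ler_sqrt.
have -> : \sum_(1 <= a < M.+1) (Num.truncn u %/ a)%:R =
    u * (\sum_(1 <= a < M.+1) a%:R^-1) - \sum_(1 <= a < M.+1) sawtooth (u / a%:R)
      - 2^-1 * M%:R :> R.
  have -> : 2^-1 * M%:R = \sum_(1 <= a < M.+1) 2^-1 :> R.
    by rewrite sumr_const_nat subSS subn0 -[RHS]mulr_natr.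
  rewrite mulr_sumr -!sumrB; apply: eq_big_nat => a /andP[a0 _].
  by rewrite /sawtooth truncn_divn//; ring.
set S1 := \sum_(_ <= _ < _) _; set S2 := \sum_(_ <= _ < _) _.
by field.
Qed.

Lemma sum_sawtooth_le (R : realType) (u : R) (N : nat) : 0 <= u ->
  `|\sum_(1 <= a < N.+1) sawtooth (u / a%:R)| <= N%:R.
Proof.
move=> u0; apply: le_trans (ler_norm_sum _ _ _) _.
apply: (@le_trans _ _ (\sum_(1 <= a < N.+1) 1)).
  apply: ler_sum => a _; apply: le_trans (sawtooth_le_half _) _; last by lra.
  by rewrite divr_ge0.
by rewrite sumr_const_nat subSS subn0.
Qed.

Lemma growth_divisor_delta (R : realType) : growth id (2^-1) (@divisor_delta R).
Proof.
have h2 : 0 <= 2^-1 :> R by rewrite invr_ge0.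
have H1 := growth_expW h2 (@divisor_delta_sawtooth R).
have H2 : growth id (2^-1) (fun u : R =>
    2 * \sum_(1 <= a < (Num.truncn (Num.sqrt u)).+1) sawtooth (u / a%:R)).
  apply: growthZ; apply: (@growth_bound _ _ _ _ 1) => u u1.
  have u0 : 0 <= u by exact: le_trans u1.
  rewrite mul1r powR12_sqrt//; apply: le_trans (sum_sawtooth_le _ u0) _.
  by rewrite truncn_le sqrtr_ge0.
by apply: growth_ext (growthB H1 H2) _ => u _; rewrite addrK.
Qed.

(** Each full period of k mod a contributes only -1/2; the incomplete one is bounded trivially. *)
Lemma sum_sawtooth_arith_le (R : realType) (a n : nat) : (0 < a)%N ->
  `|\sum_(0 <= k < n) sawtooth (k%:R / a%:R : R)| <= a%:R + n%:R / a%:R.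
Proof.
move=> a0; have a0R : 0 < a%:R :> R by rewrite ltr0n.
have triv m : `|\sum_(0 <= k < m) sawtooth (k%:R / a%:R : R)| <= 2^-1 * m%:R.
  apply: le_trans (ler_norm_sum _ _ _) _.
  apply: (@le_trans _ _ (\sum_(0 <= k < m) 2^-1)).
    by apply: ler_sum => k _; apply: sawtooth_le_half; rewrite divr_ge0.
  by rewrite sumr_const_nat subn0 mulr_natr.
elim/ltn_ind: n => n IH; have [na|an] := leqP n a.
  apply: le_trans (triv n) _.
  have : n%:R <= a%:R :> R by rewrite ler_nat.
  have : 0 <= n%:R / a%:R :> R by rewrite divr_ge0.
  have : 0 <= n%:R :> R by [].
  lra.
rewrite (@big_cat_nat _ _ _ a)//=; last exact: ltnW.
have per : \sum_(0 <= k < a) sawtooth (k%:R / a%:R : R) = - 2^-1.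
  have := @sawtooth_sum_mul R a 0 a0 (lexx 0).
  rewrite big_mkord; under eq_bigr do rewrite add0r.
  by move=> ->; rewrite mulr0 /sawtooth truncn0 subr0 sub0r.
rewrite per -{1}[a]add0n big_addn.
have -> : \sum_(0 <= i < n - a) sawtooth ((i + a)%:R / a%:R : R) =
    \sum_(0 <= i < n - a) sawtooth (i%:R / a%:R : R).
  apply: eq_bigr => i _; rewrite natrD mulrDl divff ?gt_eqF//.
  by rewrite (@sawtoothDn R _ 1)// divr_ge0.
apply: le_trans (ler_normD _ _) _.
have := IH (n - a)%N; rewrite ltn_subrL a0 (leq_trans a0 (ltnW an)) => /(_ isT).
rewrite natrB ?(ltnW an)// mulrBl divff ?gt_eqF// => h.
have -> : `|- 2^-1| = 2^-1 :> R by rewrite normrN ger0_norm.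
have : 0 <= a%:R :> R by [].
move: h; move: (n%:R / a%:R) => z h a0R'; lra.
Qed.

(** Saves N^(1/2) over the termwise bound. It is needed in [delta_weighted_sum_asymp], where the
    termwise bound would leave an error y^(7/4) in the end. At integers, exchanging summations
    leaves sums of psi(k/a) over k, which are O(a + N/a). *)
Lemma growth_sum_divisor_delta (R : realType) :
  growth (natsize R) 1 (fun N => \sum_(1 <= k < N.+1) divisor_delta (k%:R : R)).
Proof.
pose E (u : R) := divisor_delta u +
  2 * \sum_(1 <= a < (Num.truncn (Num.sqrt u)).+1) sawtooth (u / a%:R).
have HE : growth (natsize R) 0 (fun k => E k%:R).
  move=> d d0; have [C C0 HC] := @divisor_delta_sawtooth R d d0.
  by exists C => // k k1; exact: HC.
have := growth_sum (ltac:(lra) : -1 <= 0 :> R) HE; rewrite add0r => {HE}HE.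
have {}HE := growth_sum_norm HE.
pose S N : R := \sum_(1 <= k < N.+1)
  \sum_(1 <= a < (Num.truncn (Num.sqrt (k%:R : R))).+1) sawtooth (k%:R / a%:R).
suff HS : growth (natsize R) 1 S.
  apply: growth_ext (growthB HE (growthZ 2 HS)) _ => N _.
  by rewrite /S mulr_sumr -sumrB; apply: eq_bigr => k _; rewrite /E addrK.
have H1 := @growth_sum_inv R.
have H2 := growthM (growth_size (natsize R)) H1; rewrite addr0 in H2.
have H3 := growthD (growthZ 2 H2) (growthZ 4 (growth_size (natsize R))).
apply: growth_le H3 _ => N; rewrite ler1n => N1.
(* a <= sqrt k is read as a^2 <= k, so k runs over an interval from a^2 to N. *)
have SE : S N = \sum_(1 <= a < (Num.truncn (Num.sqrt (N%:R : R))).+1)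
    \sum_(a ^ 2 <= k < N.+1) sawtooth (k%:R / a%:R).
  rewrite /S; transitivity (\sum_(1 <= k < N.+1)
    \sum_(1 <= a < (Num.truncn (Num.sqrt (N%:R : R))).+1 | (a ^ 2 <= k)%N)
      sawtooth (k%:R / a%:R : R)).
    apply: eq_big_nat => k /andP[k0 kN].
    rewrite (big_nat_widen _ _ (Num.truncn (Num.sqrt (N%:R : R))).+1).
      by apply: eq_bigl => a; rewrite /= ltnS leq_truncn_sqrt// -natrX ler_nat.
    by rewrite ltnS le_truncn// ler_sqrt// ler_nat -ltnS.
  rewrite (exchange_big_dep_nat xpredT)//=; apply: eq_big_nat => a /andP[a0 _].
  by rewrite [RHS](big_nat_widenl _ 1)// expn_gt0 a0.
rewrite SE [leRHS]ger0_norm; last first.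
  rewrite addr_ge0 ?mulr_ge0//; apply: sumr_ge0 => i _; rewrite invr_ge0//.
apply: le_trans (ler_norm_sum _ _ _) _.
have /andP[MN NM] := truncn_sqrt_bounds (ler0n R N).
move: MN NM; rewrite natrK; set M := Num.truncn _ => MN NM.
have MN' : (M <= N)%N by move: MN; rewrite -mulnn; nia.
apply: (@le_trans _ _ (\sum_(1 <= a < M.+1) (2 * N%:R * a%:R^-1 + 4 * a%:R))).
  apply: ler_sum_nat => a /andP[a0 aM].
  have aN : (a ^ 2 <= N)%N by apply: leq_trans MN; rewrite leq_exp2r// -ltnS.
  have a0R : 0 < a%:R :> R by rewrite ltr0n.
  have a1R : 1 <= a%:R :> R by rewrite ler1n.
  have h1 := sum_sawtooth_arith_le R N.+1 a0.
  have h2 := sum_sawtooth_arith_le R (a ^ 2) a0.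
  move: h2; rewrite (_ : (a ^ 2)%:R / a%:R = a%:R :> R) => [h2|]; last first.
    by rewrite natrX; field; rewrite gt_eqF.
  move: h1; rewrite (@big_cat_nat _ _ _ (a ^ 2) 0 N.+1)//=; last by rewrite leqW.
  rewrite -natr1 mulrDl div1r => h1.
  have ai : a%:R^-1 <= 1 :> R by rewrite invf_le1.
  have Na0 : 0 <= N%:R * a%:R^-1 :> R by rewrite divr_ge0.
  move: h1 h2; rewrite !ler_norml -mulrA.
  move: (\sum_(0 <= k < a ^ 2) _) (\sum_(a ^ 2 <= k < N.+1) _) => s1 s2.
  move: (a%:R^-1) (N%:R * a%:R^-1) ai Na0 => w z ai Na0.
  by move=> /andP[? ?] /andP[? ?]; apply/andP; split; lra.
rewrite big_split/= -mulr_sumr; apply: lerD.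
  rewrite mulrA; apply: ler_wpM2l; first by rewrite mulr_ge0.
  rewrite [leRHS](@big_cat_nat _ _ _ M.+1)//= lerDl.
  by apply: sumr_ge0 => i _; rewrite invr_ge0.
rewrite -mulr_sumr ler_pM2l//.
apply: (@le_trans _ _ (\sum_(1 <= a < M.+1) M%:R)).
  by apply: ler_sum_nat => a /andP[_ aM]; rewrite ler_nat -ltnS.
by rewrite sumr_const_nat subSS subn0 -[leLHS]mulr_natr -natrM ler_nat mulnn.
Qed.

Lemma abel_sum (V : comPzRingType) (u v : nat -> V) (N : nat) :
  \sum_(1 <= k < N.+1) u k * v k =
  (\sum_(1 <= k < N.+1) u k) * v N +
  \sum_(1 <= k < N) (\sum_(1 <= i < k.+1) u i) * (v k - v k.+1).
Proof.
elim: N => [|N IH]; first by rewrite !big_geq// mul0r addr0.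
rewrite big_nat_recr//= IH; case: N IH => [|N] _.
  by rewrite !big_nat1 !big_geq// mul0r addr0 add0r addr0.
rewrite [in RHS]big_nat_recr//= [X in _ = _ + X]big_nat_recr//=.
set s := \sum_(1 <= i < N.+2) u i.
by ring.
Qed.

(** Partial summation against a decreasing weight: the last weight costs W and the total variation
    at most 2 W. *)
Lemma abel_bound (R : realType) (w s : nat -> R) (U : nat) (W B : R) :
  0 <= W -> 0 <= B ->
  (forall f, (0 < f <= U)%N -> `|w f| <= W) ->
  (forall f, (0 < f < U)%N -> w f.+1 <= w f) ->
  (forall V, (V <= U)%N -> `|\sum_(1 <= f < V.+1) s f| <= B) ->
  `|\sum_(1 <= f < U.+1) s f * w f| <= 3 * W * B.
Proof.
move=> W0 B0 wW wmono sB.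
case: U wW wmono sB => [|U] wW wmono sB.
  by rewrite big_geq// normr0 !mulr_ge0.
rewrite abel_sum; apply: le_trans (ler_normD _ _) _.
have -> : 3 * W * B = B * W + B * (W + W) by ring.
apply: lerD.
  by rewrite normrM; apply: ler_pM => //; [exact: sB | apply: wW; rewrite leqnn].
apply: (@le_trans _ _ (B * (w 1%N - w U.+1))); last first.
  apply: ler_wpM2l => //.
  have := wW 1%N isT; have := wW U.+1; rewrite leqnn => /(_ isT).
  by rewrite !ler_norml => /andP[? ?] /andP[? ?]; lra.
apply: le_trans (ler_norm_sum _ _ _) _.
rewrite -opprB -(telescope_sumr w (ltn0Sn U)) -sumrN mulr_sumr.
apply: ler_sum_nat => f fU; rewrite normrM opprB (ger0_norm (_ : 0 <= w f - _)).
  by apply: ler_wpM2r; rewrite ?subr_ge0 ?wmono//; apply: sB; case/andP: fU => _ /ltnW.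
by rewrite subr_ge0 wmono.
Qed.

Lemma cube_root_cube (R : realType) (x : R) : 0 <= x -> (x `^ 3^-1) ^+ 3 = x.
Proof.
move=> x0; rewrite -powR_mulrn ?powR_ge0// -powRrM mulVf ?powRr1//.
Qed.

Lemma growth_sum_cube_root (R : realType) (G : R -> R) : growth id 1 G ->
  growth id (5 / 9) (fun y : R =>
    \sum_(1 <= a < (Num.truncn (y `^ 3^-1)).+1) `|G ((y / a%:R) `^ 3^-1)|).
Proof.
(* The cap d <= 1 keeps r = (1+d)/3 below 1, so that s = 1 - r > 0. The exponent obtained is r + s/3
   = 5/9 + 2d/9. *)
move=> HG e e0; pose d := Num.min e 1.
have d0 : 0 < d by rewrite lt_min e0 ltr01.
have d1 : d <= 1 by rewrite ge_min lexx orbT.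
have de : d <= e by rewrite ge_min lexx.
have [C C0 HC] := HG d d0.
pose r := (1 + d) / 3; pose s := 1 - r.
have s0 : 0 < s by rewrite /s /r; lra.
exists (C * ((1 + s) / s)).
  by apply: mulr_ge0 => //; apply: divr_ge0; lra.
move=> y y1; rewrite ger0_norm ?sumr_ge0//.
have y0 : 0 < y by exact: lt_le_trans y1.
set A := Num.truncn _.
have Ay : A%:R <= y `^ 3^-1 by rewrite truncn_le powR_ge0.
apply: (@le_trans _ _ (\sum_(1 <= a < A.+1) C * y `^ r * a%:R `^ (s - 1))).
  apply: ler_sum_nat => a /andP[a0 aA].
  have a0R : 0 < a%:R :> R by rewrite ltr0n.
  have ay : a%:R <= y.
    apply: (@le_trans _ _ (y `^ 3^-1)).
      by apply: le_trans Ay; rewrite ler_nat -ltnS.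
    apply: ler1_powR => //; lra.
  have ya1 : 1 <= y / a%:R by rewrite ler_pdivlMr// mul1r.
  have z1 : 1 <= (y / a%:R) `^ 3^-1.
    by rewrite -[X in X <= _](powRr0 (y / a%:R)) ler_powR//; lra.
  apply: le_trans (HC _ z1) _; rewrite -mulrA; apply: ler_wpM2l => //.
  rewrite -powRrM powRM ?invr_ge0 ?(ltW y0)//.
  have -> : 3^-1 * (1 + d) = r by rewrite /r mulrC.
  apply: ler_wpM2l; first exact: powR_ge0.
  rewrite -powR_inv1// -powRrM.
  have -> : -1 * r = s - 1 by rewrite /s; lra.
  exact: lexx.
rewrite -mulr_sumr; apply: le_trans (ler_wpM2l _ (sum_powR_le A s0)) _.
  by rewrite mulr_ge0// powR_ge0.
have -> : C * y `^ r * ((1 + s) / s * A%:R `^ s) =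
   (C * ((1 + s) / s)) * (y `^ r * A%:R `^ s) by ring.
apply: ler_wpM2l.
  by apply: mulr_ge0 => //; apply: divr_ge0; lra.
apply: (@le_trans _ _ (y `^ r * y `^ (3^-1 * s))).
  apply: ler_wpM2l; first exact: powR_ge0.
  rewrite powRrM; by apply: ge0_ler_powR; rewrite ?nnegrE ?powR_ge0 ?(ltW s0).
rewrite -powRD; last by rewrite (gt_eqF y0) implybT.
apply: ler_powR => //; rewrite /s /r; lra.
Qed.

(** Multiplied by 2 y, this is the mixed term in the squares f D(y/f)^2 with D split into main term
    and Delta. *)
Definition delta_log_sum (R : realType) (y : R) : R :=
  \sum_(1 <= f < (Num.truncn (Num.sqrt y)).+1)
    (ln (y / f%:R) + (2 * stieltjes R 0 - 1)) * divisor_delta (y / f%:R).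

(** * The cross term: pairs (f, a) with a^2 f <= y *)

Section CrossTerm.
Variables (R : realType) (G : R -> R) (y c : R).
Hypothesis HG : forall (Z : R) (U : nat), 1 <= Z -> U%:R <= Z ^+ 2 ->
  `|\sum_(1 <= m < U.+1) sawtooth (Z ^+ 3 / m%:R)| <= G Z.
Hypothesis y1 : 1 <= y.

Let y0 : 0 < y. Proof. exact: lt_le_trans y1. Qed.
Let N := Num.truncn (Num.sqrt y).
Let A := Num.truncn (y `^ 3^-1).
Let w (f : nat) : R := ln (y / f%:R) + c.
Let W := ln y + `|c|.
Let B := \sum_(1 <= a < A.+1) `|G ((y / a%:R) `^ 3^-1)|.

Let W0 : 0 <= W. Proof. by rewrite addr_ge0// ln_ge0. Qed.

Let Ny : N%:R ^+ 2 <= y.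
Proof. by rewrite -leq_truncn_sqrt// ltW. Qed.

Let le_y f : (f <= N)%N -> f%:R <= y.
Proof.
move=> fN; apply: le_trans Ny; rewrite -natrX ler_nat (leq_trans fN)//.
by rewrite -mulnn; nia.
Qed.

Let w_le f : (0 < f <= N)%N -> `|w f| <= W.
Proof.
move=> /andP[f0 fN]; apply: le_trans (ler_normD _ _) _; rewrite lerD2r.
have f0R : 0 < f%:R :> R by rewrite ltr0n.
have f1R : 1 <= f%:R :> R by rewrite ler1n.
rewrite ger0_norm; last by apply: ln_ge0; rewrite ler_pdivlMr// mul1r le_y.
by rewrite ler_ln ?posrE ?divr_gt0// ler_pdivrMr// ler_peMr// ltW.
Qed.

Let w_mono f : (0 < f)%N -> w f.+1 <= w f.
Proof.
move=> f0; rewrite /w lerD2r ler_ln ?posrE ?divr_gt0 ?ltr0n//.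
by rewrite ler_pM2l// lef_pV2 ?posrE ?ltr0n// ler_nat.
Qed.

Let A_le a : (0 < a <= A)%N -> a%:R ^+ 3 <= y.
Proof.
move=> /andP[a0 aA]; rewrite -(cube_root_cube (ltW y0)).
apply: lerXn2r; rewrite ?nnegrE ?powR_ge0//.
by rewrite -truncn_ge_nat ?powR_ge0.
Qed.

Let root_ge1 (u : R) : 1 <= u -> 1 <= u `^ 3^-1.
Proof. by move=> u1; rewrite -[X in X <= _](powRr0 u) ler_powR//; lra. Qed.

Let saw_le (u : R) (U : nat) : 1 <= u -> U%:R ^+ 3 <= u ^+ 2 ->
  `|\sum_(1 <= m < U.+1) sawtooth (u / m%:R)| <= `|G (u `^ 3^-1)|.
Proof.
move=> u1 Uu; have u0 : 0 <= u by exact: le_trans u1.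
rewrite -{1}(cube_root_cube u0); apply: le_trans (ler_norm _).
apply: HG; first exact: root_ge1.
rewrite -(@ler_pXn2r _ 3)// ?nnegrE ?exprn_ge0 ?powR_ge0//.
by rewrite -exprM mulnC exprM cube_root_cube.
Qed.

(** For a <= y^(1/3) the inner sum is over f: a sawtooth hyperbola sum with parameter y/a, to which
    the logarithmic weight is attached by partial summation. *)
Let small_part :
  `|\sum_(1 <= a < A.+1) \sum_(1 <= f < N.+1 | a%:R ^+ 2 * f%:R <= y)
     sawtooth (y / a%:R / f%:R) * w f| <= 3 * W * B.
Proof.
apply: le_trans (ler_norm_sum _ _ _) _; rewrite /B mulr_sumr.
apply: ler_sum_nat => a /andP[a0 aA].
have a0R : 0 < a%:R :> R by rewrite ltr0n.
have a1R : 1 <= a%:R :> R by rewrite ler1n.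
have a3 : a%:R ^+ 3 <= y by apply: A_le; rewrite a0.
have a20 : 0 < a%:R ^+ 2 :> R by rewrite exprn_gt0.
have a1y : a%:R <= y by apply: le_trans a3; rewrite exprS ler_peMr ?exprn_ege1// ltW.
(* The two bounds U^2 <= y and U <= y/a^2 multiply to U^3 <= (y/a)^2, the length allowed by
   [saw_le]. *)
pose U := minn N (Num.truncn (y / a%:R ^+ 2)).
have -> : \sum_(1 <= f < N.+1 | a%:R ^+ 2 * f%:R <= y) sawtooth (y / a%:R / f%:R) * w f =
    \sum_(1 <= f < U.+1) sawtooth (y / a%:R / f%:R) * w f.
  rewrite [RHS](big_nat_widen _ _ N.+1) ?ltnS ?geq_minl//.
  rewrite [LHS]big_nat_cond [RHS]big_nat_cond; apply: eq_bigl => f.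
  case fH : (1 <= f < N.+1)%N => //=; move: fH => /andP[f0 fN].
  rewrite ltnS leq_min -ltnS fN /= truncn_ge_nat; last by rewrite divr_ge0// ltW.
  by rewrite ler_pdivlMr// mulrC.
apply: (@abel_bound _ w (fun f => sawtooth (y / a%:R / f%:R))) => //.
- move=> f /andP[f0 fU]; apply: w_le; rewrite f0 (leq_trans fU)//; exact: geq_minl.
- by move=> f /andP[f0 _]; exact: w_mono.
move=> V VU; apply: saw_le; first by rewrite ler_pdivlMr// mul1r.
have VN : V%:R ^+ 2 <= y.
  apply: le_trans Ny; apply: lerXn2r; rewrite ?nnegrE// ler_nat.
  by rewrite (leq_trans VU)// geq_minl.
have Va : V%:R <= y / a%:R ^+ 2.
  have : (V <= Num.truncn (y / a%:R ^+ 2))%N by rewrite (leq_trans VU)// geq_minr.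
  by rewrite truncn_ge_nat// divr_ge0// ltW.
have -> : (y / a%:R) ^+ 2 = y * (y / a%:R ^+ 2) by field; rewrite gt_eqF.
by rewrite exprSr; apply: ler_pM => //; rewrite exprn_ge0.
Qed.

(** For a > y^(1/3) the roles are exchanged: f is fixed and the sum is over a, written as the
    difference of two full sums, whence the factor 2. *)
Let large_part :
  `|\sum_(1 <= f < N.+1) w f *
      \sum_(A.+1 <= a < (Num.truncn (Num.sqrt (y / f%:R))).+1) sawtooth (y / f%:R / a%:R)|
    <= 2 * W * B.
Proof.
have yA : y < (A%:R + 1) ^+ 3.
  have : y `^ 3^-1 < A%:R + 1 by rewrite natr1 truncnS_gt.
  move=> h; rewrite -{1}(cube_root_cube (ltW y0)).
  by rewrite ltr_pXn2r ?nnegrE ?powR_ge0// addr_ge0.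
pose g (f : nat) : R := 2 * W * `|G ((y / f%:R) `^ 3^-1)|.
have key f : (0 < f <= N)%N ->
    `|w f * \sum_(A.+1 <= a < (Num.truncn (Num.sqrt (y / f%:R))).+1)
      sawtooth (y / f%:R / a%:R)| <= if (f <= A)%N then g f else 0.
  move=> /andP[f0 fN]; have f0R : 0 < f%:R :> R by rewrite ltr0n.
  have fy := le_y fN.
  have u1 : 1 <= y / f%:R by rewrite ler_pdivlMr// mul1r.
  have u0 : 0 <= y / f%:R by exact: le_trans u1.
  set M := Num.truncn (Num.sqrt (y / f%:R)).
  (* For naturals V^3 <= V^4, and V^2 <= y/f. *)
  have M3 V : (V <= M)%N -> V%:R ^+ 3 <= (y / f%:R) ^+ 2.
    rewrite /M leq_truncn_sqrt// => V2.
    apply: (@le_trans _ _ ((V%:R ^+ 2) ^+ 2)).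
      rewrite -exprM -!natrX ler_nat.
      by case: (V) => // V'; rewrite leq_pexp2l.
    by apply: lerXn2r; rewrite ?nnegrE ?exprn_ge0.
  have [MA|AM] := leqP M.+1 A.+1.
    by rewrite big_geq// mulr0 normr0; case: ifP => // _; rewrite !mulr_ge0.
  (* A nonempty range has (A+1)^2 f <= y < (A+1)^3, hence f < A + 1. *)
  have -> : (f <= A)%N.
    rewrite leqNgt; apply/negP => Af.
    have : (A.+1)%:R ^+ 2 <= y / f%:R by rewrite -leq_truncn_sqrt.
    rewrite ler_pdivlMr//; apply/negP; rewrite -ltNge; apply: lt_le_trans yA _.
    rewrite -natr1 exprSr; apply: ler_wpM2l; first by rewrite exprn_ge0 ?addr_ge0.
    by rewrite natr1 ler_nat.
  rewrite normrM /g -mulrA mulrCA; apply: ler_pM => //.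
    by apply: w_le; rewrite f0.
  have -> : \sum_(A.+1 <= a < M.+1) sawtooth (y / f%:R / a%:R) =
     \sum_(1 <= a < M.+1) sawtooth (y / f%:R / a%:R) -
     \sum_(1 <= a < A.+1) sawtooth (y / f%:R / a%:R).
    rewrite [X in _ = X - _](@big_cat_nat _ _ _ A.+1)//=; last exact: ltnW.
    by rewrite addrAC subrr add0r.
  apply: le_trans (ler_normB _ _) _; rewrite mulr2n mulrDl mul1r.
  by apply: lerD; apply: saw_le => //; apply: M3 => //; rewrite -ltnS ltnW.
apply: le_trans (ler_norm_sum _ _ _) _.
apply: (@le_trans _ _ (\sum_(1 <= f < N.+1 | (f <= A)%N) g f)).
  rewrite [leRHS]big_mkcond/=; apply: ler_sum_nat => f fN; exact: key.
rewrite /B mulr_sumr -/(g _).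
rewrite [leRHS](big_nat_widen _ _ (maxn N A).+1) ?ltnS ?leq_maxr//.
rewrite [leLHS](big_nat_widen _ _ (maxn N A).+1) ?ltnS ?leq_maxl//.
rewrite [leLHS]big_mkcond [leRHS]big_mkcond/=; apply: ler_sum => f _.
rewrite !ltnS; case: (f <= A)%N => //=; case: (f <= N)%N => //.
by rewrite !mulr_ge0.
Qed.

Lemma sawtooth_double_sum_le :
  `|\sum_(1 <= f < N.+1) w f *
     \sum_(1 <= a < (Num.truncn (Num.sqrt (y / f%:R))).+1) sawtooth (y / f%:R / a%:R)|
  <= 5 * W * B.
Proof.
have -> : \sum_(1 <= f < N.+1) w f *
     \sum_(1 <= a < (Num.truncn (Num.sqrt (y / f%:R))).+1) sawtooth (y / f%:R / a%:R) =
   \sum_(1 <= a < A.+1) \sum_(1 <= f < N.+1 | a%:R ^+ 2 * f%:R <= y)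
     sawtooth (y / a%:R / f%:R) * w f +
   \sum_(1 <= f < N.+1) w f *
      \sum_(A.+1 <= a < (Num.truncn (Num.sqrt (y / f%:R))).+1) sawtooth (y / f%:R / a%:R).
  rewrite (exchange_big_dep_nat xpredT)//= -big_split/=.
  apply: eq_big_nat => f /andP[f0 fN]; have f0R : 0 < f%:R :> R by rewrite ltr0n.
  have u0 : 0 <= y / f%:R by rewrite divr_ge0// ltW.
  set M := Num.truncn (Num.sqrt (y / f%:R)).
  have -> : \sum_(1 <= a < A.+1 | a%:R ^+ 2 * f%:R <= y) sawtooth (y / a%:R / f%:R) * w f =
     w f * \sum_(1 <= a < A.+1 | (a <= M)%N) sawtooth (y / f%:R / a%:R).
    rewrite mulr_sumr; apply: eq_big => [a|a _].
      by rewrite /M leq_truncn_sqrt// ler_pdivlMr.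
    by rewrite mulrC mulrAC.
  rewrite -mulrDr; congr (_ * _).
  have [MA|AM] := leqP M A.
    rewrite [X in _ = _ + X]big_geq// addr0 [LHS](big_nat_widen _ _ A.+1)//.
  rewrite [LHS](@big_cat_nat _ _ _ A.+1)//=; last by rewrite leqW.
  congr (_ + _); rewrite [LHS]big_nat_cond [RHS]big_nat_cond; apply: eq_bigl => a.
  case aH : (1 <= a < A.+1)%N => //=; case/andP: aH => _ aA.
  by rewrite (leq_trans _ (ltnW AM)).
apply: le_trans (ler_normD _ _) _.
apply: le_trans (lerD small_part large_part) _.
by rewrite le_eqVlt; apply/orP; left; apply/eqP; ring.
Qed.

End CrossTerm.

(** Delta is replaced by its sawtooth sum; the O(u^eps) left over in each of the sqrt y terms costs
    only y^(1/2). *)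
Lemma growth_delta_log_sum (R : realType) : growth id (5 / 9) (@delta_log_sum R).
Proof.
have [G HG HGs] := sawtooth_hyperbola_sum R.
pose c := 2 * stieltjes R 0 - 1.
pose E (u : R) := divisor_delta u +
  2 * \sum_(1 <= a < (Num.truncn (Num.sqrt u)).+1) sawtooth (u / a%:R).
have HW : growth id 0 (fun y : R => ln y + `|c|).
  by apply: growthD; [exact: growth_ln | exact: growth_cst].
pose S (y : R) := \sum_(1 <= f < (Num.truncn (Num.sqrt y)).+1) (ln (y / f%:R) + c) *
     \sum_(1 <= a < (Num.truncn (Num.sqrt (y / f%:R))).+1) sawtooth (y / f%:R / a%:R).
have HS : growth id (5 / 9) S.
  have H := growthM (growthZ 5 HW) (growth_sum_cube_root HG); rewrite add0r in H.
  apply: growth_le H _ => y y1; apply: le_trans (ler_norm _).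
  by rewrite /S; apply: sawtooth_double_sum_le.
pose T (y : R) := \sum_(1 <= f < (Num.truncn (Num.sqrt y)).+1) (ln (y / f%:R) + c) * E (y / f%:R).
have HT : growth id (2^-1) T.
  move=> d d0; have d20 : 0 < d / 2 by rewrite divr_gt0.
  have [C1 C10 HC1] := HW _ d20.
  have [C2 C20 HC2] := @divisor_delta_sawtooth R _ d20.
  exists (C1 * C2); first exact: mulr_ge0.
  move=> y y1; have y0 : 0 < y by exact: lt_le_trans y1.
  apply: le_trans (ler_norm_sum _ _ _) _.
  apply: (@le_trans _ _ (\sum_(1 <= f < (Num.truncn (Num.sqrt y)).+1) (C1 * y `^ (d / 2)) * (C2 * y `^ (d / 2)))).
    apply: ler_sum_nat => f /andP[f0 fN]; rewrite normrM.
    have f0R : 0 < f%:R :> R by rewrite ltr0n.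
    have f1R : 1 <= f%:R :> R by rewrite ler1n.
    have fy : f%:R <= y.
      have : (f%:R : R) ^+ 2 <= y by rewrite -leq_truncn_sqrt// ltW.
      by apply: le_trans; rewrite -natrX ler_nat -mulnn; nia.
    have u1 : 1 <= y / f%:R by rewrite ler_pdivlMr// mul1r.
    have uy : y / f%:R <= y by rewrite ler_pdivrMr// ler_peMr// ltW.
    have u0 : 0 < y / f%:R by rewrite divr_gt0.
    apply: ler_pM => //.
      have := HC1 y y1; rewrite add0r; apply: le_trans.
      apply: le_trans (ler_normD _ _) _; apply: le_trans (ler_norm _).
      by rewrite lerD2r ger0_norm ?ln_ge0// ler_ln ?posrE.
    apply: le_trans (HC2 _ u1) _; rewrite add0r; apply: ler_wpM2l => //.
    by apply: ge0_ler_powR; rewrite ?nnegrE ?(ltW d20) ?(ltW u0) ?(ltW y0).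
  rewrite sumr_const_nat subSS subn0 -[leLHS]mulr_natr.
  have -> : C1 * y `^ (d / 2) * (C2 * y `^ (d / 2)) = C1 * C2 * y `^ d.
    rewrite mulrACA -powRD; last by rewrite (gt_eqF y0) implybT.
    by congr (_ * _ `^ _); lra.
  rewrite powRD; last by rewrite (gt_eqF y0) implybT.
  rewrite -mulrA; apply: ler_wpM2l; first exact: mulr_ge0.
  rewrite mulrC; apply: ler_wpM2r; first exact: powR_ge0.
  by rewrite powR12_sqrt ?(ltW y0)// truncn_le sqrtr_ge0.
have := growthB (growth_expW (ltac:(lra) : 2^-1 <= 5 / 9 :> R) HT) (growthZ 2 HS).
move=> H; apply: growth_ext H _ => y y1.
rewrite /T /S mulr_sumr -sumrB; apply: eq_bigr => f _.
by rewrite /E /c; ring.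
Qed.

(** * The weighted divisor sum *)

Lemma growth_natr (R : realType) (e : R) (f : R -> R) :
  growth id e f -> growth (natsize R) e (fun k => f k%:R).
Proof.
by move=> Hf d d0; have [C C0 HC] := Hf d d0; exists C => // k k1; exact: HC.
Qed.

Lemma growth_comp_sqrt (R : realType) (e : R) (f : R -> R) :
  growth id e f -> growth id (2^-1 * e) (fun x => f (Num.sqrt x)).
Proof.
have h2 : 0 < 2^-1 :> R by rewrite invr_gt0.
move=> Hf; apply: (growth_comp (c := 1)) Hf => // x x1; have x0 := le_trans ler01 x1.
rewrite powR12_sqrt//; split; rewrite ?mul1r//.
by rewrite -sqrtr1 ler_sqrt.
Qed.

Lemma growth_succ_inv (R : realType) (j : nat) :
  growth (natsize R) (- j%:R) (fun k => (k.+1%:R ^+ j)^-1).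
Proof.
apply: growth_le (growth_size_inv (natsize R) j) _ => k; rewrite ler1n => k0.
rewrite !ger0_norm ?invr_ge0 ?exprn_ge0// lef_pV2 ?posrE ?exprn_gt0 ?ltr0n//.
by apply: lerXn2r; rewrite ?nnegrE// ler_nat.
Qed.

(** Main term of D(k)/k. *)
Definition log_shift (R : realType) (k : nat) : R := ln k%:R + (2 * stieltjes R 0 - 1).

Lemma growth_log_shift (R : realType) : growth (natsize R) 0 (@log_shift R).
Proof. by apply: growthD; [exact: growth_ln | exact: growth_cst]. Qed.

(** The weight that partial summation against 1/(2 b^2) produces; it equals k^(-3) up to
    O(k^(-4)). *)
Definition sq_inv_gap (R : realType) (k : nat) : R :=
  2^-1 * ((k%:R ^+ 2)^-1 - (k.+1%:R ^+ 2)^-1).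

Lemma sq_inv_gap_approx (R : realType) :
  growth (natsize R) (-4) (fun k => sq_inv_gap R k - (k%:R ^+ 3)^-1).
Proof.
apply: (@growth_bound _ _ _ _ 3) => k; rewrite ler1n => k0.
have k0R : 0 < k%:R :> R by rewrite ltr0n.
have k1R : 1 <= k%:R :> R by rewrite ler1n.
have -> : k%:R `^ (-4) = (k%:R ^+ 4)^-1 :> R by rewrite -[4]/(4%:R) powR_invn.
rewrite /sq_inv_gap -[k.+1%:R]natr1.
have -> : 2^-1 * ((k%:R ^+ 2)^-1 - ((k%:R + 1) ^+ 2)^-1) - (k%:R ^+ 3)^-1 =
   - ((3 * k%:R + 2) / (2 * k%:R ^+ 3 * (k%:R + 1) ^+ 2)) :> R.
  by field; rewrite (gt_eqF k0R) gt_eqF// addr_gt0.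
rewrite normrN ger0_norm; last first.
  by rewrite divr_ge0 ?mulr_ge0 ?exprn_ge0 ?addr_ge0 ?mulr_ge0.
rewrite ler_pdivrMr; last by rewrite !mulr_gt0 ?exprn_gt0 ?addr_gt0.
rewrite mulrAC ler_pdivlMr ?exprn_gt0//.
have -> : 3 * (2 * k%:R ^+ 3 * (k%:R + 1) ^+ 2) = k%:R ^+ 3 * (6 * (k%:R + 1) ^+ 2) :> R by ring.
have -> : (3 * k%:R + 2) * k%:R ^+ 4 = k%:R ^+ 3 * ((3 * k%:R + 2) * k%:R) :> R by ring.
apply: ler_wpM2l; first by rewrite exprn_ge0.
by nra.
Qed.

Lemma growth_sq_inv_gap (R : realType) : growth (natsize R) (-3) (@sq_inv_gap R).
Proof.
have := growthD (growth_expW (ltac:(lra) : -4 <= -3 :> R) (@sq_inv_gap_approx R))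
  (growth_size_inv (natsize R) 3).
by move=> H; apply: growth_ext H _ => k _; rewrite subrK.
Qed.

Lemma tau_sum_delta (R : realType) (u : R) :
  (tau_sum (Num.truncn u))%:R = u * (ln u + (2 * stieltjes R 0 - 1)) + divisor_delta u.
Proof. by rewrite /divisor_delta; ring. Qed.

Lemma growth_tau_sum (R : realType) : growth (natsize R) 1 (fun k => (tau_sum k)%:R).
Proof.
have h1 := growthM (growth_size (natsize R)) (@growth_log_shift R); rewrite addr0 in h1.
have h2 := growth_expW (ltac:(lra) : 2^-1 <= 1 :> R) (growth_natr (@growth_divisor_delta R)).
by apply: growth_ext (growthD h1 h2) _ => k _; rewrite -tau_sum_delta natrK.
Qed.

Lemma growth_tau_sum_sq (R : realType) :
  growth (natsize R) 2 (fun k => (tau_sum k)%:R ^+ 2).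
Proof.
have H := growthM (@growth_tau_sum R) (@growth_tau_sum R).
have e : 1 + 1 = 2 :> R by lra.
rewrite e in H.
by apply: growth_ext H _ => k _; rewrite expr2.
Qed.

Lemma sum_lt_asymp (R : realType) (u : nat -> R) : growth (natsize R) (-2) u ->
  exists l, growth (natsize R) (-1) (fun N => \sum_(1 <= k < N.+1) u k - l).
Proof.
move=> Hu; have [l [_ Hl]] := series_growth (ltac:(lra) : -2 < -1 :> R) Hu.
exists l; have e : -2 + 1 = -1 :> R by lra.
by rewrite e in Hl; apply: growth_ext (growthN Hl) _ => N _; rewrite opprB.
Qed.

(** Partial summation: the sums of Delta(k) are O(k^(1+eps)) and the weights have increments of
    exponent -3, so the series converges with error 1/N. *)
Lemma delta_weighted_sum_asymp (R : realType) :
  exists l, growth (natsize R) (-1) (fun N =>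
    \sum_(1 <= k < N.+1) divisor_delta (k%:R : R) * (2 * log_shift R k / k%:R ^+ 2) - l).
Proof.
pose v k : R := 2 * log_shift R k / k%:R ^+ 2.
pose S N : R := \sum_(1 <= k < N.+1) divisor_delta k%:R.
have HS : growth (natsize R) 1 S := @growth_sum_divisor_delta R.
have Hl := @growth_log_shift R.
have Hv : growth (natsize R) (-2) v.
  by have := growthM (growthZ 2 Hl) (growth_size_inv (natsize R) 2); rewrite add0r.
have Hdv : growth (natsize R) (-3) (fun k => v k - v k.+1).
  have h1 := growthM (growthZ 4 Hl) (@growth_sq_inv_gap R).
  have h2 : growth (natsize R) (-1) (fun k => ln_step R k.+1).
    apply: growth_le (growth_size_inv (natsize R) 1) _ => k; rewrite ler1n => k0.
    have /andP[a1 a2] := @ln_step_bounds R k.+1 k0.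
    rewrite expr1 !ger0_norm ?invr_ge0//.
    by apply: le_trans a1; rewrite invr_ge0.
  have h3 := growthM (growthZ 2 h2) (@growth_succ_inv R 2).
  have e1 : 0 + -3 = -3 :> R by lra.
  have e2 : -1 + - 2%:R = -3 :> R by lra.
  rewrite e1 in h1; rewrite e2 in h3.
  apply: growth_ext (growthB h1 h3) _ => k; rewrite ler1n => k0.
  rewrite /v /log_shift /sq_inv_gap /ln_step /=.
  move: (ln k.+1%:R) (ln k%:R) ((k%:R ^+ 2)^-1) ((k.+1%:R ^+ 2)^-1) => p q z z'.
  by field.
have H := growthM HS Hdv.
have e3 : 1 + -3 = -2 :> R by lra.
rewrite e3 in H; have [l Hsl] := sum_lt_asymp H.
exists l.
have H1 := growthM HS Hv; have e4 : 1 + -2 = -1 :> R by lra.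
rewrite e4 in H1.
have H2 := growth_expW (ltac:(lra) : -2 <= -1 :> R) H.
apply: growth_ext (growthD (growthB Hsl H2) H1) _ => N; rewrite ler1n => N0.
rewrite abel_sum -/(v N) -/(S N) big_nat_recr//=.
rewrite -/(S N) /v; ring.
Qed.

(** Expand D(k) = k l(k) + Delta(k) with l = [log_shift]. Replacing the weight by k^(-3), the square
    of the main term gives l(k)^2/k, subtracted here; the mixed term is [delta_weighted_sum_asymp];
    everything else has exponent at most -2 and converges absolutely. *)
Lemma tau_sum_sq_gap_asymp (R : realType) :
  exists l, growth (natsize R) (-1) (fun N =>
    \sum_(1 <= k < N) (tau_sum k)%:R ^+ 2 * sq_inv_gap R k
    - \sum_(1 <= k < N.+1) log_shift R k ^+ 2 / k%:R - l).
Proof.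
have Hl := @growth_log_shift R.
have Hl2 := growthX 2 Hl.
have Hd := growth_natr (@growth_divisor_delta R).
have Hg := @growth_sq_inv_gap R.
have Ha := @sq_inv_gap_approx R.
pose a k : R := (log_shift R k) ^+ 2 * (k%:R ^+ 2 * (sq_inv_gap R k - (k%:R ^+ 3)^-1))
  + 2 * log_shift R k * divisor_delta (k%:R : R) * (k%:R * (sq_inv_gap R k - (k%:R ^+ 3)^-1))
  + divisor_delta (k%:R : R) * divisor_delta (k%:R : R) * sq_inv_gap R k.
have HA : growth (natsize R) (-2) a.
  apply: growthD; first apply: growthD.
  - apply: growth_expW (growthM Hl2 (growthM (growth_size_exp (natsize R) 2) Ha)); lra.
  - apply: growth_expW (growthM (growthM (growthZ 2 Hl) Hd) (growthM (growth_size (natsize R)) Ha)); lra.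
  - apply: growth_expW (growthM (growthM Hd Hd) Hg); lra.
have [l1 H1] := sum_lt_asymp HA.
have [l2 H2] := @delta_weighted_sum_asymp R.
exists (l1 + l2).
have H3 := growthM (@growth_tau_sum_sq R) Hg.
have e : 2 + -3 = -1 :> R by lra.
rewrite e in H3.
apply: growth_ext (growthB (growthD H1 H2) H3) _ => N; rewrite ler1n => N0.
have -> : \sum_(1 <= k < N) (tau_sum k)%:R ^+ 2 * sq_inv_gap R k =
    \sum_(1 <= k < N.+1) (tau_sum k)%:R ^+ 2 * sq_inv_gap R k - (tau_sum N)%:R ^+ 2 * sq_inv_gap R N.
  by rewrite big_nat_recr//= addrK.
have -> : \sum_(1 <= k < N.+1) (tau_sum k)%:R ^+ 2 * sq_inv_gap R k =
    \sum_(1 <= k < N.+1) a k +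
    \sum_(1 <= k < N.+1) divisor_delta (k%:R : R) * (2 * log_shift R k / k%:R ^+ 2) +
    \sum_(1 <= k < N.+1) log_shift R k ^+ 2 / k%:R.
  rewrite -!big_split/=; apply: eq_big_nat => k /andP[k0 _].
  have k0R : k%:R != 0 :> R by rewrite pnatr_eq0 -lt0n.
  have := tau_sum_delta (k%:R : R); rewrite natrK -/(log_shift R k) => ->.
  by rewrite /a; move: (sq_inv_gap R k) => w; field.
by ring.
Qed.

Definition weighted_tau_sum (R : realType) (n : nat) : R :=
  \sum_(1 <= f < n.+1) f%:R * (tau_sum (n %/ f))%:R ^+ 2.

Lemma sum_nat_range (R : realType) (N m : nat) : (N <= m)%N ->
  \sum_(N.+1 <= f < m.+1) f%:R =
    2^-1 * (m%:R * (m%:R + 1)) - 2^-1 * (N%:R * (N%:R + 1)) :> R.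
Proof.
elim: m => [|m IH]; first by rewrite leqn0 => /eqP ->; rewrite big_geq// subrr.
rewrite leq_eqVlt ltnS => /predU1P[->|Nm]; first by rewrite big_geq// subrr.
by rewrite big_nat_recr ?ltnS//= IH// -[m.+1%:R]natr1; field.
Qed.

(** Hyperbola method at sqrt y. For f > N the square D(y/f)^2 is opened into its increments, the sum
    over f is a difference of triangular numbers, and partial summation brings back D(k)^2. *)
Lemma weighted_tau_sum_split (R : realType) (y : R) : 1 <= y ->
  let N := Num.truncn (Num.sqrt y) in
  exists2 r, `|r| <= y * \sum_(1 <= b < N.+1) ((tau_sum b)%:R ^+ 2 - (tau_sum b.-1)%:R ^+ 2) / b%:R
  & weighted_tau_sum R (Num.truncn y) =
    \sum_(1 <= f < N.+1) f%:R * (tau_sum (Num.truncn (y / f%:R)))%:R ^+ 2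
    + y ^+ 2 * \sum_(1 <= k < N) (tau_sum k)%:R ^+ 2 * sq_inv_gap R k
    + (tau_sum N)%:R ^+ 2 * (2^-1 * y ^+ 2 / N%:R ^+ 2 - 2^-1 * (N%:R * (N%:R + 1)))
    + r.
Proof.
move=> y1 N; have y0 : 0 < y by exact: lt_le_trans y1.
pose g b : R := (tau_sum b)%:R ^+ 2 - (tau_sum b.-1)%:R ^+ 2.
have tau_sum0 : tau_sum 0 = 0%N by rewrite /tau_sum big_geq.
have sg m : \sum_(1 <= b < m.+1) g b = (tau_sum m)%:R ^+ 2.
  rewrite big_add1/= (telescope_sumr_eq (fun b => (tau_sum b)%:R ^+ 2))//.
  by rewrite tau_sum0 expr0n subr0.
have g0 b : 0 <= g b.
  rewrite /g subr_ge0; apply: lerXn2r; [by rewrite nnegrE ler0n | by rewrite nnegrE ler0n | rewrite ler_nat].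
  by case: b => // b; rewrite /tau_sum /= [X in (_ <= X)%N]big_nat_recr//= leq_addr.
have Nn := truncn_sqrt_bounds (ltW y0); rewrite -/N in Nn.
have Ny : N%:R ^+ 2 <= y by rewrite -leq_truncn_sqrt// ltW.
have N1 : (0 < N)%N by rewrite /N truncn_gt0 -sqrtr1 ler_sqrt// ltW.
have Nn' : (N <= Num.truncn y)%N.
  by case/andP: Nn => + _; rewrite -mulnn; nia.
(* Triangular numbers; V of the integer part of u differs from u^2/2 by at most u for u >= 1, and
   this difference makes up r. *)
pose V (m : nat) : R := 2^-1 * (m%:R * (m%:R + 1)).
exists (\sum_(1 <= b < N.+1) g b * (V (Num.truncn (y / b%:R)) - 2^-1 * (y / b%:R) ^+ 2)).
  apply: le_trans (ler_norm_sum _ _ _) _; rewrite mulr_sumr.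
  apply: ler_sum_nat => b /andP[b0 bN].
  have b0R : 0 < b%:R :> R by rewrite ltr0n.
  have u1 : 1 <= y / b%:R.
    rewrite ler_pdivlMr// mul1r; apply: le_trans Ny.
    by rewrite -natrX ler_nat -mulnn; nia.
  have u0 : 0 <= y / b%:R by exact: le_trans u1.
  rewrite normrM (ger0_norm (g0 b)).
  have -> : y * (((tau_sum b)%:R ^+ 2 - (tau_sum b.-1)%:R ^+ 2) / b%:R) = g b * (y / b%:R).
    by rewrite /g; ring.
  apply: ler_wpM2l => //.
  have /andP[h1 h2] := truncn_itv u0; move: h2; rewrite -[(Num.truncn _).+1%:R]natr1 /V.
  move: (y / b%:R) u1 u0 h1 => u u1 u0; move: (Num.truncn u)%:R => t h1 h2.
  by rewrite ler_norml; apply/andP; split; nra.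
rewrite /weighted_tau_sum (@big_cat_nat _ _ _ N.+1)//=.
have -> : \sum_(N.+1 <= f < (Num.truncn y).+1) f%:R * (tau_sum (Num.truncn y %/ f))%:R ^+ 2 =
  \sum_(N.+1 <= f < (Num.truncn y).+1) f%:R * \sum_(1 <= b < (Num.truncn y %/ f).+1) g b.
  by apply: eq_bigr => f _; rewrite sg.
rewrite (hyperbola_tail (fun f => f%:R) g Nn).
have -> : \sum_(1 <= f < N.+1) f%:R * (tau_sum (Num.truncn y %/ f))%:R ^+ 2 =
    \sum_(1 <= f < N.+1) f%:R * (tau_sum (Num.truncn (y / f%:R)))%:R ^+ 2 :> R.
  by apply: eq_big_nat => f /andP[f0 _]; rewrite truncn_divn// ltW.
rewrite -!addrA; congr (_ + _).
have -> : \sum_(1 <= b < N.+1) g b * \sum_(N.+1 <= a < (Num.truncn y %/ b).+1) a%:R =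
  \sum_(1 <= b < N.+1) (g b * (2^-1 * y ^+ 2 / b%:R ^+ 2) - g b * V N +
     g b * (V (Num.truncn (y / b%:R)) - 2^-1 * (y / b%:R) ^+ 2)).
  apply: eq_big_nat => b /andP[b0 bN].
  have b0R : b%:R != 0 :> R by rewrite pnatr_eq0 -lt0n.
  rewrite sum_nat_range; last first.
    rewrite leq_divRL//; case/andP: Nn => Nn _; apply: leq_trans Nn.
    by rewrite -mulnn leq_mul2l -ltnS bN orbT.
  by rewrite -truncn_divn ?(ltW y0)// -/(V _) -/(V N); field.
rewrite big_split/= sumrB -[X in _ - X + _]mulr_suml sg abel_sum addrA; congr (_ + _).
rewrite sg.
have -> : \sum_(1 <= k < N) (\sum_(1 <= i < k.+1) g i) *
     (2^-1 * y ^+ 2 / k%:R ^+ 2 - 2^-1 * y ^+ 2 / k.+1%:R ^+ 2) =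
   y ^+ 2 * \sum_(1 <= k < N) (tau_sum k)%:R ^+ 2 * sq_inv_gap R k.
  rewrite mulr_sumr; apply: eq_bigr => k _; rewrite sg /sq_inv_gap.
  by ring.
by rewrite /V; ring.
Qed.

(** Expansion of T(y)/y^2 in L = ln y, before the Moebius convolutions bring in zeta(2). The
    constant term is left free. *)
Definition main_poly (R : realType) (p0 L : R) : R :=
  3^-1 * L ^+ 3 + (3 * stieltjes R 0 - 1) * L ^+ 2
  + (8 * stieltjes R 0 ^+ 2 - 6 * stieltjes R 0 - 2 * stieltjes R 1 + 1) * L + p0.

(** Each of the at most sqrt y terms is O(y^(1+d)), since f (y/f)^(1+d) <= y^(1+d). *)
Lemma growth_sum_delta_sq (R : realType) :
  growth id (3 / 2) (fun y : R => \sum_(1 <= f < (Num.truncn (Num.sqrt y)).+1)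
    f%:R * divisor_delta (y / f%:R) ^+ 2).
Proof.
move=> d d0; have d20 : 0 < d / 2 by rewrite divr_gt0.
have [C C0 HC] := @growth_divisor_delta R _ d20.
exists (C ^+ 2); first exact: exprn_ge0.
move=> y y1; have y0 : 0 < y by exact: lt_le_trans y1.
apply: le_trans (ler_norm_sum _ _ _) _.
set N := Num.truncn _.
apply: (@le_trans _ _ (\sum_(1 <= f < N.+1) C ^+ 2 * y `^ (1 + d))).
  apply: ler_sum_nat => f /andP[f0 fN].
  have f0R : 0 < f%:R :> R by rewrite ltr0n.
  have f1R : 1 <= f%:R :> R by rewrite ler1n.
  have fy : f%:R <= y.
    have : (f%:R : R) ^+ 2 <= y by rewrite -leq_truncn_sqrt// ltW.
    by apply: le_trans; rewrite -natrX ler_nat -mulnn; nia.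
  have u1 : 1 <= y / f%:R by rewrite ler_pdivlMr// mul1r.
  have u0 : 0 < y / f%:R by rewrite divr_gt0.
  have := HC _ u1; set D := divisor_delta _; set u := y / f%:R => hD.
  have hD2 : `|D| ^+ 2 <= (C * u `^ (2^-1 + d / 2)) ^+ 2.
    by apply: lerXn2r; rewrite ?nnegrE ?mulr_ge0 ?powR_ge0.
  rewrite normrM normrX ger0_norm//.
  apply: (@le_trans _ _ (f%:R * (C * u `^ (2^-1 + d / 2)) ^+ 2)).
    by rewrite ler_pM2l.
  have -> : (C * u `^ (2^-1 + d / 2)) ^+ 2 = C ^+ 2 * u `^ (1 + d).
    rewrite exprMn -[X in _ * X = _]powR_mulrn ?powR_ge0// -powRrM.
    by congr (_ * _ `^ _); field.
  rewrite mulrCA; apply: ler_wpM2l; first exact: exprn_ge0.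
  rewrite powRM ?invr_ge0 ?(ltW y0)// mulrCA -[leRHS]mulr1.
  apply: ler_wpM2l; first exact: powR_ge0.
  rewrite -powR_inv1 ?(ltW f0R)// -powRrM -{1}[f%:R]powRr1 ?(ltW f0R)//.
  rewrite -powRD; last by rewrite (gt_eqF f0R) implybT.
  rewrite -[leRHS](powRr0 f%:R); apply: ler_powR => //; lra.
rewrite sumr_const_nat subSS subn0 -[leLHS]mulr_natr -mulrA.
apply: ler_wpM2l; first exact: exprn_ge0.
have -> : 3 / 2 + d = (1 + d) + 2^-1 :> R by field.
rewrite [leRHS]powRD; last by rewrite (gt_eqF y0) implybT.
apply: ler_wpM2l; first exact: powR_ge0.
by rewrite powR12_sqrt ?(ltW y0)// truncn_le sqrtr_ge0.
Qed.

Lemma growth_tau_sum_sq_weighted (R : realType) : growth (natsize R) 1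
  (fun N => \sum_(1 <= b < N.+1) ((tau_sum b)%:R ^+ 2 - (tau_sum b.-1)%:R ^+ 2) / b%:R).
Proof.
pose g b : R := (tau_sum b)%:R ^+ 2 - (tau_sum b.-1)%:R ^+ 2.
have sg m : \sum_(1 <= b < m.+1) g b = (tau_sum m)%:R ^+ 2.
  rewrite big_add1/= (telescope_sumr_eq (fun b => (tau_sum b)%:R ^+ 2))//.
  by rewrite [tau_sum 0]/tau_sum big_geq// expr0n subr0.
have HG := @growth_tau_sum_sq R.
have Hi := growth_size_inv (natsize R) 1.
have Hd : growth (natsize R) (-2) (fun k => (k%:R^-1 - k.+1%:R^-1 : R)).
  apply: (@growth_bound _ _ _ _ 1) => k; rewrite ler1n => k0.
  have k0R : 0 < k%:R :> R by rewrite ltr0n.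
  have -> : k%:R `^ (-2) = (k%:R ^+ 2)^-1 :> R by rewrite -[2]/(2%:R) powR_invn.
  rewrite -[k.+1%:R]natr1.
  have k1R : 0 < k%:R + 1 :> R by rewrite addr_gt0.
  have -> : k%:R^-1 - (k%:R + 1)^-1 = (k%:R * (k%:R + 1))^-1 :> R.
    by field; rewrite (gt_eqF k0R) (gt_eqF k1R).
  rewrite ger0_norm; last by rewrite invr_ge0 mulr_ge0// ltW.
  rewrite mul1r lef_pV2 ?posrE ?mulr_gt0 ?exprn_gt0// expr2 ler_pM2l//.
  by rewrite lerDl.
have H1 := growthM HG Hi.
have H2 := growth_sum (ltac:(lra) : -1 <= 2 + -2 :> R) (growthM HG Hd).
have e1 : 2 + - 1%:R = 1 :> R by rewrite mulr1n; lra.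
have e2 : 2 + -2 + 1 = 1 :> R by lra.
rewrite e1 in H1; rewrite e2 in H2.
have H3 : growth (natsize R) 1 (fun N =>
    \sum_(1 <= k < N) (tau_sum k)%:R ^+ 2 * (k%:R^-1 - k.+1%:R^-1)).
  apply: growth_le H2 _ => N; rewrite ler1n => N0.
  apply: le_trans (ler_norm_sum _ _ _) _; apply: le_trans (ler_norm _).
  by rewrite [leRHS]big_nat_recr//= lerDl.
apply: growth_ext (growthD H1 H3) _ => N N1.
rewrite abel_sum -/g sg expr1; congr (_ + _).
by apply: eq_bigr => k _; rewrite sg.
Qed.

Lemma growth_expE (R : realType) (T : Type) (sz : T -> R) (e e' : R) (f : T -> R) :
  growth sz e f -> e = e' -> growth sz e' f.
Proof. by move=> H <-. Qed.

Lemma weighted_tau_sum_asymp (R : realType) :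
  exists p0 : R, growth id (14 / 9) (fun y : R =>
    weighted_tau_sum R (Num.truncn y) - y ^+ 2 * main_poly p0 (ln y)).
Proof.
have [l Hl] := @tau_sum_sq_gap_asymp R.
pose g := stieltjes R 0.
pose c := 2 * g - 1.
exists (2 * c ^+ 2 * g + 2 * stieltjes R 2 + l).
pose e (j : nat) (x : R) := \sum_(1 <= n < (Num.truncn x).+1) ln n%:R ^+ j / n%:R
      - ln x ^+ j.+1 / j.+1%:R - stieltjes R j.
have He j : (j <= 2)%N -> growth id (- 2^-1) (fun y => e j (Num.sqrt y)).
  move=> j2; apply: growth_expE (growth_comp_sqrt (@stieltjes_asymp R j j2)) _; lra.
pose Z (N : nat) : R := \sum_(1 <= k < N) (tau_sum k)%:R ^+ 2 * sq_inv_gap R k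
    - \sum_(1 <= k < N.+1) log_shift R k ^+ 2 / k%:R - l.
have HZ : growth id (- 2^-1) (fun y => Z (Num.truncn (Num.sqrt y))).
  apply: growth_expE (growth_comp_truncn_sqrt Hl) _; lra.
have sz2 : growth id 2 (fun y : R => y ^+ 2) := growth_size_exp (@id R) 2.
have sz1 : growth id 1 (fun y : R => y) := growth_size (@id R).
have Hln : growth id 0 (fun y : R => ln y) := growth_ln (@id R).
have low1 : 2 + - 2^-1 <= 14 / 9 :> R by lra.
have low2 : 3 / 2 <= 14 / 9 :> R by lra.
(* With H_j = sum ln^j n / n, the ranges f <= N and k < N together give ((L+c)^2 + c^2) H_0 - 2 L
   H_1 + 2 H_2; [Herr] gathers the errors of these H_j at sqrt y and of the k-sum. *)
have Herr : growth id (- 2^-1) (fun y => ((ln y + c) ^+ 2 + c ^+ 2) * e 0 (Num.sqrt y)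
    - 2 * ln y * e 1 (Num.sqrt y) + 2 * e 2 (Num.sqrt y) + Z (Num.truncn (Num.sqrt y))).
  have Hc : growth id 0 (fun y => (ln y + c) ^+ 2 + c ^+ 2).
    by apply: growthD; [apply: growthX; apply: growthD => //|]; exact: growth_cst.
  have h0 := growthM Hc (He 0%N isT); rewrite add0r in h0.
  have h1 := growthM (growthZ 2 Hln) (He 1%N isT); rewrite add0r in h1.
  exact: growthD (growthD (growthB h0 h1) (growthZ 2 (He 2%N isT))) HZ.
have H1 := growth_expW low1 (growthM sz2 Herr).
have H2 : growth id (14 / 9) (fun y : R => 2 * y * delta_log_sum y).
  apply: growth_expE (growthM (growthZ 2 sz1) (@growth_delta_log_sum R)) _; lra.
have H3 := growth_expW low2 (@growth_sum_delta_sq R).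
pose B (y : R) := let N := Num.truncn (Num.sqrt y) in
  (tau_sum N)%:R ^+ 2 * (2^-1 * y ^+ 2 / N%:R ^+ 2 - 2^-1 * (N%:R * (N%:R + 1))).
(* The two halves of the boundary term nearly cancel: y - N^2 = O(N), so D(N)^2, of size y, is
   multiplied by only O(y^(1/2)). *)
have HB : growth id (14 / 9) B.
  have k1 : growth id 1 (fun y : R => (tau_sum (Num.truncn (Num.sqrt y)))%:R ^+ 2).
    apply: growth_expE (growth_comp_truncn_sqrt (@growth_tau_sum_sq R)) _; lra.
  have k2 : growth id (2^-1) (fun y : R => (Num.truncn (Num.sqrt y))%:R).
    apply: growth_expE (growth_comp_truncn_sqrt (growth_size (natsize R))) _; lra.
  have k3 : growth id (-1) (fun y : R => ((Num.truncn (Num.sqrt y))%:R ^+ 2)^-1).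
    apply: growth_expE (growth_comp_truncn_sqrt (growth_size_inv (natsize R) 2)) _; lra.
  have k4 : growth id (2^-1) (fun y : R => y - (Num.truncn (Num.sqrt y))%:R ^+ 2).
    apply: growth_le (growthZ 3 k2) _ => y y1.
    have y0 : 0 <= y by exact: le_trans y1.
    have := leq_truncn_sqrt (Num.truncn (Num.sqrt y)) y0; rewrite leqnn => /esym h1.
    have s0 := sqrtr_ge0 y.
    have /andP[_ h2] := truncn_itv s0; move: h2; rewrite -[(Num.truncn _).+1%:R]natr1 => h2.
    have N1 : 1 <= (Num.truncn (Num.sqrt y))%:R :> R.
      by rewrite ler1n truncn_gt0 -sqrtr1 ler_sqrt.
    move: h1 h2 N1; set N := (Num.truncn _)%:R => h1 h2 N1.
    have h3 : y <= (N + 1) ^+ 2.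
      rewrite -(sqr_sqrtr y0); apply: lerXn2r; rewrite ?nnegrE ?sqrtr_ge0//; last exact: ltW.
      by rewrite addr_ge0// (le_trans ler01).
    rewrite ger0_norm ?subr_ge0// ger0_norm; last by rewrite mulr_ge0// (le_trans ler01).
    by nra.
  have k5 : growth id 1 (fun y : R => y + (Num.truncn (Num.sqrt y))%:R ^+ 2).
    apply: growthD => //.
    have := growthM k2 k2; have -> : 2^-1 + 2^-1 = 1 :> R by lra.
    by move=> H; apply: growth_ext H _ => y _; rewrite expr2.
  have k6 : growth id (2^-1) (fun y : R => 2^-1 * ((y - (Num.truncn (Num.sqrt y))%:R ^+ 2) *
      ((y + (Num.truncn (Num.sqrt y))%:R ^+ 2) * ((Num.truncn (Num.sqrt y))%:R ^+ 2)^-1))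
      - 2^-1 * (Num.truncn (Num.sqrt y))%:R).
    apply: growthB; last exact: growthZ.
    apply: growthZ; apply: growth_expE (growthM k4 (growthM k5 k3)) _; lra.
  have k7 := growthM k1 k6; have e7 : 1 + 2^-1 <= 14 / 9 :> R by lra.
  apply: growth_ext (growth_expW e7 k7) _ => y y1 /=.
  rewrite /B; congr (_ * _).
  have : (Num.truncn (Num.sqrt y))%:R != 0 :> R.
    rewrite pnatr_eq0 -lt0n truncn_gt0 -sqrtr1 ler_sqrt// (le_trans ler01)//.
  by move=> N0; field.
have Hr : growth id (14 / 9) (fun y : R => weighted_tau_sum R (Num.truncn y) -
   (\sum_(1 <= f < (Num.truncn (Num.sqrt y)).+1) f%:R * (tau_sum (Num.truncn (y / f%:R)))%:R ^+ 2
    + y ^+ 2 * \sum_(1 <= k < Num.truncn (Num.sqrt y)) (tau_sum k)%:R ^+ 2 * sq_inv_gap R k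
    + B y)).
  have := growthM sz1 (growth_comp_truncn_sqrt (@growth_tau_sum_sq_weighted R)).
  have e7 : 1 + 1 / 2 <= 14 / 9 :> R by lra.
  move=> /(growth_expW e7) H; apply: growth_le H _ => y y1.
  have [r hr ->] := weighted_tau_sum_split y1.
  rewrite addrAC subrr add0r; apply: le_trans hr _; exact: ler_norm.
apply: growth_ext (growthD (growthD (growthD (growthD Hr HB) H3) H2) H1) _ => y y1.
have y0 : 0 < y by exact: lt_le_trans y1.
have s0 : 0 < Num.sqrt y by rewrite sqrtr_gt0.
set N := Num.truncn (Num.sqrt y).
pose H j : R := \sum_(1 <= n < N.+1) ln n%:R ^+ j / n%:R.
have lsE : ln (Num.sqrt y) = 2^-1 * ln y.
  by rewrite -powR12_sqrt ?(ltW y0)// ln_powR.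
have HE j : H j = (2^-1 * ln y) ^+ j.+1 / j.+1%:R + stieltjes R j + e j (Num.sqrt y).
  by rewrite /e lsE -/N -/(H j); ring.
have s1 : \sum_(1 <= k < N) (tau_sum k)%:R ^+ 2 * sq_inv_gap R k =
    c ^+ 2 * H 0 + 2 * c * H 1 + H 2 + l + Z N.
  have -> : c ^+ 2 * H 0 + 2 * c * H 1 + H 2 = \sum_(1 <= k < N.+1) log_shift R k ^+ 2 / k%:R.
    rewrite /H !mulr_sumr -!big_split/=; apply: eq_bigr => k _.
    by rewrite /log_shift -/g -/c; ring.
  by rewrite /Z; ring.
have s2 : \sum_(1 <= f < N.+1) f%:R * (tau_sum (Num.truncn (y / f%:R)))%:R ^+ 2 =
    y ^+ 2 * ((ln y + c) ^+ 2 * H 0 - 2 * (ln y + c) * H 1 + H 2) +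
    2 * y * delta_log_sum y + \sum_(1 <= f < N.+1) f%:R * divisor_delta (y / f%:R) ^+ 2.
  rewrite /H /delta_log_sum -/N !mulr_sumr -sumrB -big_split/= mulr_sumr -!big_split/=.
  apply: eq_big_nat => f /andP[f0 _]; have f0R : 0 < f%:R :> R by rewrite ltr0n.
  rewrite tau_sum_delta -/g -/c ln_div ?posrE//.
  by move: (divisor_delta _) => D; field; rewrite gt_eqF.
rewrite -/N s2 s1 (HE 0%N) (HE 1%N) (HE 2%N).
rewrite /main_poly -/g /c.
move: (e 0%N _) (e 1%N _) (e 2%N _) (Z N) (B y) (delta_log_sum y) => e0 e1 e2 z b dl.
move: (\sum_(_ <= _ < _) _) (weighted_tau_sum _ _) (ln y) => s w L.
by field.
Qed.

(** * Moebius convolution and the zeta function at 2 *)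

(** Turns estimates on partial sums into exact identities between limits, without a theory of
    products of series. *)
Lemma growth_cst_eq0 (R : realType) (e c : R) : e < 0 ->
  growth (natsize R) e (fun=> c) -> c = 0.
Proof.
move=> e0 /growth_comp_truncn/(growth_cvg0 e0) h0.
exact: (cvg_unique (@Rhausdorff R) (cvg_cst c) h0).
Qed.

Lemma sum_powR_bounded (R : realType) (r : R) (N : nat) : 0 < r ->
  \sum_(1 <= n < N) n%:R `^ (- r - 1) <= 1 + r^-1.
Proof.
move=> r0; case: N => [|[|N]]; try by rewrite big_geq// addr_ge0// invr_ge0 ltW.
rewrite big_ltn// powR1 lerD2l; apply: le_trans (sum_powR_tail_le _ r0 (ltn0Sn 0)) _.
by rewrite powR1 mulr1.
Qed.

(* The Dirichlet series of [(-1)^j (log n)^j a n] at 2, i.e. the j-th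
   derivative at 2 of the Dirichlet series of [a]. *)
Definition dirichlet_term (R : realType) (a : nat -> R) (j n : nat) : R :=
  a n * (- ln n%:R) ^+ j / n%:R ^+ 2.

Lemma growth_dirichlet_term (R : realType) (a : nat -> R) (j : nat) :
  (forall n, `|a n| <= 1) -> growth (natsize R) (-2) (dirichlet_term a j).
Proof.
move=> a1.
have h := growthM (growthX j (growthN (growth_ln (natsize R)))) (growth_size_inv (natsize R) 2).
rewrite add0r in h; apply: growth_le h _ => n _.
rewrite /dirichlet_term -mulrA normrM -[leRHS]mul1r; apply: ler_wpM2r => //.
Qed.

(** Only half of the decay of [t] is used: N <= 2 e (N/e) gives a factor e^(1/2) N^(-1/2), and e^(-2
    + 1/4 + 1/2) is still summable. *)
Lemma growth_dirichlet_conv (R : realType) (u t : nat -> R) :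
  growth (natsize R) (-2) u -> growth (natsize R) (-1) t ->
  growth (natsize R) (- 2^-1) (fun N => \sum_(1 <= e < N.+1) u e * t (N %/ e)%N).
Proof.
move=> Hu Ht.
have d4 : 0 < 4^-1 :> R by rewrite invr_gt0.
have d2 : 0 < 2^-1 :> R by rewrite invr_gt0.
have [C C0 HC] := Hu _ d4; have [D D0 HD] := Ht _ d2.
apply: (@growth_bound _ _ _ _ (C * (D * 2) * (1 + (4^-1)^-1))) => N; rewrite ler1n => N1.
have N0R : 0 < N%:R :> R by rewrite ltr0n.
apply: le_trans (ler_norm_sum _ _ _) _.
apply: (@le_trans _ _ (\sum_(1 <= e < N.+1)
   (C * (D * 2) * N%:R `^ (- 2^-1)) * e%:R `^ (- 4^-1 - 1))).
  apply: ler_sum_nat => e /andP[e0 eN].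
  have e0R : 0 < e%:R :> R by rewrite ltr0n.
  have q1 : (0 < N %/ e)%N by rewrite divn_gt0.
  have q0R : 0 < (N %/ e)%:R :> R by rewrite ltr0n.
  have q1R : 1 <= (N %/ e)%:R :> R by rewrite ler1n.
  have Nq : N%:R <= 2 * e%:R * (N %/ e)%:R :> R.
    rewrite -!natrM ler_nat; have := ltn_ceil N e0; nia.
  rewrite normrM.
  have -> : C * (D * 2) * N%:R `^ (- 2^-1) * e%:R `^ (- 4^-1 - 1) =
    (C * e%:R `^ (-2 + 4^-1)) * (D * (2 * e%:R `^ 2^-1 * N%:R `^ (- 2^-1))).
    have -> : - 4^-1 - 1 = (-2 + 4^-1) + 2^-1 :> R by lra.
    rewrite [in LHS]powRD; last by rewrite (gt_eqF e0R) implybT.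
    by ring.
  apply: ler_pM => //; first by apply: HC; rewrite ler1n.
  apply: le_trans (HD _ q1R) _; apply: ler_wpM2l => //.
  have -> : -1 + 2^-1 = - 2^-1 :> R by lra.
  rewrite !powRN -[leLHS]div1r ler_pdivrMr ?powR_gt0// mulrAC.
  rewrite ler_pdivlMr ?powR_gt0// mul1r.
  apply: (@le_trans _ _ ((2 * e%:R * (N %/ e)%:R) `^ 2^-1)).
    by apply: ge0_ler_powR; rewrite ?nnegrE ?mulr_ge0 ?(ltW d2).
  rewrite !powRM ?mulr_ge0//; apply: ler_wpM2r; first exact: powR_ge0.
  apply: ler_wpM2r; first exact: powR_ge0.
  by apply: ler1_powR; lra.
rewrite -mulr_sumr [leRHS]mulrAC; apply: ler_wpM2l; first by rewrite !mulr_ge0 ?powR_ge0.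
exact: sum_powR_bounded.
Qed.

Definition dirichlet_value (R : realType) (a : nat -> R) (j : nat) : R :=
  limn (fun N => \sum_(1 <= n < N) dirichlet_term a j n).

Lemma dirichlet_value_asymp (R : realType) (a : nat -> R) (j : nat) :
  (forall n, `|a n| <= 1) ->
  growth (natsize R) (-1)
    (fun N => dirichlet_value a j - \sum_(1 <= n < N.+1) dirichlet_term a j n).
Proof.
move=> a1; have [l [cl Hl]] := series_growth (ltac:(lra) : -2 < -1 :> R) (growth_dirichlet_term j a1).
have e : -2 + 1 = -1 :> R by lra.
rewrite e in Hl; suff -> : dirichlet_value a j = l by [].
exact: (cvg_lim (@Rhausdorff R) cl).
Qed.

Notation mobius_value R := (@dirichlet_value R (fun n => (mobius n)%:~R)).
Notation zeta_value R := (@dirichlet_value R (fun=> 1)).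

Lemma mobius_real_le1 (R : realType) (n : nat) : `|(mobius n)%:~R : R| <= 1.
Proof. by rewrite -intr_norm -[1]/(1%:~R) ler_int mobius_norm_le1. Qed.

Lemma one_norm_le1 (R : realType) (n : nat) : `|(fun=> 1) n : R| <= 1.
Proof. by rewrite normr1. Qed.

(** [mobius_value] and [zeta_value] are the derivatives at 2 of 1/zeta and zeta. Ordering the
    products over e b <= N lets the relations from (1/zeta) zeta = 1 be read off. *)
Lemma mobius_zeta_partial (R : realType) (i j : nat) :
  growth (natsize R) (- 2^-1) (fun N =>
    \sum_(1 <= e < N.+1) dirichlet_term (fun n => (mobius n)%:~R : R) i e *
       \sum_(1 <= b < (N %/ e).+1) dirichlet_term (fun=> 1 : R) j b
    - mobius_value R i * zeta_value R j).
Proof.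
have H1 := dirichlet_value_asymp i (@mobius_real_le1 R).
have H2 := dirichlet_value_asymp j (@one_norm_le1 R).
have H3 := growth_dirichlet_conv (growth_dirichlet_term i (@mobius_real_le1 R)) H2.
have H4 := growth_expW (ltac:(lra) : -1 <= - 2^-1 :> R) (growthZ (zeta_value R j) H1).
apply: growth_ext (growthN (growthD H3 H4)) _ => N _.
under [X in _ = - (X + _)]eq_bigr do rewrite mulrBr.
rewrite sumrB -mulr_suml; ring.
Qed.

(** Grouping by k = e b, the sum of mu over the divisors of k leaves only k = 1. *)
Lemma mobius_zeta_conv (R : realType) (F : nat -> R) (N : nat) : (0 < N)%N ->
  \sum_(1 <= e < N.+1) \sum_(1 <= b < (N %/ e).+1) (mobius e)%:~R * F (e * b)%N = F 1%N.
Proof.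
move=> N0; rewrite -(sum_divisors_exchange (fun e k => (mobius e)%:~R * F k)).
rewrite big_ltn ?ltnS// big_seq1 mul1r.
rewrite big_nat_cond big1 ?addr0// => k; rewrite andbT => /andP[k1 _].
by rewrite -mulr_suml sum_mobius_real ?(ltnW k1)// gtn_eqF// mul0r.
Qed.

Lemma ln_natM (R : realType) (e b : nat) : (0 < e)%N -> (0 < b)%N ->
  ln (e * b)%:R = ln e%:R + ln b%:R :> R.
Proof. by move=> e0 b0; rewrite natrM lnM ?posrE ?ltr0n. Qed.

Lemma mobius_zeta_value0 (R : realType) : mobius_value R 0 * zeta_value R 0 = 1.
Proof.
apply/esym/eqP; rewrite -subr_eq0; apply/eqP.
apply: (@growth_cst_eq0 _ (- 2^-1)); first lra.
apply: growth_ext (@mobius_zeta_partial R 0 0) _ => N; rewrite ler1n => N0.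
congr (_ - _); rewrite -[LHS](_ : (1%:R ^+ 2)^-1 = 1); last by rewrite expr1n invr1.
rewrite -(mobius_zeta_conv (fun k => (k%:R ^+ 2)^-1) N0).
apply: eq_bigr => e _; rewrite mulr_sumr; apply: eq_bigr => b _.
by rewrite /dirichlet_term !expr0 natrM exprMn invfM; ring.
Qed.

(** First derivative of (1/zeta) zeta = 1 at 2: ln(e b) = ln e + ln b yields the two products, and
    ln 1 = 0. *)
Lemma mobius_zeta_value1 (R : realType) :
  mobius_value R 1 * zeta_value R 0 + mobius_value R 0 * zeta_value R 1 = 0.
Proof.
apply: oppr_inj; rewrite oppr0; apply: (@growth_cst_eq0 _ (- 2^-1)); first lra.
have H := growthD (@mobius_zeta_partial R 1 0) (@mobius_zeta_partial R 0 1).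
apply: growth_ext H _ => N; rewrite ler1n => N0.
have := mobius_zeta_conv (fun k => - ln k%:R / k%:R ^+ 2 : R) N0.
rewrite ln1 oppr0 mul0r => E.
rewrite addrACA -opprD -[LHS]add0r; congr (_ - _); rewrite -[LHS]E -big_split/=.
rewrite big_nat_cond [RHS]big_nat_cond; apply: eq_bigr => e /andP[/andP[e0 _] _].
rewrite !mulr_sumr -big_split/=.
rewrite big_nat_cond [RHS]big_nat_cond; apply: eq_bigr => b /andP[/andP[b0 _] _].
by rewrite /dirichlet_term !expr0 !expr1 (ln_natM R e0 b0) natrM exprMn invfM; ring.
Qed.

(** Second derivative of the same identity; squaring ln e + ln b produces the coefficient 2. *)
Lemma mobius_zeta_value2 (R : realType) :
  mobius_value R 2 * zeta_value R 0 + 2 * (mobius_value R 1 * zeta_value R 1)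
    + mobius_value R 0 * zeta_value R 2 = 0.
Proof.
apply: oppr_inj; rewrite oppr0; apply: (@growth_cst_eq0 _ (- 2^-1)); first lra.
have H := growthD (growthD (@mobius_zeta_partial R 2 0)
  (growthZ 2 (@mobius_zeta_partial R 1 1))) (@mobius_zeta_partial R 0 2).
apply: growth_ext H _ => N; rewrite ler1n => N0.
have := mobius_zeta_conv (fun k => (- ln k%:R) ^+ 2 / k%:R ^+ 2 : R) N0.
rewrite ln1 oppr0 expr0n mul0r => E.
rewrite mulrBr [X in _ = X + _]addrACA -opprD addrACA -opprD -[LHS]add0r; congr (_ - _).
rewrite -[LHS]E mulr_sumr -!big_split/=.
rewrite big_nat_cond [RHS]big_nat_cond; apply: eq_bigr => e /andP[/andP[e0 _] _].
rewrite !mulr_sumr -!big_split/=.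
rewrite big_nat_cond [RHS]big_nat_cond; apply: eq_bigr => b /andP[/andP[b0 _] _].
by rewrite /dirichlet_term !expr0 !expr1 (ln_natM R e0 b0) natrM exprMn invfM; ring.
Qed.

Definition cubic_log (R : realType) (q3 q2 q1 q0 L : R) : R :=
  q3 * L ^+ 3 + q2 * L ^+ 2 + q1 * L + q0.

Definition mobius_sum (R : realType) (F : nat -> R) (n : nat) : R :=
  \sum_(1 <= e < n.+1) (mobius e)%:~R * F (n %/ e)%N.

(** Taylor expansion of the cubic P at ln y - ln e: the new polynomial is P M_0 + P' M_1 + P'' M_2 /
    2 + P''' M_3 / 6. The shape is preserved, so the lemma can be iterated. *)
Lemma mobius_sum_asymp (R : realType) (F : nat -> R) (q3 q2 q1 q0 : R) :
  let M := mobius_value R in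
  growth id (14 / 9)
    (fun y : R => F (Num.truncn y) - y ^+ 2 * cubic_log q3 q2 q1 q0 (ln y)) ->
  growth id (14 / 9) (fun y : R => mobius_sum F (Num.truncn y) -
    y ^+ 2 * cubic_log (M 0%N * q3) (M 0%N * q2 + 3 * M 1%N * q3)
      (M 0%N * q1 + 2 * M 1%N * q2 + 3 * M 2%N * q3)
      (M 0%N * q0 + M 1%N * q1 + M 2%N * q2 + M 3%N * q3) (ln y)).
Proof.
move=> M HF.
pose E (y : R) := F (Num.truncn y) - y ^+ 2 * cubic_log q3 q2 q1 q0 (ln y).
have HE : growth id (14 / 9) (fun y : R =>
    \sum_(1 <= e < (Num.truncn y).+1) (mobius e)%:~R * E (y / e%:R)).
  move=> d d0; have [C C0 HC] := HF d d0.
  (* The errors (y/e)^(14/9+d) sum over e because 14/9 + d = r + 1 > 1. *)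
  pose r := 5 / 9 + d; have r0 : 0 < r by rewrite /r; lra.
  exists (C * (1 + r^-1)); first by rewrite mulr_ge0// addr_ge0// invr_ge0 ltW.
  move=> y y1; have y0 : 0 < y by exact: lt_le_trans y1.
  apply: le_trans (ler_norm_sum _ _ _) _.
  apply: (@le_trans _ _ (\sum_(1 <= e < (Num.truncn y).+1)
      C * y `^ (14 / 9 + d) * e%:R `^ (- r - 1))).
    apply: ler_sum_nat => e /andP[e0 eN]; rewrite normrM.
    have e0R : 0 < e%:R :> R by rewrite ltr0n.
    have ey : e%:R <= y by rewrite -truncn_ge_nat// ltW.
    have u1 : 1 <= y / e%:R by rewrite ler_pdivlMr// mul1r.
    apply: (@le_trans _ _ (1 * `|E (y / e%:R)|)).
      by apply: ler_wpM2r => //; exact: mobius_real_le1.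
    rewrite mul1r; apply: le_trans (HC _ u1) _; rewrite -mulrA; apply: ler_wpM2l => //.
    rewrite powRM ?invr_ge0 ?(ltW y0)//; apply: ler_wpM2l; first exact: powR_ge0.
    rewrite -powR_inv1 ?(ltW e0R)// -powRrM.
    have -> : -1 * (14 / 9 + d) = - r - 1 by rewrite /r; lra.
    exact: lexx.
  rewrite -mulr_sumr [leRHS]mulrAC; apply: ler_wpM2l; first by rewrite mulr_ge0 ?powR_ge0.
  exact: sum_powR_bounded.
pose P (j n : nat) : R := \sum_(1 <= e < n.+1) dirichlet_term (fun n => (mobius n)%:~R : R) j e.
(* Completing the partial sums to M_j costs y^2 times O(1/y) up to logarithms. *)
pose t (j : nat) (y : R) := M j - P j (Num.truncn y).
have Ht j : growth id (-1) (t j).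
  exact: growth_comp_truncn (dirichlet_value_asymp j (@mobius_real_le1 R)).
have Hln : growth id 0 (fun y : R => ln y) := growth_ln (@id R).
have Hlt k j : growth id (-1) (fun y => ln y ^+ k * t j y).
  by have := growthM (growthX k Hln) (Ht j); rewrite add0r.
have Hmain : growth id (-1) (fun y : R =>
     cubic_log (t 0%N y * q3) (t 0%N y * q2 + 3 * t 1%N y * q3)
      (t 0%N y * q1 + 2 * t 1%N y * q2 + 3 * t 2%N y * q3)
      (t 0%N y * q0 + t 1%N y * q1 + t 2%N y * q2 + t 3%N y * q3) (ln y)).
  have H := growthD (growthD (growthD (growthD (growthD (growthD (growthD (growthD (growthD
    (growthZ q3 (Hlt 3%N 0%N)) (growthZ q2 (Hlt 2%N 0%N)))
    (growthZ (3 * q3) (Hlt 2%N 1%N))) (growthZ q1 (Hlt 1%N 0%N)))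
    (growthZ (2 * q2) (Hlt 1%N 1%N))) (growthZ (3 * q3) (Hlt 1%N 2%N)))
    (growthZ q0 (Hlt 0%N 0%N))) (growthZ q1 (Hlt 0%N 1%N)))
    (growthZ q2 (Hlt 0%N 2%N))) (growthZ q3 (Hlt 0%N 3%N)).
  by apply: growth_ext H _ => y _; rewrite /cubic_log; ring.
have sz2 : growth id 2 (fun y : R => y ^+ 2) := growth_size_exp (@id R) 2.
have e1 : 2 + -1 <= 14 / 9 :> R by lra.
have H := growthB HE (growth_expW e1 (growthM sz2 Hmain)).
apply: growth_ext H _ => y y1; have y0 : 0 < y by exact: lt_le_trans y1.
have -> : mobius_sum F (Num.truncn y) =
    \sum_(1 <= e < (Num.truncn y).+1) (mobius e)%:~R * E (y / e%:R) +
    \sum_(1 <= e < (Num.truncn y).+1) y ^+ 2 *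
      ((mobius e)%:~R / e%:R ^+ 2 * cubic_log q3 q2 q1 q0 (ln y - ln e%:R)).
  rewrite /mobius_sum -big_split/=; apply: eq_big_nat => e /andP[e0 _].
  have e0R : 0 < e%:R :> R by rewrite ltr0n.
  rewrite /E truncn_divn ?(ltW y0)// ln_div ?posrE// expr_div_n; ring.
rewrite -mulr_sumr -addrA; congr (_ + _).
have -> : \sum_(1 <= e < (Num.truncn y).+1)
      (mobius e)%:~R / e%:R ^+ 2 * cubic_log q3 q2 q1 q0 (ln y - ln e%:R) =
   cubic_log q3 q2 q1 q0 (ln y) * P 0%N (Num.truncn y)
   + (3 * q3 * ln y ^+ 2 + 2 * q2 * ln y + q1) * P 1%N (Num.truncn y)
   + (3 * q3 * ln y + q2) * P 2%N (Num.truncn y) + q3 * P 3%N (Num.truncn y).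
  rewrite /P !mulr_sumr -!big_split/=; apply: eq_bigr => e _.
  by rewrite /dirichlet_term /cubic_log; ring.
by rewrite /t /cubic_log; ring.
Qed.

(** * Differentiating the zeta series term by term *)

Lemma expR_taylor1 (R : realType) (x : R) : `|expR x - 1 - x| <= x ^+ 2 * expR `|x|.
Proof.
have h0 : 0 <= expR x - 1 - x by have := expR_ge1Dx x; lra.
have hN := expR_ge1Dx (- x).
have ep := expR_gt0 x.
have e1 : expR x * expR (- x) = 1 by rewrite expRxMexpNx_1.
rewrite ger0_norm//; have [x0|x0] := leP 0 x.
  rewrite ger0_norm//.
  have k : expR x * (1 - x) <= 1 by rewrite -[leRHS]e1 ler_pM2l.
  nra.
have k : expR x * (1 - x) <= 1 by rewrite -[leRHS]e1 ler_pM2l.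
have a1 : 1 <= expR `|x| by rewrite -expR0 ler_expR.
apply: (@le_trans _ _ (x ^+ 2)); last by rewrite ler_peMr ?exprn_even_ge0.
have x10 : 0 < 1 - x by lra.
have : expR x <= (1 - x)^-1 by rewrite -[leRHS]mul1r ler_pdivlMr.
have : (1 - x)^-1 - 1 - x <= x ^+ 2.
  rewrite -subr_ge0.
  have -> : x ^+ 2 - ((1 - x)^-1 - 1 - x) = - x ^+ 3 / (1 - x) by field; rewrite gt_eqF.
  apply: divr_ge0; last exact: ltW.
  rewrite oppr_ge0 exprS; apply: mulr_le0_ge0; first exact: ltW.
  by rewrite exprn_even_ge0.
lra.
Qed.

Definition zeta_deriv (R : realType) (j : nat) (s : R) : R :=
  limn (fun N => \sum_(1 <= n < N) (- ln n%:R) ^+ j * n%:R `^ (- s)).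

Lemma zeta_deriv_cvg (R : realType) (j : nat) (s : R) : 1 < s ->
  \sum_(1 <= n < N) (- ln n%:R) ^+ j * n%:R `^ (- s) @[N --> \oo] --> zeta_deriv j s.
Proof.
move=> s1.
have H : growth (natsize R) (- s) (fun n => (- ln n%:R) ^+ j * n%:R `^ (- s)).
  have := growthM (growthX j (growthN (growth_ln (natsize R)))) (growth_powR (natsize R) (- s)).
  by rewrite add0r.
have [l [cl _]] := series_growth (ltac:(lra) : - s < -1) H.
suff -> : zeta_deriv j s = l by [].
exact: (cvg_lim (@Rhausdorff R) cl).
Qed.

(** A quadratic remainder, summed over n, gives the derivative at once. For s > 3/2 and |h| <= 1/4
    the factor n^|h| still leaves the convergent majorant (ln n)^(j+2) n^(-5/4). *)
Lemma zeta_deriv_increment (R : realType) (j : nat) (s : R) : 3 / 2 < s ->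
  exists2 C, 0 <= C & forall h, `|h| <= 4^-1 ->
    `|zeta_deriv j (s + h) - zeta_deriv j s - h * zeta_deriv j.+1 s| <= C * h ^+ 2.
Proof.
move=> s32.
pose u n : R := (- ln n%:R) ^+ j.+2 * n%:R `^ (- (5 / 4)).
have Hu : growth (natsize R) (- (5 / 4)) u.
  have := growthM (growthX j.+2 (growthN (growth_ln (natsize R)))) (growth_powR (natsize R) (- (5 / 4))).
  by rewrite add0r.
(* The logarithms are absorbed in n^(1/8), which leaves n^(-9/8). *)
have d8 : 0 < 8^-1 :> R by rewrite invr_gt0.
have [C C0 HC] := Hu _ d8.
exists (C * (1 + 8^-1^-1)); first by rewrite mulr_ge0// addr_ge0 ?invr_ge0.
move=> h h4.
have h4' : - 4^-1 <= h <= 4^-1 by rewrite -ler_norml.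
have /andP[h41 h42] := h4'.
have c1 := @zeta_deriv_cvg R j (s + h) ltac:(lra).
have c2 := @zeta_deriv_cvg R j s ltac:(lra).
have c3 := @zeta_deriv_cvg R j.+1 s ltac:(lra).
have c : `|\sum_(1 <= n < N) (- ln n%:R) ^+ j * n%:R `^ (- (s + h))
      - \sum_(1 <= n < N) (- ln n%:R) ^+ j * n%:R `^ (- s)
      - h * \sum_(1 <= n < N) (- ln n%:R) ^+ j.+1 * n%:R `^ (- s)| @[N --> \oo] -->
    `|zeta_deriv j (s + h) - zeta_deriv j s - h * zeta_deriv j.+1 s|.
  apply: cvg_norm; apply: cvgB; first exact: cvgB.
  by apply: cvgM => //; exact: cvg_cst.
rewrite -(cvg_lim (@Rhausdorff R) c); apply: limr_le; first by apply/cvg_ex; eexists; exact: c.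
near=> N.
rewrite mulr_sumr -!sumrB; apply: le_trans (ler_norm_sum _ _ _) _.
apply: (@le_trans _ _ (\sum_(1 <= n < N) C * h ^+ 2 * n%:R `^ (- 8^-1 - 1))).
  apply: ler_sum_nat => n /andP[n0 _].
  have n0R : 0 < n%:R :> R by rewrite ltr0n.
  have n1R : 1 <= n%:R :> R by rewrite ler1n.
  have l0 : 0 <= ln n%:R :> R by rewrite ln_ge0.
  set l : R := ln n%:R in l0 *.
  have pw (z : R) : n%:R `^ z = expR (z * l) by rewrite /powR gt_eqF.
  have -> : (- l) ^+ j * n%:R `^ (- (s + h)) - (- l) ^+ j * n%:R `^ (- s)
      - h * ((- l) ^+ j.+1 * n%:R `^ (- s)) =
     (- l) ^+ j * n%:R `^ (- s) * (expR (- (h * l)) - 1 - (- (h * l))).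
    have -> : n%:R `^ (- (s + h)) = n%:R `^ (- s) * expR (- (h * l)).
      by rewrite !pw -expRD; congr expR; ring.
    by rewrite exprS; ring.
  rewrite normrM; apply: le_trans (ler_wpM2l _ (expR_taylor1 _)) _ => //.
  have := HC n n1R; rewrite /u -/l.
  have -> : - (5 / 4) + 8^-1 = - 8^-1 - 1 :> R by lra.
  move=> HCn; rewrite [leRHS]mulrAC.
  have h20 : 0 <= h ^+ 2 by rewrite exprn_even_ge0.
  apply: le_trans (ler_wpM2r h20 HCn).
  have nl k : `|(- l) ^+ k| = l ^+ k by rewrite normrX normrN ger0_norm.
  rewrite [`|_ * n%:R `^ (- s)|]normrM [`|_ * n%:R `^ (- (5 / 4))|]normrM !nl.
  rewrite !(ger0_norm (powR_ge0 _ _)) sqrrN exprMn.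
  have -> : l ^+ j.+2 * n%:R `^ (- (5 / 4)) * h ^+ 2 =
     l ^+ j * (h ^+ 2 * l ^+ 2) * n%:R `^ (- (5 / 4)).
    by rewrite -[j.+2]addn2 exprD; ring.
  have -> : l ^+ j * n%:R `^ (- s) * (h ^+ 2 * l ^+ 2 * expR `|- (h * l)|) =
     l ^+ j * (h ^+ 2 * l ^+ 2) * (n%:R `^ (- s) * expR `|- (h * l)|) by ring.
  apply: ler_wpM2l.
    by apply: mulr_ge0; [exact: exprn_ge0 | apply: mulr_ge0 => //; exact: exprn_ge0].
  rewrite !pw -expRD ler_expR normrN normrM (ger0_norm l0) -mulrDl.
  by apply: ler_wpM2r => //; lra.
rewrite -mulr_sumr mulrAC [leRHS]mulrAC -mulrA.
apply: (@le_trans _ _ (C * h ^+ 2 * (1 + 8^-1^-1))).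
  rewrite mulrA [X in X <= _]mulrAC.
  apply: ler_wpM2l; last exact: sum_powR_bounded.
  by rewrite mulr_ge0// exprn_even_ge0.
by rewrite mulrAC.
Unshelve. all: by end_near. Qed.

Lemma is_derive_zeta_deriv (R : realType) (j : nat) (s : R) : 3 / 2 < s ->
  is_derive s 1 (@zeta_deriv R j) (zeta_deriv j.+1 s).
Proof.
move=> s32; have [C C0 HC] := zeta_deriv_increment j s32.
have cv : h^-1 *: (zeta_deriv j (h *: (1 : R) + s) - zeta_deriv j s) @[h --> (0 : R)^'] -->
    zeta_deriv j.+1 s.
  apply/cvgrPdist_le => /= e e0; near=> h.
  have h0 : h != 0 by near: h; exact: nbhs_dnbhs_neq.
  have hn0 : 0 < `|h| by rewrite normr_gt0.
  have h4 : `|h| <= 4^-1.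
    near: h; apply: dnbhs0_le; by rewrite invr_gt0.
  have hC : `|h| <= e / (C + 1).
    near: h; apply: dnbhs0_le; by rewrite divr_gt0// ltr_wpDl.
  rewrite /GRing.scale/= mulr1 [h + s]addrC distrC.
  have -> : h^-1 * (zeta_deriv j (s + h) - zeta_deriv j s) - zeta_deriv j.+1 s =
     h^-1 * (zeta_deriv j (s + h) - zeta_deriv j s - h * zeta_deriv j.+1 s).
    by field.
  rewrite normrM normfV ler_pdivrMl//; apply: le_trans (HC h h4) _.
  have -> : h ^+ 2 = `|h| * `|h|.
    by rewrite -expr2 -normrX ger0_norm ?exprn_even_ge0.
  rewrite mulrCA; apply: ler_wpM2l => //.
  apply: le_trans (ler_wpM2l C0 hC) _.
  rewrite mulrA ler_pdivrMr ?ltr_wpDl// mulrC; apply: ler_wpM2l; first exact: ltW.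
  by rewrite lerDl.
apply: DeriveDef; first by apply/cvg_ex; exists (zeta_deriv j.+1 s).
by apply: (cvg_lim (@Rhausdorff R)).
Unshelve. all: by end_near. Qed.

Lemma zeta_deriv0 (R : realType) : @zeta_deriv R 0 = @zeta R.
Proof.
apply/funext => s; rewrite /zeta_deriv /zeta; congr (lim (_ @ \oo)).
apply/funext => N; apply: eq_bigr => n _; by rewrite expr0 mul1r.
Qed.

Lemma zeta_deriv_value (R : realType) (j : nat) : zeta_deriv j (2 : R) = zeta_value R j.
Proof.
rewrite /zeta_deriv /dirichlet_value; congr (lim (_ @ \oo)).
apply/funext => N; apply: eq_bigr => n _.
have -> : n%:R `^ (- 2) = (n%:R ^+ 2)^-1 :> R by rewrite -[2]/(2%:R) powR_invn.
by rewrite /dirichlet_term mul1r.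
Qed.

Lemma zeta_value0 (R : realType) : zeta (2 : R) = zeta_value R 0.
Proof. by rewrite -zeta_deriv0 zeta_deriv_value. Qed.

Lemma zeta_derive1 (R : realType) (s : R) : 3 / 2 < s ->
  (@zeta R)^`()%classic s = zeta_deriv 1 s.
Proof.
move=> s32; rewrite -zeta_deriv0 derive1E.
by have [_ ->] := is_derive_zeta_deriv 0 s32.
Qed.

Lemma zeta_value1 (R : realType) : (@zeta R)^`()%classic 2 = zeta_value R 1.
Proof. by rewrite zeta_derive1 ?zeta_deriv_value//; lra. Qed.

Lemma zeta_value2 (R : realType) : (@zeta R)^`(2)%classic 2 = zeta_value R 2.
Proof.
have s2 : 3 / 2 < 2 :> R by lra.
rewrite derive1nS derive1n1.
have <- : zeta_deriv 2 (2 : R) = zeta_value R 2 := zeta_deriv_value R 2.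
rewrite derive1E; have [_ <-] := is_derive_zeta_deriv 1 s2.
(* The second derivative needs zeta' on a neighbourhood of 2, not only its value at 2. *)
apply: near_eq_derive.
near=> s; apply: zeta_derive1.
by near: s; apply: lt_nbhsr; lra.
Unshelve. all: by end_near. Qed.

Lemma zeta_value0_neq0 (R : realType) : zeta_value R 0 != 0.
Proof.
apply/eqP => z0; have := @mobius_zeta_value0 R; rewrite z0 mulr0 => /esym/eqP.
by rewrite oner_eq0.
Qed.

Lemma mobius_value0E (R : realType) : mobius_value R 0 = (zeta_value R 0)^-1.
Proof.
by apply: (mulIf (zeta_value0_neq0 R)); rewrite mobius_zeta_value0 mulVf// zeta_value0_neq0.
Qed.

Lemma mobius_value1E (R : realType) :
  mobius_value R 1 = - zeta_value R 1 / zeta_value R 0 ^+ 2.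
Proof.
have z0 := zeta_value0_neq0 R; have := @mobius_zeta_value1 R.
rewrite mobius_value0E => /eqP; rewrite addr_eq0 => /eqP h.
by apply: (mulIf z0); rewrite h; field.
Qed.

Lemma mobius_value2E (R : realType) :
  mobius_value R 2 =
    2 * zeta_value R 1 ^+ 2 / zeta_value R 0 ^+ 3 - zeta_value R 2 / zeta_value R 0 ^+ 2.
Proof.
have z0 := zeta_value0_neq0 R; have := @mobius_zeta_value2 R.
rewrite mobius_value0E mobius_value1E => /eqP; rewrite -addrA addr_eq0 => /eqP h.
by apply: (mulIf z0); rewrite h; field.
Qed.

(** * Subgroups of a product of two cyclic groups *)

(** In a cyclic group, taking orders is a bijection from subgroups to divisors of the group
    order. *)
Lemma sum_subgroups_cyclic (gT : finGroupType) (G : {group gT}) (F : nat -> nat) :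
  cyclic G -> (\sum_(H in subgroups G) F #|H| = \sum_(d <- divisors #|G|) F d)%N.
Proof.
move=> cG; rewrite -big_enum/=.
rewrite -(big_map (fun H : {group gT} => #|H|) xpredT F).
apply: perm_big; apply: uniq_perm.
- rewrite map_inj_in_uniq ?enum_uniq// => H K.
  rewrite !mem_enum !inE => HG KG /eqP.
  by rewrite -(eq_subG_cyclic cG HG KG) => /eqP/val_inj.
- exact: divisors_uniq.
move=> d; rewrite -dvdn_divisors ?cardG_gt0//; apply/mapP/idP.
  by move=> [H]; rewrite mem_enum inE => HG ->; exact: cardSg.
move=> dG; have /cyclicP[g gE] := cG.
exists <[(g ^+ (#|G| %/ d))%g]>%G.
  by rewrite mem_enum inE gE cycle_subG mem_cycle.
have og : #[g]%g = #|G| by rewrite orderE -gE.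
by rewrite /= -orderE orderXdiv og ?dvdn_div// divnA// mulKn// cardG_gt0.
Qed.

(** Prime by prime: the exponents of p in gcd and lcm are those in a and b, up to order. *)
Lemma totient_gcd_lcm (a b : nat) : (0 < a)%N -> (0 < b)%N ->
  (totient a * totient b = totient (gcdn a b) * totient (lcmn a b))%N.
Proof.
move=> a0 b0.
(* Local factor of the totient, equal to 1 at exponent 0, so that all four products can run over the
   same primes below N. *)
pose w p k := (if k is k'.+1 then p.-1 * p ^ k' else 1)%N.
pose N := (a * b).+1.
have tE n : (0 < n)%N -> (n < N)%N ->
    totient n = (\prod_(0 <= p < N | prime p) w p (logn p n))%N.
  move=> n0 nN; rewrite totientE//.
  have -> : (\prod_(p <- primes n) (p.-1 * p ^ (logn p n).-1) =
     \prod_(p <- primes n) w p (logn p n))%N.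
    rewrite big_seq [RHS]big_seq; apply: eq_bigr => p pn.
    by rewrite /w; move: pn; rewrite -logn_gt0; case: logn.
  rewrite [RHS](bigID (fun p => p \in primes n))/= [X in (_ * X)%N]big1 ?muln1; last first.
    by move=> p /andP[pp pn]; rewrite /w; move: pn; rewrite -logn_gt0 -eqn0Ngt => /eqP ->.
  rewrite -[RHS]big_filter; apply: perm_big; apply: uniq_perm.
  - exact: primes_uniq.
  - by rewrite filter_uniq// iota_uniq.
  move=> p; rewrite mem_filter mem_index_iota /=.
  case pn : (p \in primes n); rewrite ?andbF//.
  move: pn; rewrite mem_primes => /and3P[pp _ pdn]; rewrite pp/=.
  by rewrite (leq_ltn_trans (dvdn_leq n0 pdn)).
have aN : (a < N)%N by rewrite ltnS leq_pmulr.
have bN : (b < N)%N by rewrite ltnS leq_pmull.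
have g0 : (0 < gcdn a b)%N by rewrite gcdn_gt0 a0.
have l0 : (0 < lcmn a b)%N by rewrite lcmn_gt0 a0.
have gN : (gcdn a b < N)%N by apply: leq_ltn_trans aN; apply: dvdn_leq => //; exact: dvdn_gcdl.
have lN : (lcmn a b < N)%N.
  by rewrite ltnS -muln_lcm_gcd leq_pmulr.
rewrite !tE// -!big_split/=; apply: eq_bigr => p pp.
rewrite logn_gcd// logn_lcm//.
by case: (leqP (logn p a) (logn p b)) => _ //; rewrite mulnC.
Qed.

Lemma sum_divisors_rev (F : nat -> nat) (n : nat) : (0 < n)%N ->
  (\sum_(d <- divisors n) F (n %/ d) = \sum_(d <- divisors n) F d)%N.
Proof.
move=> n0; rewrite -(big_map (fun d => n %/ d)%N xpredT F).
have invol d : d \in divisors n -> (n %/ (n %/ d))%N = d.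
  by rewrite -dvdn_divisors// => dn; rewrite divnA// mulKn.
apply: perm_big; apply: uniq_perm.
- rewrite map_inj_in_uniq ?divisors_uniq// => d e /invol hd /invol he h.
  by rewrite -hd -he h.
- exact: divisors_uniq.
move=> d; apply/mapP/idP => [[e]|dn].
  by rewrite -!dvdn_divisors// => en ->; exact: dvdn_div.
by exists (n %/ d)%N; rewrite ?invol// -dvdn_divisors// dvdn_div// dvdn_divisors.
Qed.

Lemma card_fibers (T U : finType) (f : T -> U) (Y : {set T}) (S : {set U}) :
  (forall y, y \in Y -> f y \in S) ->
  (#|Y| = \sum_(H in S) #|[set y in Y | f y == H]%SET|)%N.
Proof.
move=> YS; rewrite -sum1_card (partition_big f (mem S))//=; apply: eq_bigr => H _.
by rewrite -sum1_card; apply: eq_bigl => y; rewrite !inE.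
Qed.

Section ProductOfCyclicGroups.
Local Open Scope group_scope.
Variables (gT1 gT2 : finGroupType) (G1 : {group gT1}) (G2 : {group gT2}).
Hypotheses (cG1 : cyclic G1) (cG2 : cyclic G2).

Let G := setX_group G1 G2.

Lemma pair_expg (x : gT1) (y : gT2) (k : nat) :
  ((x, y) : gT1 * gT2) ^+ k = (x ^+ k, y ^+ k).
Proof. by elim: k => [|k IH]; rewrite ?expg0// !expgS IH. Qed.

Lemma mem_subgroup_cyclic (gT : finGroupType) (C D : {group gT}) (y : gT) :
  cyclic C -> D \subset C -> y \in C -> (y \in D) = (#[y] %| #|D|)%N.
Proof.
move=> cC DC yC; rewrite orderE (cardSg_cyclic cC) ?cycle_subG//.
Qed.

(** In a cyclic group y^a lies in K iff the order of y divides |K| a, so the set is the subgroup of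
    order gcd(|K| a, |G2|). *)
Lemma card_pow_mem (K : {group gT2}) (a : nat) : K \subset G2 -> (0 < a)%N ->
  #|[set y in G2 | y ^+ a \in K]%SET| = (#|K| * gcdn a (#|G2| %/ #|K|))%N.
Proof.
move=> KG a0; set n := #|G2|; set k := #|K|.
have kn : (k %| n)%N := cardSg KG.
have k0 : (0 < k)%N := cardG_gt0 K.
have -> : (k * gcdn a (n %/ k))%N = gcdn (k * a) n.
  by rewrite muln_gcdr [X in gcdn _ X]mulnC divnK.
have dn : (gcdn (k * a) n %| n)%N := dvdn_gcdr _ _.
have /cyclicP[g gE] := cG2.
have og : #[g] = n by rewrite orderE -gE.
pose D := <[g ^+ (n %/ gcdn (k * a) n)]>%G.
have DG : D \subset G2 by rewrite gE cycle_subG mem_cycle.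
have cD : #|D| = gcdn (k * a) n.
  rewrite /= -orderE orderXdiv og ?dvdn_div// divnA// mulKn//.
  by rewrite -og order_gt0.
rewrite -cD; apply: eq_card => y; rewrite inE.
case yG : (y \in G2) => /=; last first.
  by apply/esym/negbTE/negP => /(fintype.subsetP DG); rewrite yG.
rewrite (mem_subgroup_cyclic cG2 KG (groupX a yG)) (mem_subgroup_cyclic cG2 DG yG) cD.
by rewrite order_dvdn -expgM -order_dvdn dvdn_gcd mulnC (order_dvdG yG) andbT.
Qed.

Let fst_im (H : {group gT1 * gT2}) : {group gT1} := (@fst gT1 gT2 @* H)%G.
Let snd_ker (H : {group gT1 * gT2}) : {group gT2} := (@pair1g gT1 gT2 @*^-1 H)%G.

Let mem_fst_im (H : {group gT1 * gT2}) x : x \in fst_im H -> exists y, (x, y) \in H.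
Proof. by move=> /morphimP[[x' y] _ xyH ->]; exists y. Qed.

Let fst_im_mem (H : {group gT1 * gT2}) x y : (x, y) \in H -> x \in fst_im H.
Proof. by move=> xyH; apply/morphimP; exists (x, y); rewrite ?inE. Qed.

Let mem_snd_ker (H : {group gT1 * gT2}) y : (y \in snd_ker H) = ((1, y) \in H).
Proof. by rewrite !inE. Qed.

Let fst_im_sub (H : {group gT1 * gT2}) : H \subset G -> fst_im H \subset G1.
Proof.
move=> HG; apply/fintype.subsetP => x /mem_fst_im[y /(fintype.subsetP HG)].
by rewrite inE => /andP[].
Qed.

Let snd_ker_sub (H : {group gT1 * gT2}) : H \subset G -> snd_ker H \subset G2.
Proof.
move=> HG; apply/fintype.subsetP => y; rewrite mem_snd_ker => /(fintype.subsetP HG).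
by rewrite inE => /andP[].
Qed.

Let abG : abelian G.
Proof.
apply/centsP => -[x y] + [x' y'] +; rewrite !inE => /andP[/= xG yG] /andP[/= x'G y'G].
have c1 := centsP (cyclic_abelian cG1) x xG x' x'G.
have c2 := centsP (cyclic_abelian cG2) y yG y' y'G.
by rewrite /commute; congr (_, _).
Qed.

Let fiber (A : {group gT1}) (K : {group gT2}) : {set {group gT1 * gT2}} :=
  [set H in subgroups G | (fst_im H == A) && (snd_ker H == K)]%SET.

(* A subgroup with first projection <[x0]> and kernel K is determined by any
   y with (x0, y) in it, and these y form a coset of K. *)
Lemma card_goursat_fiber (A : {group gT1}) (K : {group gT2}) :
  A \subset G1 -> K \subset G2 ->
  #|fiber A K| = gcdn #|A| (#|G2| %/ #|K|).
Proof.
move=> AG KG; have /cyclicP[x0 AE] := cyclicS AG cG1.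
have oA : #[x0] = #|A| by rewrite orderE AE.
have x0A : x0 \in A by rewrite AE cycle_id.
(* The possible images of the generator x0: the relation x0^|A| = 1 requires y^|A| to lie in K. *)
pose Y := [set y in G2 | y ^+ #|A| \in K]%SET.
pose Hy (y : gT2) : {group gT1 * gT2} :=
  (<[((x0, y) : gT1 * gT2)]> <*> (@pair1g gT1 gT2 @* K))%G.
have gen_in y : (x0, y) \in Hy y by rewrite mem_gen// inE cycle_id.
have ker_in y z : z \in K -> (1, z) \in Hy y.
  by move=> zK; rewrite mem_gen// inE; apply/orP; right; apply/morphimP; exists z; rewrite ?inE.
have Hy_min (H : {group gT1 * gT2}) y : (x0, y) \in H -> snd_ker H = K -> Hy y \subset H.
  move=> xyH HK; rewrite gen_subG finset.subUset cycle_subG xyH /=.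
  by apply/fintype.subsetP => _ /morphimP[z _ zK ->]; rewrite -[_ \in H]mem_snd_ker HK.
have HyG y : y \in G2 -> Hy y \subset G.
  move=> yG; rewrite gen_subG finset.subUset cycle_subG inE /= (fintype.subsetP AG)// yG /=.
  apply/fintype.subsetP => _ /morphimP[z _ zK ->].
  by rewrite inE /= group1 (fintype.subsetP KG).
have Hy_elt y h : y \in G2 -> h \in Hy y -> exists i z, z \in K /\ h = (x0 ^+ i, y ^+ i * z).
  move=> yG; rewrite /Hy /= norm_joinEl; last first.
    apply: (@fintype.subset_trans _ _ G); first by rewrite cycle_subG inE /= (fintype.subsetP AG)// yG.
    apply: (sub_abelian_norm abG).
    by apply/fintype.subsetP => _ /morphimP[z _ zK ->]; rewrite inE /= group1 (fintype.subsetP KG).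
  move=> /mulsgP[_ _ /cycleP[i ->] /morphimP[z _ zK ->] ->].
  by exists i, z; split=> //; rewrite pair_expg; congr (_, _); rewrite /= mulg1.
have HyS y : y \in Y -> Hy y \in fiber A K.
  rewrite inE => /andP[yG yK]; rewrite inE inE HyG//=.
  apply/andP; split; apply/eqP/val_inj/eqP => /=; rewrite finset.eqEsubset; apply/andP; split.
  - apply/fintype.subsetP => x /mem_fst_im[z /(Hy_elt _ _ yG)[i [w [_ [-> _]]]]].
    exact: groupX.
  - by rewrite AE cycle_subG; exact: (fst_im_mem (gen_in y)).
  - apply/fintype.subsetP => z; rewrite mem_snd_ker => /(Hy_elt _ _ yG)[i [w [wK [/esym/eqP xi ->]]]].
    move: xi; rewrite -order_dvdn oA => /dvdnP[q ->].
    by rewrite mulnC expgM groupM// groupX.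
  by apply/fintype.subsetP => z zK; rewrite mem_snd_ker; exact: ker_in.
have := card_fibers HyS; rewrite card_pow_mem// => E.
(* Each H arises from exactly one coset of K, so the fiber has |Y|/|K| elements. *)
have fib H : H \in fiber A K -> #|[set y in Y | Hy y == H]%SET| = #|K|.
  rewrite inE inE => /and3P[HG /eqP HA /eqP HK].
  have [y1 y1H] : exists y, (x0, y) \in H by apply: mem_fst_im; rewrite HA.
  have -> : [set y in Y | Hy y == H]%SET = y1 *: K.
    apply/finset.setP => y; rewrite mem_lcoset.
    have -> : (y \in [set y in Y | Hy y == H]%SET) = ((x0, y) \in H).
      rewrite inE; apply/andP/idP => [[_ /eqP <-]|xyH]; first exact: gen_in.
      have yG : y \in G2 by have := fintype.subsetP HG _ xyH; rewrite inE => /andP[].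
      split.
        rewrite inE yG /= -HK mem_snd_ker.
        have := groupX #|A| xyH; rewrite pair_expg -oA expg_order//.
      apply/eqP/val_inj/eqP; rewrite finset.eqEsubset Hy_min//=.
      apply/fintype.subsetP => -[x z] xzH.
      have : x \in A by rewrite -HA; exact: (fst_im_mem xzH).
      rewrite AE => /cycleP[i xE].
      have : (1, (y ^+ i)^-1 * z) \in H.
        have gm := groupM (groupVr (groupX i xyH)) xzH.
        suff -> : (1, (y ^+ i)^-1 * z) = ((x0, y) ^+ i)^-1 * (x, z) :> gT1 * gT2 by [].
        by rewrite pair_expg xE; congr (_, _); rewrite /= mulVg.
      rewrite -[_ \in H]mem_snd_ker HK => /(ker_in y) kz.
      have gm := groupM (groupX i (gen_in y)) kz.
      suff -> : (x, z) = (x0, y) ^+ i * (1, (y ^+ i)^-1 * z) :> gT1 * gT2 by [].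
      by rewrite pair_expg xE; congr (_, _); rewrite /= ?mulg1 ?mulKVg.
    rewrite -HK mem_snd_ker.
    apply/idP/idP => h.
      have gm := groupM (groupVr y1H) h.
      suff -> : (1, y1^-1 * y) = (x0, y1)^-1 * (x0, y) :> gT1 * gT2 by [].
      by congr (_, _); rewrite /= mulVg.
    have gm := groupM y1H h.
    suff -> : (x0, y) = (x0, y1) * (1, y1^-1 * y) :> gT1 * gT2 by [].
    by congr (_, _); rewrite /= ?mulg1 ?mulKVg.
  exact: card_lcoset.
move: E; rewrite (eq_bigr (fun=> #|K|)) => [|H HS]; last exact: fib.
by rewrite sum_nat_const mulnC => /eqP; rewrite eqn_pmul2r ?cardG_gt0// => /eqP ->.
Qed.

(** Sort the subgroups by first projection A and kernel K; replacing |G2|/|K| by b reverses the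
    divisors of |G2|. *)
Lemma card_subgroups_prod :
  (#|subgroups (finset.setX G1 G2)| =
    \sum_(a <- divisors #|G1|) \sum_(b <- divisors #|G2|) gcdn a b)%N.
Proof.
transitivity (\sum_(A in subgroups G1) \sum_(K in subgroups G2) gcdn #|A| (#|G2| %/ #|K|))%N.
  rewrite -sum1_card (partition_big fst_im (mem (subgroups G1)))/=; last first.
    by move=> H; rewrite !inE; exact: fst_im_sub.
  apply: eq_bigr => A; rewrite inE => AG.
  rewrite (partition_big snd_ker (mem (subgroups G2)))/=; last first.
    by move=> H; rewrite !inE => /andP[HG _]; exact: snd_ker_sub.
  apply: eq_bigr => K; rewrite inE => KG.
  rewrite -card_goursat_fiber// -sum1_card; apply: eq_bigl => H.
  by rewrite !inE andbA.
rewrite (sum_subgroups_cyclic (fun a => \sum_(K in subgroups G2) gcdn a (#|G2| %/ #|K|))%N cG1).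
apply: eq_bigr => a _.
rewrite (sum_subgroups_cyclic (fun k => gcdn a (#|G2| %/ k)) cG2).
exact: (sum_divisors_rev (gcdn a) (cardG_gt0 G2)).
Qed.

Let snd_im (H : {group gT1 * gT2}) : {group gT2} := (@snd gT1 gT2 @* H)%G.

Let cyc_fiber (A : {group gT1}) (B : {group gT2}) : {set {group gT1 * gT2}} :=
  [set H in subgroups G | [&& cyclic H, fst_im H == A & snd_im H == B]]%SET.

Let order_pair (x : gT1) (y : gT2) : #[((x, y) : gT1 * gT2)] = lcmn #[x] #[y].
Proof.
apply/eqP; rewrite eqn_dvd; apply/andP; split.
  rewrite order_dvdn pair_expg; apply/eqP; congr (_, _); apply/eqP; rewrite -order_dvdn.
    exact: dvdn_lcml.
  exact: dvdn_lcmr.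
have := expg_order ((x, y) : gT1 * gT2); rewrite pair_expg => -[/eqP h1 /eqP h2].
by rewrite dvdn_lcm !order_dvdn h1 h2.
Qed.

(** Double counting of generators: phi(|A|) phi(|B|) pairs generate a subgroup with projections A
    and B, and each such subgroup, of order lcm(|A|, |B|), has phi(lcm) generators.
    [totient_gcd_lcm] gives the quotient. *)
Lemma card_cyclic_fiber (A : {group gT1}) (B : {group gT2}) :
  A \subset G1 -> B \subset G2 -> #|cyc_fiber A B| = totient (gcdn #|A| #|B|).
Proof.
move=> AG BG; have /cyclicP[x0 AE] := cyclicS AG cG1.
have /cyclicP[y0 BE] := cyclicS BG cG2.
pose E := finset.setX [set x | generator <[x0]> x]%SET [set y | generator <[y0]> y]%SET.
have fst_cyc (g : gT1 * gT2) : fst_im <[g]>%G = <[g.1]>%G.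
  by apply: val_inj => /=; rewrite morphim_cycle ?inE.
have snd_cyc (g : gT1 * gT2) : snd_im <[g]>%G = <[g.2]>%G.
  by apply: val_inj => /=; rewrite morphim_cycle ?inE.
have EP (g : gT1 * gT2) : (g \in E) = (fst_im <[g]>%G == A) && (snd_im <[g]>%G == B).
  rewrite fst_cyc snd_cyc !inE /generator -AE -BE.
  by congr (_ && _); rewrite [LHS]eq_sym; apply/eqP/eqP => [h|/(congr1 val)//]; apply: val_inj.
have ES g : g \in E -> <[g]>%G \in cyc_fiber A B.
  move=> gE; have := gE; rewrite EP => /andP[hA hB].
  rewrite inE hA hB cycle_cyclic !inE cycle_subG inE.
  move: gE; rewrite inE => /andP[]; rewrite !inE => /cycle_generator h1 /cycle_generator h2.
  by rewrite (fintype.subsetP AG) ?(fintype.subsetP BG) ?AE ?BE.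
have fib H : H \in cyc_fiber A B -> #|[set g in E | <[g]>%G == H]%SET| = totient (lcmn #|A| #|B|).
  rewrite inE => /and4P[_ /cyclicP[h HE] hA hB].
  have HE' : H = <[h]>%G by apply: val_inj.
  have hE : h \in E by rewrite EP -HE' hA hB.
  have -> : [set g in E | <[g]>%G == H]%SET = [set g | generator <[h]> g]%SET.
    apply/finset.setP => g; rewrite [LHS]inE [RHS]inE /generator.
    have -> : (<[h]> == <[g]>) = (<[g]>%G == H).
      by rewrite eq_sym HE'; apply/eqP/eqP => [e|/(congr1 val)//]; apply: val_inj.
    apply/andP/idP => [[]//|e]; split=> //.
    by rewrite EP (eqP e) hA hB.
  rewrite -totient_gen; congr totient.
  rewrite [h]surjective_pairing order_pair.
  move: hE; rewrite inE !inE /generator -AE -BE => /andP[/eqP hA' /eqP hB'].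
  by rewrite !orderE -hA' -hB'.
have := card_fibers ES; rewrite (eq_bigr (fun=> totient (lcmn #|A| #|B|))) => [|H HS]; last exact: fib.
rewrite sum_nat_const cardsX -!totient_gen !orderE -AE -BE.
rewrite totient_gcd_lcm ?cardG_gt0// => /eqP.
by rewrite eqn_pmul2r ?totient_gt0 ?lcmn_gt0 ?cardG_gt0// => /eqP ->.
Qed.

Lemma card_cyclic_subgroups_prod :
  (#|[set H in subgroups (finset.setX G1 G2) | cyclic H]%SET| =
    \sum_(a <- divisors #|G1|) \sum_(b <- divisors #|G2|) totient (gcdn a b))%N.
Proof.
transitivity (\sum_(A in subgroups G1) \sum_(B in subgroups G2) totient (gcdn #|A| #|B|))%N.
  rewrite -sum1_card (partition_big fst_im (mem (subgroups G1)))/=; last first.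
    by move=> H; rewrite !inE => /andP[HG _]; exact: fst_im_sub.
  apply: eq_bigr => A; rewrite inE => AG.
  rewrite (partition_big snd_im (mem (subgroups G2)))/=; last first.
    move=> H; rewrite !inE => /andP[/andP[HG _] _].
    apply/fintype.subsetP => y /morphimP[[x y'] _ /(fintype.subsetP HG)]; rewrite inE => /andP[_ /= y'G] ->.
    exact: y'G.
  apply: eq_bigr => B; rewrite inE => BG.
  rewrite -card_cyclic_fiber// -sum1_card; apply: eq_bigl => H.
  by rewrite !inE -!andbA.
rewrite (sum_subgroups_cyclic (fun a => \sum_(B in subgroups G2) totient (gcdn a #|B|))%N cG1).
apply: eq_bigr => a _.
exact: (sum_subgroups_cyclic (fun b => totient (gcdn a b)) cG2).
Qed.

End ProductOfCyclicGroups.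

Lemma Zp_group_cyclic (n : nat) : cyclic (Zp n).
Proof.
rewrite /Zp; case: ifP => _; last exact: cyclic1.
by apply/cyclicP; exists Zp1; exact: Zp_cycle.
Qed.

Lemma nb_subgroupsE (m n : nat) : (0 < m)%N -> (0 < n)%N ->
  nb_subgroups m n = (\sum_(a <- divisors m) \sum_(b <- divisors n) gcdn a b)%N.
Proof.
move=> m0 n0; rewrite /nb_subgroups.
have := card_subgroups_prod (Zp_group_cyclic m) (Zp_group_cyclic n).
by rewrite !card_Zp.
Qed.

Lemma nb_cyclic_subgroupsE (m n : nat) : (0 < m)%N -> (0 < n)%N ->
  nb_cyclic_subgroups m n =
    (\sum_(a <- divisors m) \sum_(b <- divisors n) totient (gcdn a b))%N.
Proof.
move=> m0 n0; rewrite /nb_cyclic_subgroups.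
have := card_cyclic_subgroups_prod (Zp_group_cyclic m) (Zp_group_cyclic n).
by rewrite !card_Zp.
Qed.

(** * Summation over pairs (m, n) *)

Definition gcd_sum (R : realType) (h : nat -> R) (N : nat) : R :=
  \sum_(1 <= a < N.+1) \sum_(1 <= b < N.+1) h (gcdn a b) * ((N %/ a)%:R * (N %/ b)%:R).

Lemma sum_divisors_weight (R : realType) (F : nat -> R) (N : nat) :
  \sum_(1 <= m < N.+1) \sum_(a <- divisors m) F a =
  \sum_(1 <= a < N.+1) F a * (N %/ a)%:R.
Proof.
rewrite (sum_divisors_exchange (fun a _ => F a)); apply: eq_bigr => a _.
by rewrite sumr_const_nat subSS subn0 mulr_natr.
Qed.

Lemma pair_divisor_sumE (R : realType) (h : nat -> R) (N : nat) :
  \sum_(1 <= m < N.+1) \sum_(1 <= n < N.+1)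
    \sum_(a <- divisors m) \sum_(b <- divisors n) h (gcdn a b) = gcd_sum h N.
Proof.
under eq_bigr do rewrite exchange_big/=.
rewrite sum_divisors_weight; apply: eq_bigr => a _.
rewrite (sum_divisors_weight (fun b => h (gcdn a b))) mulr_suml; apply: eq_bigr => b _.
by rewrite -mulrA; congr (_ * _); rewrite mulrC.
Qed.

Lemma sum_dvdn_gcd (R : realType) (F : nat -> nat -> nat -> R) (N : nat) :
  \sum_(1 <= a < N.+1) \sum_(1 <= b < N.+1) \sum_(e <- divisors (gcdn a b)) F e a b =
  \sum_(1 <= e < N.+1) \sum_(1 <= a < (N %/ e).+1) \sum_(1 <= b < (N %/ e).+1)
    F e (e * a)%N (e * b)%N.
Proof.
transitivity (\sum_(1 <= a < N.+1) \sum_(1 <= e < N.+1 | (e %| a)%N)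
    \sum_(1 <= b < N.+1 | (e %| b)%N) F e a b).
  apply: eq_big_nat => a /andP[a0 aN].
  transitivity (\sum_(1 <= b < N.+1) \sum_(1 <= e < N.+1 | (e %| a)%N && (e %| b)%N) F e a b).
    apply: eq_big_nat => b /andP[b0 bN].
    have g0 : (0 < gcdn a b)%N by rewrite gcdn_gt0 a0.
    have gN : (gcdn a b <= N)%N.
      by rewrite (leq_trans (dvdn_leq a0 (dvdn_gcdl a b))).
    rewrite (@big_divisors _ _ _ N) ?g0//; apply: eq_bigl => e; exact: dvdn_gcd.
  rewrite (exchange_big_dep_nat (fun e => (e %| a)%N)) /=; last first.
    by move=> b e _ _ _ /andP[].
  rewrite big_nat_cond [RHS]big_nat_cond; apply: eq_bigr => e /andP[_ ea].
  by apply: eq_bigl => b; rewrite ea.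
rewrite (exchange_big_dep_nat xpredT)//=; apply: eq_big_nat => e /andP[e0 _].
rewrite sum_multiples//; apply: eq_bigr => a _; exact: sum_multiples.
Qed.

(** A Dirichlet factor u of h is pulled out by writing a and b as multiples of e, because N/(e a) is
    (N/e)/a in integer division. *)
Lemma gcd_sum_conv (R : realType) (h h' u : nat -> R) (N : nat) :
  (forall g, (0 < g)%N -> h g = \sum_(e <- divisors g) u e * h' (g %/ e)%N) ->
  gcd_sum h N = \sum_(1 <= e < N.+1) u e * gcd_sum h' (N %/ e)%N.
Proof.
move=> hh; rewrite /gcd_sum.
transitivity (\sum_(1 <= a < N.+1) \sum_(1 <= b < N.+1) \sum_(e <- divisors (gcdn a b))
    u e * h' (gcdn a b %/ e)%N * ((N %/ a)%:R * (N %/ b)%:R)).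
  apply: eq_big_nat => a /andP[a0 _]; apply: eq_big_nat => b _.
  by rewrite hh ?gcdn_gt0 ?a0// mulr_suml.
rewrite (sum_dvdn_gcd (fun e a b => u e * h' (gcdn a b %/ e)%N * ((N %/ a)%:R * (N %/ b)%:R))).
apply: eq_big_nat => e /andP[e0 _]; rewrite mulr_sumr; apply: eq_bigr => a _.
rewrite mulr_sumr; apply: eq_bigr => b _.
by rewrite -muln_gcdr mulKn// !divnMA -!mulrA.
Qed.

Lemma gcd_sum1 (R : realType) (N : nat) :
  gcd_sum (fun=> 1 : R) N = (tau_sum N)%:R ^+ 2.
Proof.
rewrite /gcd_sum tau_sumE natr_sum expr2 mulr_suml; apply: eq_bigr => a _.
by rewrite mulr_sumr; apply: eq_bigr => b _; rewrite mul1r.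
Qed.

(** First id = phi convolved with 1, which gives D(N/k)^2 with weight phi(k); then phi = mu
    convolved with id produces T. *)
Lemma gcd_sum_id (R : realType) (N : nat) :
  gcd_sum (fun g => g%:R : R) N = mobius_sum (weighted_tau_sum R) N.
Proof.
rewrite (@gcd_sum_conv _ _ (fun=> 1) (fun e => (totient e)%:R)); last first.
  move=> g g0; rewrite -[in LHS](sum_totient_divisors g0) natr_sum.
  by apply: eq_bigr => e _; rewrite mulr1.
transitivity (\sum_(1 <= k < N.+1) \sum_(d <- divisors k)
    (mobius d)%:~R * ((k %/ d)%:R * (tau_sum (N %/ k))%:R ^+ 2) : R).
  apply: eq_big_nat => k /andP[k0 _].
  rewrite gcd_sum1 totient_mobius// mulr_suml; apply: eq_bigr => d _.
  by rewrite mulrA.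
rewrite sum_divisors_exchange /mobius_sum; apply: eq_big_nat => d /andP[d0 _].
rewrite /weighted_tau_sum mulr_sumr; apply: eq_bigr => b _.
by rewrite mulKn// divnMA.
Qed.

Lemma pair_sum_subgroups (R : realType) (x : R) :
  pair_sum nb_subgroups x = mobius_sum (weighted_tau_sum R) (Num.truncn x).
Proof.
rewrite -gcd_sum_id -pair_divisor_sumE /pair_sum.
apply: eq_big_nat => m /andP[m0 _]; apply: eq_big_nat => n /andP[n0 _].
by rewrite nb_subgroupsE// natr_sum; apply: eq_bigr => a _; rewrite natr_sum.
Qed.

(** Here phi takes the place of id, and phi = mu convolved with id adds a second Moebius
    convolution. *)
Lemma pair_sum_cyclic (R : realType) (x : R) :
  pair_sum nb_cyclic_subgroups x =
  mobius_sum (mobius_sum (weighted_tau_sum R)) (Num.truncn x).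
Proof.
transitivity (gcd_sum (fun g => (totient g)%:R : R) (Num.truncn x)).
  rewrite -pair_divisor_sumE /pair_sum.
  apply: eq_big_nat => m /andP[m0 _]; apply: eq_big_nat => n /andP[n0 _].
  by rewrite nb_cyclic_subgroupsE// natr_sum; apply: eq_bigr => a _; rewrite natr_sum.
rewrite (@gcd_sum_conv _ _ (fun g => g%:R) (fun e => (mobius e)%:~R)); last first.
  by move=> g g0; rewrite totient_mobius.
by rewrite /mobius_sum; apply: eq_bigr => e _; rewrite gcd_sum_id.
Qed.

Definition coprime_tau_sum (R : realType) (N : nat) : R :=
  \sum_(1 <= K < N.+1) (mobius K)%:~R *
    (\sum_(1 <= m < (N %/ K).+1) (tau (K * m))%:R) ^+ 2.

Lemma coprime_tau_sumE (R : realType) (N : nat) :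
  \sum_(1 <= m < N.+1) \sum_(1 <= n < N.+1 | coprime m n) (tau m)%:R * (tau n)%:R =
  coprime_tau_sum R N.
Proof.
transitivity (\sum_(1 <= m < N.+1) \sum_(1 <= n < N.+1) \sum_(K <- divisors (gcdn m n))
    (mobius K)%:~R * ((tau m)%:R * (tau n)%:R) : R).
  apply: eq_big_nat => m /andP[m0 _]; rewrite [LHS]big_mkcond/=.
  apply: eq_big_nat => n _; rewrite -mulr_suml sum_mobius_real ?gcdn_gt0 ?m0//.
  by rewrite /coprime; case: eqP; rewrite ?mul1r ?mul0r.
rewrite sum_dvdn_gcd; apply: eq_bigr => K _.
rewrite expr2 mulr_suml mulr_sumr; apply: eq_bigr => m _.
by rewrite !mulr_sumr; apply: eq_bigr => n _.
Qed.

Lemma noncoprime_pair_sumE (R : realType) (f : nat -> nat -> nat) (x : R) :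
  (forall m n, (0 < m)%N -> (0 < n)%N -> coprime m n -> f m n = (tau m * tau n)%N) ->
  noncoprime_pair_sum f x = pair_sum f x - coprime_tau_sum R (Num.truncn x).
Proof.
move=> fc; rewrite -coprime_tau_sumE /noncoprime_pair_sum /pair_sum -sumrB.
apply: eq_big_nat => m /andP[m0 _].
rewrite [X in X - _](bigID (fun n => coprime m n))/= addrAC.
rewrite [X in _ = X - _ + _]big_nat_cond [X in _ = _ - X + _]big_nat_cond.
have -> : \sum_(1 <= n < (Num.truncn x).+1 | (1 <= n < (Num.truncn x).+1)%N && coprime m n) (f m n)%:R =
   \sum_(1 <= n < (Num.truncn x).+1 | (1 <= n < (Num.truncn x).+1)%N && coprime m n)
      (tau m)%:R * (tau n)%:R :> R.
  by apply: eq_bigr => n /andP[/andP[n0 _] mn]; rewrite fc// natrM.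
rewrite subrr add0r; apply: eq_bigl => n.
by rewrite /coprime ltn_neqAle eq_sym gcdn_gt0 m0 andbT.
Qed.

Lemma sum_one_divisors_pair (h : nat -> nat) (m n : nat) :
  (0 < m)%N -> (0 < n)%N -> h 1%N = 1%N -> coprime m n ->
  (\sum_(a <- divisors m) \sum_(b <- divisors n) h (gcdn a b) = tau m * tau n)%N.
Proof.
move=> m0 n0 h1 mn; rewrite /tau.
transitivity (\sum_(a <- divisors m) \sum_(b <- divisors n) 1)%N.
  rewrite big_seq [RHS]big_seq; apply: eq_bigr => a; rewrite -dvdn_divisors// => am.
  rewrite big_seq [RHS]big_seq; apply: eq_bigr => b; rewrite -dvdn_divisors// => bn.
  have : coprime a b by apply: coprime_dvdl am _; exact: coprime_dvdr bn mn.
  by rewrite /coprime => /eqP ->.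
by rewrite sum1_size big_const_seq count_predT iter_addn_0 mulnC.
Qed.

Lemma noncoprime_subgroups (R : realType) (x : R) :
  noncoprime_pair_sum nb_subgroups x =
    pair_sum nb_subgroups x - coprime_tau_sum R (Num.truncn x).
Proof.
apply: noncoprime_pair_sumE => m n m0 n0 mn; rewrite nb_subgroupsE//.
exact: (@sum_one_divisors_pair id).
Qed.

Lemma noncoprime_cyclic (R : realType) (x : R) :
  noncoprime_pair_sum nb_cyclic_subgroups x =
    pair_sum nb_cyclic_subgroups x - coprime_tau_sum R (Num.truncn x).
Proof.
apply: noncoprime_pair_sumE => m n m0 n0 mn; rewrite nb_cyclic_subgroupsE//.
exact: (@sum_one_divisors_pair totient).
Qed.

(** * Coprime pairs *)

(** Squarefreeness is expressed by [mobius K != 0]; the induction strips off one prime at a time. *)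
Lemma squarefree_ind (P : nat -> Prop) :
  P 1%N ->
  (forall p K, prime p -> (0 < K)%N -> ~~ (p %| K)%N -> mobius K != 0 -> P K -> P (p * K)%N) ->
  forall K, (0 < K)%N -> mobius K != 0 -> P K.
Proof.
move=> P1 PM; elim/ltn_ind => K IH K0 mK.
have [->//|K1] := eqVneq K 1%N.
have pp : prime (pdiv K) by apply: pdiv_prime; rewrite ltn_neqAle eq_sym K1.
have pK := pdiv_dvd K; move: (pdiv K) pp pK => p pp pK.
have KE : K = (p * (K %/ p))%N by rewrite mulnC divnK.
have K'0 : (0 < K %/ p)%N by rewrite divn_gt0 ?prime_gt0// dvdn_leq.
move: mK; rewrite {1}KE mobius_mul_prime//; case: ifP => // /negbT pK' mK'.
rewrite KE; apply: PM => //; first by move: mK'; rewrite oppr_eq0.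
apply: IH => //; last by move: mK'; rewrite oppr_eq0.
by rewrite ltn_Pdiv// prime_gt1.
Qed.

Lemma primes_mul_prime (p K : nat) : prime p -> (0 < K)%N -> ~~ (p %| K)%N ->
  perm_eq (primes (p * K)) (p :: primes K).
Proof.
move=> pp K0 pK; apply: uniq_perm; rewrite ?primes_uniq//=.
  by rewrite mem_primes (negbTE pK) !andbF primes_uniq.
have p0 := prime_gt0 pp.
by move=> q; rewrite inE primesM// [primes p]primes_prime// inE.
Qed.

Lemma tauE (k N : nat) : (0 < k <= N)%N -> tau k = (\sum_(1 <= d < N.+1 | (d %| k)%N) 1)%N.
Proof. by move=> kN; rewrite /tau -sum1_size; apply: (big_divisors (fun=> 1%N) kN). Qed.

(** Sort divisors by divisibility by p: with c the number of divisors of n prime to p, tau(pn) =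
    tau(n) + c and tau(n) = tau(n/p) + c, the first summand being absent when p does not divide
    n. *)
Lemma tau_mul_prime (p n : nat) : prime p -> (0 < n)%N ->
  (tau (p * n) + (if p %| n then tau (n %/ p) else 0) = 2 * tau n)%N.
Proof.
move=> pp n0; have p0 := prime_gt0 pp.
have pn0 : (0 < p * n)%N by rewrite muln_gt0 p0.
pose c := (\sum_(1 <= d < (p * n).+1 | (d %| n)%N && ~~ (p %| d)%N) 1)%N.
have h1 : tau (p * n) = (tau n + c)%N.
  rewrite (@tauE _ (p * n)) ?pn0 ?leqnn// (bigID (fun d => (p %| d)%N))/=; congr (_ + _)%N.
    under eq_bigl do rewrite andbC.
    rewrite big_mkcondr/= (sum_multiples (fun d => if (d %| p * n)%N then 1%N else 0%N) _ p0) mulKn//.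
    rewrite (@tauE _ n) ?n0 ?leqnn// [RHS]big_mkcond/=; apply: eq_bigr => b _.
    by rewrite dvdn_pmul2l.
  apply: eq_bigl => d; case pd : (p %| d)%N; rewrite ?andbF// !andbT.
  by rewrite Gauss_dvdr// coprime_sym prime_coprime// pd.
have h2 : tau n = ((if p %| n then tau (n %/ p) else 0) + c)%N.
  rewrite (@tauE _ (p * n)) ?n0 ?leq_pmull// (bigID (fun d => (p %| d)%N))/=; congr (_ + _)%N.
  under eq_bigl do rewrite andbC.
  rewrite big_mkcondr/= (sum_multiples (fun d => if (d %| n)%N then 1%N else 0%N) _ p0) mulKn//.
  case: ifP => pn.
    rewrite (@tauE _ n); last by rewrite divn_gt0// dvdn_leq//= leq_div.
    rewrite [RHS]big_mkcond/=; apply: eq_bigr => b _.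
    by rewrite dvdn_divRL// mulnC.
  rewrite big1// => b _; case: ifP => // pbn.
  by move: pn; rewrite (dvdn_trans (dvdn_mulr b (dvdnn p)) pbn).
by rewrite h1 [in RHS]h2; lia.
Qed.

Definition tau_mul_sum (R : realType) (K : nat) (y : R) : R :=
  \sum_(1 <= m < (Num.truncn y).+1) (tau (K * m))%:R.

Lemma tau_mul_sum_prime (R : realType) (p K : nat) (y : R) :
  prime p -> (0 < K)%N -> ~~ (p %| K)%N -> 0 < y ->
  tau_mul_sum (p * K) y = 2 * tau_mul_sum K y - tau_mul_sum K (y / p%:R).
Proof.
move=> pp K0 pK y0; have p0 := prime_gt0 pp.
apply/eqP; rewrite eq_sym subr_eq; apply/eqP/esym.
rewrite /tau_mul_sum truncn_divn ?(ltW y0)//.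
have -> : \sum_(1 <= m < (Num.truncn y %/ p).+1) (tau (K * m))%:R =
    \sum_(1 <= m < (Num.truncn y).+1) (if (p %| m)%N then (tau (K * (m %/ p)))%:R else 0) :> R.
  rewrite -[RHS]big_mkcond/= (sum_multiples (fun m => (tau (K * (m %/ p)))%:R) _ p0).
  by apply: eq_bigr => m _; rewrite mulKn.
rewrite -big_split mulr_sumr; apply: eq_big_nat => m /andP[m0 _]/=.
have Km0 : (0 < K * m)%N by rewrite muln_gt0 K0.
have := tau_mul_prime pp Km0; rewrite mulnA Euclid_dvdM// (negbTE pK)/= => h.
have -> : (if (p %| m)%N then (tau (K * (m %/ p)))%:R else 0) =
    (if (p %| m)%N then tau (K * m %/ p) else 0%N)%:R :> R.
  by case: ifP => // pm; rewrite muln_divA.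
by rewrite -natrD h natrM.
Qed.

Lemma Ffun_mul_prime (R : realType) (p K : nat) (s : R) :
  prime p -> (0 < K)%N -> ~~ (p %| K)%N ->
  Ffun (p * K) s = (1 - 2^-1 * p%:R `^ (- s)) * Ffun K s.
Proof.
move=> pp K0 pK; have p0 := prime_gt0 pp; rewrite /Ffun (perm_big _ (primes_mul_prime pp K0 pK)) big_cons/=.
have lpK : logn p K = 0%N.
  by apply/eqP; rewrite -leqn0 leqNgt logn_gt0 mem_primes (negbTE pK) !andbF.
congr (_ * _).
  by rewrite /eta lognM// logn_prime// eqxx lpK addn0 mul1r.
rewrite big_seq [RHS]big_seq; apply: eq_bigr => q qK.
have qp : (q == p) = false.
  by apply/eqP => qp; move: qK; rewrite qp mem_primes (negbTE pK) !andbF.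
by rewrite /eta lognM// logn_prime// qp.
Qed.

Lemma is_derive_prime_factor (R : realType) (p : nat) (s : R) : (0 < p)%N ->
  is_derive s 1 (fun s : R => 1 - 2^-1 * p%:R `^ (- s)) (2^-1 * (ln p%:R * p%:R `^ (- s))).
Proof.
move=> p0; have p0R : (p%:R == 0 :> R) = false by rewrite pnatr_eq0 gtn_eqF.
have -> : (fun s : R => 1 - 2^-1 * p%:R `^ (- s)) = (fun s : R => 1 - 2^-1 * expR (- s * ln p%:R)).
  by apply/funext => x; rewrite /powR p0R.
rewrite /powR p0R; apply: is_derive_eq; rewrite /GRing.scale/=; ring.
Qed.

Lemma is_derive_Ffun (R : realType) (K : nat) : (0 < K)%N -> mobius K != 0 ->
  is_derive (1 : R) 1 (@Ffun R K) (alpha1 R K).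
Proof.
move: K; apply: squarefree_ind => [|p K pp K0 pK _ IH].
  have FE : @Ffun R 1 = (fun=> 1) by apply/funext => s; rewrite /Ffun big_nil.
  by rewrite /alpha1 FE derive1_cst; apply: is_derive_cst.
have FE : @Ffun R (p * K) = (fun s : R => (1 - 2^-1 * p%:R `^ (- s)) * Ffun K s).
  by apply/funext => s; exact: Ffun_mul_prime.
have D1 := @is_derive_prime_factor R p 1 (prime_gt0 pp).
have D2 := is_deriveM D1 IH.
rewrite /alpha1 FE derive1E; apply: DeriveDef; first by have [] := D2.
by [].
Qed.

Lemma alpha0_mul_prime (R : realType) (p K : nat) :
  prime p -> (0 < K)%N -> ~~ (p %| K)%N ->
  alpha0 R (p * K) = (1 - 2^-1 / p%:R) * alpha0 R K.
Proof. by move=> pp K0 pK; rewrite /alpha0 Ffun_mul_prime// powR_inv1. Qed.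

Lemma alpha1_mul_prime (R : realType) (p K : nat) :
  prime p -> (0 < K)%N -> ~~ (p %| K)%N -> mobius K != 0 ->
  alpha1 R (p * K) = (1 - 2^-1 / p%:R) * alpha1 R K + 2^-1 * (ln p%:R / p%:R) * alpha0 R K.
Proof.
move=> pp K0 pK mK.
have FE : @Ffun R (p * K) = (fun s : R => (1 - 2^-1 * p%:R `^ (- s)) * Ffun K s).
  by apply/funext => s; exact: Ffun_mul_prime.
have D1 := @is_derive_prime_factor R p 1 (prime_gt0 pp).
have D2 := is_deriveM D1 (@is_derive_Ffun R K K0 mK).
rewrite {1}/alpha1 FE derive1E; have [_ ->] := D2.
by rewrite /alpha0 /GRing.scale/= powR_inv1//; ring.
Qed.

Lemma beta0_mul_prime (R : realType) (p K : nat) :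
  prime p -> (0 < K)%N -> ~~ (p %| K)%N ->
  beta0 R (p * K) = (2 - p%:R^-1) * beta0 R K.
Proof.
move=> pp K0 pK; rewrite /beta0 alpha0_mul_prime//.
have := tau_mul_prime pp K0; rewrite (negbTE pK) addn0 => ->.
by rewrite natrM; field; rewrite pnatr_eq0 -lt0n prime_gt0.
Qed.

(** Same recursion as for the coefficients of 2 D_K(y) - D_K(y/p): the term with ln p / p comes from
    ln(y/p). *)
Lemma beta1_mul_prime (R : realType) (p K : nat) :
  prime p -> (0 < K)%N -> ~~ (p %| K)%N -> mobius K != 0 ->
  beta1 R (p * K) = (2 - p%:R^-1) * beta1 R K + ln p%:R / p%:R * beta0 R K.
Proof.
move=> pp K0 pK mK; rewrite /beta1 /beta0 alpha0_mul_prime// alpha1_mul_prime//.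
have := tau_mul_prime pp K0; rewrite (negbTE pK) addn0 => ->.
by rewrite natrM; field; rewrite pnatr_eq0 -lt0n prime_gt0.
Qed.

Lemma beta0_1 (R : realType) : beta0 R 1 = 1.
Proof. by rewrite /beta0 /alpha0 /Ffun big_nil mulr1. Qed.

Lemma beta1_1 (R : realType) : beta1 R 1 = 2 * stieltjes R 0 - 1.
Proof.
have FE : @Ffun R 1 = (fun=> 1) by apply/funext => s; rewrite /Ffun big_nil.
by rewrite /beta1 /alpha0 /alpha1 FE derive1_cst addr0 !mul1r.
Qed.

Lemma prime_inv_bounds (R : realType) (p : nat) : prime p -> 0 < (p%:R^-1 : R) <= 1.
Proof.
move=> pp; have p0 : 0 < p%:R :> R by rewrite ltr0n prime_gt0.
by rewrite invr_gt0 p0 invf_le1// ler1n prime_gt0.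
Qed.

Lemma beta0_le (R : realType) (K : nat) : (0 < K)%N -> mobius K != 0 ->
  `|beta0 R K| <= 2 ^+ size (primes K).
Proof.
move: K; apply: squarefree_ind => [|p K pp K0 pK _ IH]; first by rewrite beta0_1 normr1.
rewrite beta0_mul_prime// (perm_size (primes_mul_prime pp K0 pK))/= exprS normrM.
have /andP[h1 h2] := prime_inv_bounds R pp.
by apply: ler_pM => //; rewrite ger0_norm; lra.
Qed.

Lemma beta1_le (R : realType) (K : nat) : (0 < K)%N -> mobius K != 0 ->
  `|beta1 R K| <= 2 ^+ size (primes K) * (`|2 * stieltjes R 0 - 1| + ln K%:R).
Proof.
move: K; apply: squarefree_ind => [|p K pp K0 pK mK IH].
  by rewrite beta1_1 ln1 addr0 mul1r.
rewrite beta1_mul_prime// (perm_size (primes_mul_prime pp K0 pK))/= exprS.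
have /andP[h1 h2] := prime_inv_bounds R pp.
have b0 := beta0_le R K0 mK.
have lp0 : 0 <= ln p%:R :> R by rewrite ln_ge0// ler1n prime_gt0.
rewrite (ln_natM R (prime_gt0 pp) K0); apply: le_trans (ler_normD _ _) _.
move: IH b0; move: (beta0 R K) (beta1 R K) (2 * stieltjes R 0 - 1) => b b' c0.
set w := 2 ^+ size _; set c := `|c0|; move=> IH b0.
apply: (@le_trans _ _ (2 * (w * (c + ln K%:R)) + ln p%:R * w)).
  apply: lerD.
    by rewrite normrM; apply: ler_pM => //; rewrite ger0_norm; lra.
  rewrite normrM; apply: ler_pM => //.
  by rewrite ger0_norm; [rewrite ler_piMr | rewrite mulr_ge0// ltW].
have w0 : 0 <= w by rewrite exprn_ge0.
have : 0 <= ln p%:R * w by rewrite mulr_ge0.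
move: (ln p%:R) (ln K%:R) => x z; nra.
Qed.

(** Arguments below 1 must be included, as the recursion for D_K passes from y to y/p. There
    Delta(u) = -u (ln u + c) is O(u^(3/4)), hence the condition t <= 3/4. *)
Lemma divisor_delta_le (R : realType) (t : R) : 2^-1 < t -> t <= 3 / 4 ->
  exists2 C, 0 <= C & forall u, 0 < u -> `|divisor_delta u| <= C * u `^ t.
Proof.
move=> t1 t2; have d0 : 0 < t - 2^-1 by rewrite subr_gt0.
have [C C0 HC] := @growth_divisor_delta R _ d0.
pose c := `|2 * stieltjes R 0 - 1|.
have c0 : 0 <= c by exact: normr_ge0.
have c40 : 0 <= 4 + c by lra.
exists (C + (4 + c)); first exact: addr_ge0.
move=> u u0; have [u1|u1] := leP 1 u.
  apply: le_trans (HC u u1) _; have -> : 2^-1 + (t - 2^-1) = t by lra.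
  apply: ler_wpM2r; first exact: powR_ge0.
  by rewrite lerDl.
apply: (@le_trans _ _ ((4 + c) * u `^ t)); last first.
  by apply: ler_wpM2r; rewrite ?powR_ge0// lerDr.
have -> : divisor_delta u = - (u * (ln u + (2 * stieltjes R 0 - 1))).
  rewrite /divisor_delta (_ : Num.truncn u = 0%N) ?[tau_sum 0]/tau_sum ?big_geq ?sub0r//.
  by apply: truncn_def; rewrite (ltW u0).
rewrite normrN normrM (ger0_norm (ltW u0)).
have ui1 : 1 <= u^-1 by rewrite invf_ge1// ltW.
have l4 : `|ln u| <= 4 * u `^ (- 4^-1).
  have := ln_le_powR (ltac:(lra) : 0 < 4^-1 :> R) ui1.
  rewrite invrK lnV ?posrE// -[u^-1]powR_inv1 ?(ltW u0)// -powRrM mulN1r.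
  by rewrite ler0_norm// ln_le0// ltW.
apply: (@le_trans _ _ (u * (4 * u `^ (- 4^-1) + c))).
  by rewrite ler_pM2l//; apply: le_trans (ler_normD _ _) _; rewrite lerD2r.
have u01 : 0 < u <= 1 by rewrite u0 ltW.
rewrite mulrDr [leRHS]mulrDl; apply: lerD.
  rewrite mulrCA ler_pM2l// -{1}[u]powRr1 ?(ltW u0)// -powRD; last by rewrite (gt_eqF u0) implybT.
  apply: ger_powR => //; lra.
rewrite mulrC; apply: ler_wpM2l => //.
by rewrite -{1}[u]powRr1 ?(ltW u0)//; apply: ger_powR => //; lra.
Qed.

(** Each prime multiplies the error by at most 2 + 1 = 3, since (y/p)^t <= y^t; the constant C is
    that of K = 1. *)
Lemma tau_mul_sum_asymp (R : realType) (t : R) : 2^-1 < t -> t <= 3 / 4 ->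
  exists2 C, 0 <= C & forall K, (0 < K)%N -> mobius K != 0 -> forall y : R, 0 < y ->
    `|tau_mul_sum K y - y * (beta0 R K * ln y + beta1 R K)| <=
      3 ^+ size (primes K) * (C * y `^ t).
Proof.
move=> t1 t2; have [C C0 HC] := divisor_delta_le t1 t2.
exists C => //; apply: squarefree_ind => [y y0|p K pp K0 pK mK IH y y0].
  rewrite beta0_1 beta1_1 expr0 !mul1r; apply: le_trans (HC y y0).
  rewrite le_eqVlt; apply/orP; left; apply/eqP; congr (`|_|).
  rewrite /divisor_delta /tau_mul_sum /tau_sum natr_sum.
  by congr (_ - _); apply: eq_bigr => m _; rewrite mul1n.
have p0R : 0 < p%:R :> R by rewrite ltr0n prime_gt0.
have p1R : 1 <= p%:R :> R by rewrite ler1n prime_gt0.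
have yp0 : 0 < y / p%:R by rewrite divr_gt0.
rewrite tau_mul_sum_prime// beta0_mul_prime// beta1_mul_prime//.
rewrite (perm_size (primes_mul_prime pp K0 pK))/= exprS.
have h1 := IH y y0; have := IH _ yp0; rewrite ln_div ?posrE//.
have hp : (y / p%:R) `^ t <= y `^ t.
  apply: ge0_ler_powR; rewrite ?nnegrE ?(ltW y0) ?(ltW yp0)//; first by lra.
  by rewrite ler_pdivrMr// ler_peMr// ltW.
set w := 3 ^+ _; have w0 : 0 <= w by rewrite exprn_ge0.
move=> h2; have {}h2 := le_trans h2 (ler_wpM2l w0 (ler_wpM2l C0 hp)).
move: h1 h2; set a := _ - _ => h1; set b := _ - _ => h2.
have -> : 2 * tau_mul_sum K y - tau_mul_sum K (y / p%:R) -
    y * ((2 - p%:R^-1) * beta0 R K * ln y + ((2 - p%:R^-1) * beta1 R K + ln p%:R / p%:R * beta0 R K))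
   = 2 * a - b by rewrite /a /b; ring.
apply: le_trans (ler_normB _ _) _; rewrite normrM ger0_norm//.
move: h1 h2; set z := w * _; rewrite -mulrA -/z; lra.
Qed.

Lemma prod_primes_le (K : nat) : (0 < K)%N -> (\prod_(p <- primes K) p <= K)%N.
Proof.
move=> K0; rewrite {2}(prod_prime_decomp K0) prime_decompE big_map/=.
rewrite big_seq [X in (_ <= X)%N]big_seq; apply: leq_prod => p pK.
rewrite -{1}[p]expn1 leq_exp2l ?logn_gt0//.
by move: pK; rewrite mem_primes => /andP[/prime_gt1].
Qed.

(** At most 2^k primes lie below 2^k, each giving a factor 2^k; for a prime p >= 2^k the factor is
    at most p, and the product of the primes of K is at most K. *)
Lemma exp_omega_le (k K : nat) : (0 < K)%N ->
  ((2 ^ size (primes K)) ^ k <= 2 ^ (k * 2 ^ k) * K)%N.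
Proof.
move=> K0; rewrite -expnM mulnC expnM.
rewrite -(count_predC (fun p => p < 2 ^ k)%N) expnD; apply: leq_mul.
  rewrite expnM leq_pexp2l ?expn_gt0// -size_filter -[leqRHS](size_iota 0).
  apply: uniq_leq_size; first by rewrite filter_uniq// primes_uniq.
  by move=> p; rewrite mem_filter mem_iota => /andP[].
apply: leq_trans (prod_primes_le K0).
have : all (fun p => 0 < p)%N (primes K).
  by apply/allP => p; rewrite mem_primes => /andP[/prime_gt0].
elim: (primes K) => [|p s IH] /=; first by rewrite big_nil.
move=> /andP[p0 /IH {}IH]; rewrite big_cons expnD; apply: leq_mul => //.
by case: ltnP => //= pk; rewrite expn1.
Qed.

Lemma growth_exp_omega (R : realType) (j : nat) :
  growth (natsize R) 0 (fun K => (2 ^+ size (primes K)) ^+ j).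
Proof.
apply: growthX => d d0.
(* The k-th root of [exp_omega_le] bounds 2^omega(K) by a constant times K^(1/k), with 1/k <= d. *)
pose k := (Num.truncn d^-1).+1.
have kd : d^-1 < k%:R by exact: truncnS_gt.
have k0R : 0 < k%:R :> R by rewrite ltr0n.
have kd' : k%:R^-1 <= d by rewrite invf_ple ?posrE// ltW.
exists ((2 ^ (k * 2 ^ k))%:R `^ k%:R^-1); first exact: powR_ge0.
move=> K; rewrite ler1n => K0; rewrite add0r ger0_norm ?exprn_ge0//.
have := exp_omega_le k K0; rewrite -(ler_nat R) natrM natrX natrX => h.
set w := 2 ^+ _ in h *; have w0 : 0 <= w by rewrite exprn_ge0.
apply: (@le_trans _ _ ((w ^+ k) `^ k%:R^-1)).
  by rewrite -powR_mulrn// -powRrM mulfV ?gt_eqF// powRr1.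
apply: (@le_trans _ _ (((2 ^ (k * 2 ^ k))%:R * K%:R) `^ k%:R^-1)).
  by apply: ge0_ler_powR; rewrite ?nnegrE ?invr_ge0 ?exprn_ge0 ?mulr_ge0.
rewrite powRM//; apply: ler_wpM2l; first exact: powR_ge0.
by apply: ler_powR; rewrite ?ler1n.
Qed.

(** Constant coefficient of beta_0 ln(y/K) + beta_1 as a polynomial in ln y. *)
Definition beta_shift (R : realType) (K : nat) : R := beta1 R K - beta0 R K * ln K%:R.

Lemma beta_shift_le (R : realType) (K : nat) : (0 < K)%N -> mobius K != 0 ->
  `|beta_shift R K| <= 2 ^+ size (primes K) * (`|2 * stieltjes R 0 - 1| + 2 * ln K%:R).
Proof.
move=> K0 mK; have h0 := beta0_le R K0 mK; have h1 := beta1_le R K0 mK.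
have l0 : 0 <= ln K%:R :> R by rewrite ln_ge0// ler1n.
apply: le_trans (ler_normB _ _) _; rewrite [`|_ * ln _|]normrM (ger0_norm l0).
have := ler_wpM2r l0 h0; move: h1; set w := 2 ^+ _; set c := `|2 * _ - 1|; nra.
Qed.

(** The bounds on beta_0 and beta_1 are available for squarefree K only; since mu(K) absorbs any
    power of this indicator, every beta can be multiplied by it. *)
Definition squarefree_char (R : realType) (K : nat) : R := (mobius K != 0)%:R.

Lemma mobius_squarefree_char (R : realType) (K j : nat) :
  (mobius K)%:~R = (mobius K)%:~R * squarefree_char R K ^+ j.
Proof.
rewrite /squarefree_char; case: eqP => [->|_]; first by rewrite mul0r.
by rewrite expr1n mulr1.
Qed.

Lemma growth_mobius (R : realType) : growth (natsize R) 0 (fun K => (mobius K)%:~R).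
Proof.
apply: (@growth_bound _ _ _ _ 1) => K _.
by rewrite powRr0 mulr1; exact: mobius_real_le1.
Qed.

Lemma growth_sqfree_beta0 (R : realType) :
  growth (natsize R) 0 (fun K => squarefree_char R K * beta0 R K).
Proof.
apply: growth_le (@growth_exp_omega R 1) _ => K; rewrite ler1n => K0.
rewrite /squarefree_char expr1; case: eqP => [_|/eqP mK]; first by rewrite mul0r normr0.
by rewrite mul1r [leRHS]ger0_norm ?exprn_ge0// beta0_le.
Qed.

Lemma growth_sqfree_beta_shift (R : realType) :
  growth (natsize R) 0 (fun K => squarefree_char R K * beta_shift R K).
Proof.
have H := growthM (@growth_exp_omega R 1) (growthD
  (growth_cst (natsize R) `|2 * stieltjes R 0 - 1|) (growthZ 2 (growth_ln (natsize R)))).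
rewrite addr0 in H; apply: growth_le H _ => K; rewrite ler1n => K0.
rewrite /squarefree_char expr1; case: eqP => [_|/eqP mK]; first by rewrite mul0r normr0.
have l0 : 0 <= ln K%:R :> R by rewrite ln_ge0// ler1n.
rewrite mul1r [leRHS]ger0_norm ?mulr_ge0 ?addr_ge0 ?mulr_ge0 ?exprn_ge0//.
exact: beta_shift_le.
Qed.

Lemma growth_b2_term (R : realType) : growth (natsize R) (-2) (b2_term R).
Proof.
have H := growthM (growthM (@growth_mobius R) (growthX 2 (@growth_sqfree_beta0 R)))
  (growth_size_inv (natsize R) 2).
rewrite !add0r in H; apply: growth_ext H _ => K _.
by rewrite /b2_term [in LHS](@mobius_squarefree_char R K 2) expr_div_n/=; ring.
Qed.

Lemma growth_b1_term (R : realType) : growth (natsize R) (-2) (b1_term R).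
Proof.
have H := growthZ 2 (growthM (growthM (@growth_mobius R)
  (growthM (@growth_sqfree_beta0 R) (@growth_sqfree_beta_shift R)))
  (growth_size_inv (natsize R) 2)).
rewrite !add0r in H; apply: growth_ext H _ => K _.
rewrite /b1_term [in LHS](@mobius_squarefree_char R K 2) -/(beta_shift R K)/=; ring.
Qed.

Lemma growth_b0_term (R : realType) : growth (natsize R) (-2) (b0_term R).
Proof.
have H := growthM (growthM (@growth_mobius R) (growthX 2 (@growth_sqfree_beta_shift R)))
  (growth_size_inv (natsize R) 2).
rewrite !add0r in H; apply: growth_ext H _ => K _.
by rewrite /b0_term [in LHS](@mobius_squarefree_char R K 2) -/(beta_shift R K)/=; ring.
Qed.

Lemma series_limn_growth (R : realType) (u : nat -> R) :
  let l := limn (fun N => \sum_(1 <= K < N) u K) in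
  growth (natsize R) (-2) u ->
  \sum_(1 <= K < N) u K @[N --> \oo] --> l /\
  growth (natsize R) (-1) (fun N => l - \sum_(1 <= K < N.+1) u K).
Proof.
move=> l Hu; have [l' [cl Hl]] := series_growth (ltac:(lra) : -2 < -1 :> R) Hu.
have e : -2 + 1 = -1 :> R by lra.
have -> : l = l' by exact: (cvg_lim (@Rhausdorff R) cl).
by rewrite e in Hl.
Qed.

Lemma coprime_tau_sum_error (R : realType) :
  growth id (14 / 9) (fun y : R => coprime_tau_sum R (Num.truncn y) -
    \sum_(1 <= K < (Num.truncn y).+1) (mobius K)%:~R *
      (y / K%:R * (beta0 R K * ln y + beta_shift R K)) ^+ 2).
Proof.
(* Any t slightly above 1/2 with 1 + t < 14/9 would do: 1 + t = 55/36 < 56/36. *)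
pose t : R := 19 / 36.
have t1 : 2^-1 < t by rewrite /t; lra.
have t2 : t <= 3 / 4 by rewrite /t; lra.
have [C C0 HC] := tau_mul_sum_asymp t1 t2.
pose c : R := `|2 * stieltjes R 0 - 1|.
have c0 : 0 <= c by exact: normr_ge0.
(* Every K-term of the error is at most 16^omega(K)/K times G(y); these weights sum to y^eps. *)
pose S (N : nat) : R := \sum_(1 <= K < N.+1) `|(2 ^+ size (primes K)) ^+ 4 * (K%:R ^+ 1)^-1|.
have HS : growth id 0 (fun y => S (Num.truncn y)).
  apply: growth_comp_truncn.
  have H := growthM (@growth_exp_omega R 4) (growth_size_inv (natsize R) 1).
  rewrite add0r in H; have := growth_sum (lexx _) H.
  by rewrite addrC subrr.
pose G (y : R) := 2 * C * (c + 3 * ln y) * y `^ (1 + t) + C ^+ 2 * y `^ (2 * t).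
have HG : growth id (14 / 9) G.
  apply: growthD.
    apply: growth_expW (ltac:(rewrite /t; lra) : 0 + (1 + t) <= 14 / 9) _.
    apply: growthM; last exact: growth_powR.
    apply: growthZ; apply: growthD; [exact: growth_cst | apply: growthZ; exact: growth_ln].
  apply: growth_expW (ltac:(rewrite /t; lra) : 2 * t <= 14 / 9) _.
  by apply: growthZ; exact: growth_powR.
have H := growthM HS HG; rewrite add0r in H.
apply: growth_le H _ => y y1.
have y0 : 0 < y by exact: lt_le_trans y1.
have L0 : 0 <= ln y by rewrite ln_ge0.
have G0 : 0 <= G y.
  by rewrite /G addr_ge0// ?mulr_ge0 ?powR_ge0 ?addr_ge0 ?mulr_ge0 ?exprn_ge0.
have S0 N : 0 <= S N by rewrite /S sumr_ge0.
rewrite [leRHS]ger0_norm ?mulr_ge0// /coprime_tau_sum -sumrB /S mulr_suml.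
apply: le_trans (ler_norm_sum _ _ _) _; apply: ler_sum_nat => K /andP[K0 KN].
have K0R : 0 < K%:R :> R by rewrite ltr0n.
have K1R : 1 <= K%:R :> R by rewrite ler1n.
have Ky : K%:R <= y by rewrite -truncn_ge_nat// ltW.
have u0 : 0 < y / K%:R by rewrite divr_gt0.
rewrite -truncn_divn ?(ltW y0)// -/(tau_mul_sum K (y / K%:R)) -mulrBr.
rewrite expr1 [in leRHS]ger0_norm ?divr_ge0 ?exprn_ge0 ?(ltW K0R)//.
have [->|mK] := eqVneq (mobius K) 0.
  by rewrite mul0r normr0 mulr_ge0// divr_ge0 ?exprn_ge0 ?(ltW K0R).
rewrite normrM; apply: le_trans (ler_wpM2r (normr_ge0 _) (mobius_real_le1 R K)) _.
rewrite mul1r.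
have lK : ln K%:R <= ln y by rewrite ler_ln ?posrE.
have lK0 : 0 <= ln K%:R :> R by rewrite ln_ge0.
have := HC K K0 mK _ u0; rewrite ln_div ?posrE//.
have -> : beta0 R K * (ln y - ln K%:R) + beta1 R K = beta0 R K * ln y + beta_shift R K.
  by rewrite /beta_shift; ring.
have hb : `|beta0 R K * ln y + beta_shift R K| <= 2 ^+ size (primes K) * (c + 3 * ln y).
  apply: le_trans (ler_normD _ _) _; rewrite [`|_ * ln _|]normrM (ger0_norm L0).
  have := beta_shift_le R K0 mK; have := ler_wpM2r L0 (beta0_le R K0 mK).
  rewrite -/c; set w := 2 ^+ _; have w0 : 0 <= w by rewrite exprn_ge0.
  have := ler_wpM2l w0 lK; lra.
move: hb; set w := 2 ^+ _; set v := 3 ^+ _; set M := _ + beta_shift _ _ => hb.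
set D := tau_mul_sum _ _ => hD.
have w0 : 0 <= w by rewrite exprn_ge0.
have w1 : 1 <= w by rewrite exprn_ege1// ler1n.
(* 3^omega <= 4^omega, so that all errors are powers of w = 2^omega. *)
have vw : v <= w ^+ 2.
  rewrite /v /w -exprM mulnC exprM; apply: lerXn2r; rewrite ?nnegrE//; lra.
have v0 : 0 <= v by rewrite exprn_ge0.
set X := y / K%:R * M; set E := D - X.
have -> : D ^+ 2 - X ^+ 2 = 2 * X * E + E ^+ 2 by rewrite /E; ring.
have hE : `|E| <= w ^+ 2 * (C * (y / K%:R) `^ t).
  by apply: le_trans hD _; apply: ler_wpM2r vw; rewrite mulr_ge0 ?powR_ge0.
have Kt : (y / K%:R) `^ t <= y `^ t.
  apply: ge0_ler_powR; rewrite ?nnegrE ?(ltW y0) ?(ltW u0)//; first by rewrite /t; lra.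
  by rewrite ler_pdivrMr// ler_peMr// ltW.
(* Because 2t >= 1, the squared error keeps a factor 1/K. *)
have K2t : (y / K%:R) `^ t * (y / K%:R) `^ t <= y `^ (2 * t) / K%:R.
  rewrite -powRD; last by rewrite (gt_eqF u0) implybT.
  have -> : t + t = 2 * t by lra.
  rewrite powRM ?invr_ge0 ?(ltW y0)//; apply: ler_wpM2l; first exact: powR_ge0.
  rewrite -[leRHS]powRr1 ?invr_ge0//; apply: ger_powR; last by rewrite /t; lra.
  by rewrite invr_gt0 K0R invf_le1.
have hX : `|X| <= y / K%:R * (w * (c + 3 * ln y)).
  by rewrite /X normrM (ger0_norm (ltW u0)) ler_pM2l.
apply: le_trans (ler_normD _ _) _; rewrite /G [leRHS]mulrDr; apply: lerD.
  rewrite normrM [`|2 * X|]normrM (ger0_norm (ler0n R 2)).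
  apply: (@le_trans _ _ (2 * (y / K%:R * (w * (c + 3 * ln y))) * (w ^+ 2 * (C * y `^ t)))).
    apply: ler_pM => //; first by rewrite ler_pM2l.
    apply: le_trans hE _; apply: ler_wpM2l; first by rewrite exprn_ge0.
    by apply: ler_wpM2l.
  rewrite powRD; last by rewrite (gt_eqF y0) implybT.
  rewrite powRr1 ?(ltW y0)//.
  have -> : 2 * (y / K%:R * (w * (c + 3 * ln y))) * (w ^+ 2 * (C * y `^ t)) =
    w ^+ 3 * (K%:R^-1 * (2 * C * (c + 3 * ln y) * (y * y `^ t))) by ring.
  have -> : w ^+ 4 / K%:R * (2 * C * (c + 3 * ln y) * (y * y `^ t)) =
    w ^+ 4 * (K%:R^-1 * (2 * C * (c + 3 * ln y) * (y * y `^ t))) by ring.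
  apply: ler_wpM2r; last by rewrite ler_weXn2l.
  by rewrite !mulr_ge0 ?powR_ge0 ?invr_ge0 ?addr_ge0 ?mulr_ge0 ?(ltW y0) ?(ltW K0R).
rewrite normrX expr2; apply: (@le_trans _ _ ((w ^+ 2 * (C * (y / K%:R) `^ t)) * (w ^+ 2 * (C * (y / K%:R) `^ t)))).
  exact: ler_pM.
have -> : (w ^+ 2 * (C * (y / K%:R) `^ t)) * (w ^+ 2 * (C * (y / K%:R) `^ t)) =
  w ^+ 4 * C ^+ 2 * ((y / K%:R) `^ t * (y / K%:R) `^ t) by ring.
have -> : w ^+ 4 / K%:R * (C ^+ 2 * y `^ (2 * t)) =
  w ^+ 4 * C ^+ 2 * (y `^ (2 * t) / K%:R) by ring.
by apply: ler_wpM2l; rewrite ?mulr_ge0 ?exprn_ge0.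
Qed.

Lemma coprime_tau_sum_asymp (R : realType) :
  growth id (14 / 9) (fun y : R => coprime_tau_sum R (Num.truncn y) -
    y ^+ 2 * (b2 R * ln y ^+ 2 + b1 R * ln y + b0 R)).
Proof.
have [_ /growth_comp_truncn H2] := series_limn_growth (@growth_b2_term R).
have [_ /growth_comp_truncn H1] := series_limn_growth (@growth_b1_term R).
have [_ /growth_comp_truncn H0] := series_limn_growth (@growth_b0_term R).
have Hln j : growth id 0 (fun y : R => ln y ^+ j) by apply: growthX; exact: growth_ln.
have T2 := growthM (Hln 2) H2; have T1 := growthM (Hln 1) H1; have T0 := growthM (Hln 0) H0.
have sz2 : growth id 2 (fun y : R => y ^+ 2) := growth_size_exp (@id R) 2.
have T := growthM sz2 (growthD (growthD T2 T1) T0); rewrite add0r in T.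
have e : 2 + -1 <= 14 / 9 :> R by lra.
apply: growth_ext (growthB (@coprime_tau_sum_error R) (growth_expW e T)) _ => y _.
rewrite -/(b2 R) -/(b1 R) -/(b0 R).
set N := (Num.truncn y).+1.
have -> : \sum_(1 <= K < N) (mobius K)%:~R * (y / K%:R * (beta0 R K * ln y + beta_shift R K)) ^+ 2
  = y ^+ 2 * (ln y ^+ 2 * \sum_(1 <= K < N) b2_term R K + ln y * \sum_(1 <= K < N) b1_term R K
      + \sum_(1 <= K < N) b0_term R K).
  rewrite !mulr_sumr -!big_split/= mulr_sumr; apply: eq_bigr => K _.
  by rewrite /b2_term /b1_term /b0_term -/(beta_shift R K) -!exprVn; ring.
by rewrite expr0 expr1; ring.
Qed.

(** * The Euler product for b_2 *)

Definition smooth (N k : nat) : bool :=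
  (mobius k != 0) && all (fun q => q < N)%N (primes k).

Lemma smooth1 (k : nat) : (0 < k)%N -> smooth 1 k = (k == 1)%N.
Proof.
move=> k0; have [->//|k1] := eqVneq k 1%N.
apply/negbTE/negP => /andP[_ /allP h].
have k2 : (1 < k)%N by rewrite ltn_neqAle eq_sym k1.
have pk : pdiv k \in primes k by rewrite mem_primes pdiv_prime// k0 pdiv_dvd.
by have := h _ pk; rewrite ltnS leqn0 => /eqP p0; have := pdiv_gt0 k; rewrite p0.
Qed.

Lemma smoothS (N k : nat) : ~~ ((N %| k)%N && prime N) -> smooth N.+1 k = smooth N k.
Proof.
move=> Nk; rewrite /smooth; congr (_ && _); apply: eq_in_all => q.
rewrite mem_primes => /and3P[qp _ qk].
have qN : q != N by apply: contraNneq Nk => <-; rewrite qk qp.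
by rewrite ltnS leq_eqVlt (negbTE qN).
Qed.

Lemma smooth_mul_prime (p k : nat) : prime p -> (0 < k)%N ->
  smooth p.+1 (p * k) = smooth p k.
Proof.
move=> pp k0; have [pk|pk] := boolP (p %| k)%N.
  rewrite /smooth mobius_mul_prime// pk eqxx/=; apply/esym/negbTE; rewrite negb_and; apply/orP; right.
  by apply/allPn; exists p; rewrite ?ltnn// mem_primes pp k0 pk.
rewrite -(@smoothS p k); last by rewrite (negbTE pk).
rewrite /smooth mobius_mul_prime// (negbTE pk) oppr_eq0.
by rewrite (perm_all _ (primes_mul_prime pp k0 pk))/= ltnSn.
Qed.

Lemma b2_term_mul_prime (R : realType) (p k : nat) : prime p -> (0 < k)%N -> ~~ (p %| k)%N ->
  b2_term R (p * k) = - ((2 - p%:R^-1) / p%:R) ^+ 2 * b2_term R k.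
Proof.
move=> pp k0 pk; have p0 : p%:R != 0 :> R by rewrite pnatr_eq0 -lt0n prime_gt0.
have k0R : k%:R != 0 :> R by rewrite pnatr_eq0 -lt0n.
rewrite /b2_term mobius_mul_prime// (negbTE pk) beta0_mul_prime// rmorphN/= natrM.
by field; rewrite p0 k0R.
Qed.

(** Squarefree numbers with all prime factors at most N form a finite set, so the sum stabilises. A
    new prime p multiplies it by 1 - ((2 - 1/p)/p)^2, which is the Euler factor. *)
Lemma smooth_sum_b2_term (R : realType) (N : nat) :
  exists B, forall M, (B <= M)%N ->
    \sum_(1 <= k < M.+1 | smooth N.+1 k) b2_term R k =
    \prod_(1 <= p < N.+1 | prime p)
      (1 - 4 / p%:R ^+ 2 + 4 / p%:R ^+ 3 - 1 / p%:R ^+ 4).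
Proof.
elim: N => [|p [B IH]].
  exists 1%N => M M1; rewrite [RHS]big_geq//.
  rewrite big_nat_cond (eq_bigl (fun k => (1 <= k < M.+1)%N && (k == 1)%N)); last first.
    by move=> k; apply: andb_id2l => /andP[k0 _]; exact: smooth1.
  rewrite -big_nat_cond big_ltn_cond// big_nat_cond big1; last first.
    by move=> k /andP[/andP[k1 _] /eqP k1']; rewrite k1' in k1.
  by rewrite addr0 /b2_term beta0_1 divr1 expr1n mulr1.
set q := p.+1; exists (q * B)%N => M BM.
have q0 : (0 < q)%N by [].
have BM1 : (B <= M)%N by apply: leq_trans BM; rewrite leq_pmull.
have BM2 : (B <= M %/ q)%N by rewrite leq_divRL// mulnC.
rewrite [RHS]big_mkcond [RHS]big_nat_recr//= -[in RHS]big_mkcond/=.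
rewrite (bigID (fun k => (q %| k)%N && prime q))/=; case: ifP => pq; last first.
  rewrite big1 ?add0r; last by move=> k; rewrite !andbF.
  rewrite mulr1 -(IH M BM1).
  by apply: eq_bigl => k; rewrite andbF andbT smoothS// pq andbF.
have -> : \sum_(1 <= k < M.+1 | smooth q.+1 k && ((q %| k)%N && true)) b2_term R k =
    - ((2 - q%:R^-1) / q%:R) ^+ 2 * \sum_(1 <= k < (M %/ q).+1 | smooth q k) b2_term R k.
  under eq_bigl do rewrite andbT andbC.
  rewrite big_mkcondr/= sum_multiples// mulr_sumr [RHS]big_mkcond/=.
  apply: eq_big_nat => k /andP[k0 _]; rewrite smooth_mul_prime//.
  case: ifP => // /andP[_ /allP sk]; rewrite b2_term_mul_prime//.
  apply/negP => qk; have : q \in primes k by rewrite mem_primes pq k0 qk.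
  by move/sk; rewrite ltnn.
have -> : \sum_(1 <= k < M.+1 | smooth q.+1 k && ~~ ((q %| k)%N && true)) b2_term R k =
    \sum_(1 <= k < M.+1 | smooth q k) b2_term R k.
  rewrite big_mkcond [RHS]big_mkcond; apply: eq_big_nat => k /andP[k0 _].
  rewrite andbT; have [qk|qk] := boolP (q %| k)%N.
    rewrite andbF; case: ifP => // /andP[_ /allP sk].
    have : q \in primes k by rewrite mem_primes pq k0 qk.
    by move/sk; rewrite ltnn.
  by rewrite andbT smoothS// (negbTE qk).
rewrite (IH _ BM1) (IH _ BM2); set P := \prod_(_ <= _ < _ | _) _.
by field; rewrite pnatr_eq0.
Qed.

(** All squarefree k <= N occur in the smooth sum, so the gap consists of terms with k > N and is
    bounded by a tail. *)
Lemma euler_product_gap (R : realType) :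
  growth (natsize R) (- 2^-1) (fun N =>
    \prod_(1 <= p < N.+1 | prime p)
      (1 - 4 / p%:R ^+ 2 + 4 / p%:R ^+ 3 - 1 / p%:R ^+ 4)
    - \sum_(1 <= K < N.+1) b2_term R K).
Proof.
have h2 : 0 < 2^-1 :> R by rewrite invr_gt0.
have [C C0 HC] := growth_b2_term h2.
apply: (@growth_bound _ _ _ _ (C * (2^-1)^-1)) => N; rewrite ler1n => N0.
have [B HB] := smooth_sum_b2_term R N.
pose M := maxn B N; rewrite -(HB M (leq_maxl _ _)).
have NM : (N <= M)%N := leq_maxr _ _.
rewrite big_mkcond (big_cat_nat (n := N.+1))//= addrAC.
have -> : \sum_(1 <= k < N.+1) (if smooth N.+1 k then b2_term R k else 0) =
    \sum_(1 <= K < N.+1) b2_term R K.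
  apply: eq_big_nat => k /andP[k0 kN]; case: ifP => // /negbT; rewrite negb_and => /orP[].
    by rewrite negbK => /eqP mk; rewrite /b2_term mk mul0r.
  move=> /allPn[q]; rewrite mem_primes => /and3P[_ _ qk]; rewrite -leqNgt => /leq_trans/(_ (dvdn_leq k0 qk)).
  by rewrite leqNgt kN.
rewrite subrr add0r; apply: le_trans (ler_norm_sum _ _ _) _.
apply: (@le_trans _ _ (\sum_(N.+1 <= k < M.+1) C * k%:R `^ (- 2^-1 - 1))); last first.
  by rewrite -mulr_sumr -mulrA; apply: ler_wpM2l => //; apply: sum_powR_tail_le.
apply: ler_sum_nat => k /andP[Nk _]; have k1 : 1 <= k%:R :> R by rewrite ler1n (leq_trans _ Nk).
case: ifP => _; last by rewrite normr0 mulr_ge0// powR_ge0.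
have -> : - 2^-1 - 1 = -2 + 2^-1 :> R by lra.
exact: HC.
Qed.

Lemma euler_product_cvg (R : realType) :
  \prod_(1 <= p < N | prime p)
    (1 - 4 / p%:R ^+ 2 + 4 / p%:R ^+ 3 - 1 / p%:R ^+ 4) @[N --> \oo] --> b2 R.
Proof.
have n2 : - 2^-1 < 0 :> R by lra.
have := @euler_product_gap R; set D := (X in growth _ _ X).
move=> /growth_comp_truncn/(growth_cvg0 n2) H.
have {}H : D N @[N --> \oo] --> (0 : R).
  have := cvg_comp (fun N : nat => N%:R : R) _ (@cvgr_idn R) H.
  by rewrite (_ : _ \o _ = D)//; apply/funext => N /=; rewrite natrK.
have c2 : \sum_(1 <= K < N.+1) b2_term R K @[N --> \oo] --> b2 R.
  rewrite (cvg_shiftS (fun N => \sum_(1 <= K < N) b2_term R K)).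
  by have [] := series_limn_growth (@growth_b2_term R).
rewrite -cvg_shiftS -[b2 R]add0r.
have -> : [sequence \prod_(1 <= p < n.+1 | prime p)
    (1 - 4 / p%:R ^+ 2 + 4 / p%:R ^+ 3 - 1 / p%:R ^+ 4) : R]_n =
    (fun N => D N + \sum_(1 <= K < N.+1) b2_term R K).
  by apply/funext => N; rewrite /D subrK.
exact: cvgD.
Qed.

(** * Assembling the asymptotic formulas *)

Lemma pair_sum_subgroups_asymp (R : realType) :
  exists q0 : R, growth id (14 / 9) (fun y : R => pair_sum nb_subgroups y -
    y ^+ 2 * cubic_log (A3 R) (A2 R) (A1 R) q0 (ln y)) /\
  exists q0' : R, growth id (14 / 9) (fun y : R => pair_sum nb_cyclic_subgroups y -
    y ^+ 2 * cubic_log (B3 R) (B2 R) (B1 R) q0' (ln y)).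
Proof.
have [p0 H] := @weighted_tau_sum_asymp R; rewrite /main_poly in H.
(* One convolution for all subgroups, two for cyclic ones; the coefficients then match A_r and B_r
   through the derivatives of 1/zeta at 2. *)
have H1 := mobius_sum_asymp H; have H2 := mobius_sum_asymp H1.
have z0 := zeta_value0_neq0 R.
have a3 : mobius_value R 0 * 3^-1 = A3 R.
  by rewrite /A3 zeta_value0 mobius_value0E; field.
have a2 : mobius_value R 0 * (3 * stieltjes R 0 - 1) + 3 * mobius_value R 1 * 3^-1 = A2 R.
  by rewrite /A2 /zeta1q zeta_value0 zeta_value1 mobius_value0E mobius_value1E; field.
have a1 : mobius_value R 0 * (8 * stieltjes R 0 ^+ 2 - 6 * stieltjes R 0 - 2 * stieltjes R 1 + 1)
    + 2 * mobius_value R 1 * (3 * stieltjes R 0 - 1) + 3 * mobius_value R 2 * 3^-1 = A1 R.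
  rewrite /A1 /zeta1q /zeta2q zeta_value0 zeta_value1 zeta_value2.
  by rewrite mobius_value0E mobius_value1E mobius_value2E; field.
rewrite a3 a2 a1 in H1 H2.
have b3 : mobius_value R 0 * A3 R = B3 R.
  by rewrite /A3 /B3 zeta_value0 mobius_value0E; field.
have b2 : mobius_value R 0 * A2 R + 3 * mobius_value R 1 * A3 R = B2 R.
  by rewrite /A2 /A3 /B2 /zeta1q zeta_value0 zeta_value1 mobius_value0E mobius_value1E; field.
have b1 : mobius_value R 0 * A1 R + 2 * mobius_value R 1 * A2 R + 3 * mobius_value R 2 * A3 R = B1 R.
  rewrite /A1 /A2 /A3 /B1 /zeta1q /zeta2q zeta_value0 zeta_value1 zeta_value2.
  by rewrite mobius_value0E mobius_value1E mobius_value2E; field.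
rewrite b3 b2 b1 in H2.
eexists; split; last eexists.
  by apply: growth_ext H1 _ => y _; rewrite pair_sum_subgroups.
by apply: growth_ext H2 _ => y _; rewrite pair_sum_cyclic.
Qed.

Lemma constant_coefficient_cvg (R : realType) (S : R -> R) (q3 q2 q1 q0 : R) :
  growth id (14 / 9) (fun y : R => S y - y ^+ 2 * cubic_log q3 q2 q1 q0 (ln y)) ->
  (S x / x ^+ 2 - (q1 * ln x + q2 * ln x ^+ 2 + q3 * ln x ^+ 3) : R) @[x --> +oo] --> q0.
Proof.
move=> H; have e : 14 / 9 + - 2%:R < 0 :> R by lra.
have := growth_cvg0 e (growthM H (growth_size_inv (@id R) 2)) => /= /cvgD/(_ (cvg_cst q0)).
rewrite add0r; apply: cvg_trans; apply: near_eq_cvg; near=> x.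
have x0 : 0 < x by near: x; exact: nbhs_pinfty_gt.
by rewrite fctE /cubic_log; field; rewrite gt_eqF.
Unshelve. all: by end_near.
Qed.

Lemma growth_eqO (R : realType) (e e' : R) (f g : R -> R) : e < e' ->
  growth id e (fun x => f x - g x) ->
  f = g +O_ (+oo : set_system R) (fun x : R => x `^ e').
Proof.
move=> ee' H; have d0 : 0 < e' - e by rewrite subr_gt0.
have [C C0 HC] := H _ d0; apply/eqaddOP; near=> k; near=> x.
have x1 : 1 <= x by near: x; apply: nbhs_pinfty_ge; exact: num_real.
apply: le_trans (HC x x1) _; rewrite /= subrKC ger0_norm ?powR_ge0//.
apply: ler_wpM2r; first exact: powR_ge0.
by near: k; apply: nbhs_pinfty_ge; exact: num_real.
Unshelve. all: by end_near.
Qed.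

Theorem theorem3 (R : realType) :
  (cvg (A0_fun x @[x --> (+oo : set_system R)]) /\
   cvg (B0_fun x @[x --> (+oo : set_system R)])) /\
  (\sum_(1 <= K < N) b2_term R K @[N --> \oo] --> b2 R /\
   \prod_(1 <= p < N | prime p)
     (1 - 4 / p%:R ^+ 2 + 4 / p%:R ^+ 3 - 1 / p%:R ^+ 4) @[N --> \oo] --> b2 R /\
   \sum_(1 <= K < N) b1_term R K @[N --> \oo] --> b1 R /\
   \sum_(1 <= K < N) b0_term R K @[N --> \oo] --> b0 R) /\
  forall eps : R, 0 < eps ->
    noncoprime_pair_sum nb_subgroups =
      (fun x : R => x ^+ 2 *
         (C0 R + C1 R * ln x + C2 R * ln x ^+ 2 + C3 R * ln x ^+ 3))
      +O_ (+oo : set_system R) (fun x : R => x `^ (1117 / 701 + eps)) /\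
    noncoprime_pair_sum nb_cyclic_subgroups =
      (fun x : R => x ^+ 2 *
         (D0 R + D1 R * ln x + D2 R * ln x ^+ 2 + D3 R * ln x ^+ 3))
      +O_ (+oo : set_system R) (fun x : R => x `^ (1117 / 701 + eps)).
Proof.
have [a0 [HA [b0' HB]]] := @pair_sum_subgroups_asymp R.
have cA := constant_coefficient_cvg HA; have cB := constant_coefficient_cvg HB.
(* The unknown constants of the expansions are identified with the limits, whose existence is proved
   on the way. *)
have A0E : A0 R = a0 by exact: (cvg_lim (@Rhausdorff R) cA).
have B0E : B0 R = b0' by exact: (cvg_lim (@Rhausdorff R) cB).
split; first by split; apply/cvg_ex; [exists a0 | exists b0'].
split.
  split; first by have [] := series_limn_growth (@growth_b2_term R).
  split; first exact: euler_product_cvg.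
  by split; [have [] := series_limn_growth (@growth_b1_term R)
            | have [] := series_limn_growth (@growth_b0_term R)].
(* 14/9 < 1117/701 since 14 * 701 = 9814 < 10053 = 9 * 1117. *)
move=> eps eps0; have ee : 14 / 9 < 1117 / 701 + eps by lra.
split; apply: growth_eqO ee _.
  apply: growth_ext (growthB HA (@coprime_tau_sum_asymp R)) _ => x _.
  by rewrite noncoprime_subgroups /C0 /C1 /C2 /C3 A0E /cubic_log; ring.
apply: growth_ext (growthB HB (@coprime_tau_sum_asymp R)) _ => x _.
by rewrite noncoprime_cyclic /D0 /D1 /D2 /D3 B0E /cubic_log; ring.
Qed.
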